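(* Let $n\geq 2$, let $\mathfrak{w}$ be a proper (real) subspace of $\mathfrak{g}_\alpha$, let $W_{\mathfrak{w}}=S_{\mathfrak{w}}\cdot o\subset\mathbb{C}H^n$ be the orbit through $o$ of the connected subgroup $S_{\mathfrak{w}}$ of $SU(1,n)$ with Lie algebra $\mathfrak{s}_{\mathfrak{w}}=\mathfrak{a}\oplus\mathfrak{w}\oplus\mathfrak{g}_{2\alpha}$, and for $r>0$ let $M^r$ be the tube of radius $r$ around $W_{\mathfrak{w}}$. Then, for every $r>0$, the principal curvatures of $M^r$ are constant if and only if $\mathfrak{w}^\perp=\mathfrak{g}_\alpha\ominus\mathfrak{w}$ has constant Kähler angle.
   Context: $\mathbb{C}H^n$ is the complex hyperbolic space of constant holomorphic sectional curvature $-1$, written as $G/K$ with $G=SU(1,n)$ and $K=S(U(1)U(n))$ the isotropy group at a point $o\in\mathbb{C}H^n$; $\mathfrak{g}$ and $\mathfrak{k}$ are the Lie algebras of $G$ and $K$, $\mathfrak{g}=\mathfrak{k}\oplus\mathfrak{p}$ is the Cartan decomposition with respect to $o$, $\mathfrak{a}\subset\mathfrak{p}$ is a maximal abelian subspace (1-dimensional), and $\mathfrak{g}=\mathfrak{g}_{-2\alpha}\oplus\mathfrak{g}_{-\alpha}\oplus\mathfrak{g}_{0}\oplus\mathfrak{g}_{\alpha}\oplus\mathfrak{g}_{2\alpha}$ is the root space decomposition with respect to $\mathfrak{a}$, with the roots ordered so that $\alpha$ is positive. Put $\mathfrak{n}=\mathfrak{g}_\alpha\oplus\mathfrak{g}_{2\alpha}$,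 so that $\mathfrak{g}=\mathfrak{k}\oplus\mathfrak{a}\oplus\mathfrak{n}$ is an Iwasawa decomposition, and let $AN$ be the connected subgroup of $G$ with Lie algebra $\mathfrak{a}\oplus\mathfrak{n}$. $AN$ acts simply transitively on $\mathbb{C}H^n$, and via the identification $AN\cong\mathbb{C}H^n$, $g\mapsto g\cdot o$, the metric and complex structure $J$ of $\mathbb{C}H^n$ induce a left-invariant metric $\langle\cdot,\cdot\rangle$ and a left-invariant complex structure $J$ on $AN$, hence an inner product and a complex structure on $\mathfrak{a}\oplus\mathfrak{n}\cong T_o\mathbb{C}H^n$. With respect to these, $\mathfrak{g}_\alpha$ is $J$-invariant (isomorphic to $\mathbb{C}^{n-1}$) and $J\mathfrak{a}=\mathfrak{g}_{2\alpha}$. $\mathfrak{w}^\perp=\mathfrak{g}_\alpha\ominus\mathfrak{w}$ denotes the orthogonal complement of $\mathfrak{w}$ in $\mathfrak{g}_\alpha$. $\mathfrak{s}_{\mathfrak{w}}$ is a Lie subalgebra of $\mathfrak{a}\oplus\mathfrak{n}$, and $W_{\mathfrak{w}}$ is a homogeneous submanifold of codimension $\dim\mathfrak{w}^\perp$. Kähler angle: for nonzero $\xi\in\mathfrak{w}^\perp$, the Kähler angle of $\xi$ with respect to $\mathfrak{w}^\perp$ is the angle $\varphi_\xi\in[0,\pi/2]$ between $J\xi$ and $\mathfrak{w}^\perp$, i.e. if $F\xi$ is the orthogonal projection of $J\xi$ onto $\mathfrak{w}^\perp$, then $\langle F\xi,F\xi\rangle=\cos^2(\varphi_\xi)\langle\xi,\xi\rangle$.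 $\mathfrak{w}^\perp$ has constant Kähler angle if $\varphi_\xi$ is independent of the nonzero vector $\xi\in\mathfrak{w}^\perp$. The tube of radius $r$ around $W_{\mathfrak{w}}$ is $M^r=\{\exp_p(r\xi): p\in W_{\mathfrak{w}},\ \xi\in\nu_pW_{\mathfrak{w}},\ |\xi|=1\}$, where $\nu W_{\mathfrak{w}}$ is the normal bundle (if $W_{\mathfrak{w}}$ has codimension 1, this consists of the equidistant hypersurfaces to $W_{\mathfrak{w}}$ at distance $r$); it is a hypersurface of $\mathbb{C}H^n$ for every $r>0$. The principal curvatures of $M^r$ are the eigenvalues of its shape operator with respect to the unit normal field $-\dot\gamma_\xi(r)$ at $\gamma_\xi(r)=\exp_p(r\xi)$. *)

(* Defs.v *)
From HB Require Import structures.
From mathcomp Require Import all_boot all_order all_algebra.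
From mathcomp Require Import all_classical all_reals all_analysis.
From mathcomp Require Import complex.
Set Implicit Arguments.
Unset Strict Implicit.
Unset Printing Implicit Defensive.
Import Order.TTheory GRing.Theory Num.Theory.
Import numFieldNormedType.Exports.
Local Open Scope classical_set_scope.
Local Open Scope complex_scope.
Local Open Scope ring_scope.

Section RiemannianGeometry.
Context {R : realType} {m : nat}.
Local Notation E := 'rV[R]_m.

(* A Riemannian manifold given by one global chart: an open set U of R^m with
   the metric g, where g p X Y is the inner product of X, Y in T_pU = R^m. *)
Implicit Types (U M : set E) (g : E -> E -> E -> R) (c V : R -> E).

(* < nabla_X Y , Z > at p, for X, Y, Z extended to constant vector fields
   (Koszul formula; the Lie brackets vanish). *)
Definition koszul g (p X Y Z : E) : R :=
  ('D_X (fun q => g q Y Z) p + 'D_Y (fun q => g q X Z) p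
   - 'D_Z (fun q => g q X Y) p) / 2.

(* The Levi-Civita covariant derivative at time t of the vector field V along
   the curve c is A, that is A = V' + Gamma(c', V), tested against all Z. *)
Definition is_covariant_derivative g c V (t : R) (A : E) : Prop :=
  exists c' V' : E,
    [/\ is_derive t 1 c c', is_derive t 1 V V' &
        forall Z, g (c t) A Z = g (c t) V' Z + koszul g (c t) c' (V t) Z].

Definition is_geodesic U g c : Prop :=
  forall t, U (c t) /\ is_covariant_derivative g c (c^`())%classic t 0.

(* Only used for embedded submanifolds, for which velocities of differentiable
   curves and of smooth curves are the same vectors. *)
Definition tangent_vector M (p X : E) : Prop :=
  exists c, [/\ forall t, M (c t), c 0 = p & is_derive (0 : R) 1 c X].

Definition unit_normal_vector g M (p xi : E) : Prop :=
  (forall X, tangent_vector M p X -> g p xi X = 0) /\ g p xi xi = 1.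

Definition unit_normal_geodesic U g M c : Prop :=
  [/\ is_geodesic U g c, M (c 0) & unit_normal_vector g M (c 0) (c^`()%classic 0)].

Definition tube U g M (r : R) : set E :=
  [set q | exists2 c, unit_normal_geodesic U g M c & c r = q].

(* N is the value at q of the unit normal field - gamma'(r) of the tube. *)
Definition tube_normal U g M (r : R) (q N : E) : Prop :=
  exists2 c, unit_normal_geodesic U g M c & c r = q /\ N = - c^`()%classic r.

(* The shape operator S X = - nabla_X N of a hypersurface with unit normal
   field N, as a relation between X and Y = S X. The field is given by its
   graph nu, whose domain is the hypersurface; X ranges over the tangent space
   of the hypersurface at q. *)
Definition shape_operator g (nu : E -> E -> Prop) (q X Y : E) : Prop :=
  exists c V,
    [/\ forall t, nu (c t) (V t), c 0 = q, is_derive (0 : R) 1 c X &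
        is_covariant_derivative g c V 0 (- Y)].

Definition has_dim (S : set E) (k : nat) : Prop :=
  exists2 B : 'M[R]_(k, m), row_free B & S = [set v | (v <= B)%MS].

(* The eigenvalues of the shape operator, counted with multiplicity, do not
   depend on the point of M; mult x is the dimension of the eigenspace of x,
   which is 0 when x is not a principal curvature. *)
Definition constant_principal_curvatures g M (nu : E -> E -> Prop) : Prop :=
  exists mult : R -> nat, forall q, M q -> forall x : R,
    has_dim [set X | shape_operator g nu q X (x *: X)] (mult x).

End RiemannianGeometry.

Section ComplexHyperbolicSpace.
Context {R : realType} {n : nat}.
(* C^n as a real vector space, x + i y being stored as the row (x, y). *)
Local Notation E := 'rV[R]_(n + n).
Local Notation C := R[i].
Local Notation Mat := 'M[C]_(1 + n).

Definition vec_to_complex (z : E) : 'cV[C]_n :=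
  \col_j (lsubmx z 0 j +i* rsubmx z 0 j).

Definition vec_of_complex (u : 'cV[C]_n) : E :=
  row_mx (\row_j complex.Re (u j 0)) (\row_j complex.Im (u j 0)).

Definition Jmap (z : E) : E := row_mx (- rsubmx z) (lsubmx z).

Definition dotE (x y : E) : R := \sum_(j < n + n) x 0 j * y 0 j.

(* The unit ball with the Bergman metric of constant holomorphic sectional
   curvature -1,
     4 Re ((1 - |z|^2) h(X, Y) + h(X, z) h(z, Y)) / (1 - |z|^2)^2,
   h being the standard Hermitian form of C^n. *)
Definition CH : set E := [set z | dotE z z < 1].

Definition bergman (z X Y : E) : R :=
  4 * ((1 - dotE z z) * dotE X Y
       + dotE X z * dotE Y z + dotE X (Jmap z) * dotE Y (Jmap z))
    / (1 - dotE z z) ^+ 2.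

(* The action of SU(1, n) on the ball, z standing for the complex line
   spanned by (1, z). The base point o is 0. *)
Definition ball_action (A : Mat) (z : E) : E :=
  let v : 'cV[C]_(1 + n) := A *m col_mx 1%:M (vec_to_complex z) in
  vec_of_complex ((usubmx v 0 0)^-1 *: dsubmx v).

Definition hform : Mat := block_mx (- 1%:M) 0 0 1%:M.

Definition conj_transpose (A : Mat) : Mat := (map_mx (@conjc R) A)^T.

(* The Lie algebra of SU(1, n), the group of the A with A^* hform A = hform and
   det A = 1. *)
Definition su1n : set Mat :=
  [set X | conj_transpose X *m hform + hform *m X = 0 /\ \tr X = 0].

(* The -1 eigenspace of the Cartan involution X |-> - X^* fixing the Lie
   algebra of the isotropy group S(U(1)U(n)) of o. *)
Definition cartan_p : set Mat := [set X | su1n X /\ conj_transpose X = X].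

Definition bracket (X Y : Mat) : Mat := X *m Y - Y *m X.

Definition real_subspace (V : set Mat) : Prop :=
  [/\ V 0, forall X Y, V X -> V Y -> V (X + Y) &
      forall (x : R) X, V X -> V (x%:C *: X)].

Definition abelian_subspace (a : set Mat) : Prop :=
  [/\ real_subspace a, a `<=` cartan_p &
      forall X Y, a X -> a Y -> bracket X Y = 0].

Definition maximal_abelian (a : set Mat) : Prop :=
  abelian_subspace a /\
  forall b, abelian_subspace b -> a `<=` b -> b = a.

(* Functionals on a are functions on matrices of which only the values on a
   matter. *)
Definition root_space (a : set Mat) (lam : Mat -> R) : set Mat :=
  [set X | su1n X /\ forall H, a H -> bracket H X = (lam H)%:C *: X].

Definition is_root (a : set Mat) (lam : Mat -> R) : Prop :=
  (exists2 H, a H & lam H != 0) /\ exists2 X, root_space a lam X & X != 0.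

Definition double_root (alpha : Mat -> R) : Mat -> R := fun H => 2 * alpha H.

(* alpha and 2 alpha are roots: for n >= 2 this says that alpha is one of the
   two choices of the simple root, i.e. it fixes an ordering of the roots. *)
Definition simple_root (a : set Mat) (alpha : Mat -> R) : Prop :=
  is_root a alpha /\ is_root a (double_root alpha).

(* A = exp X, by means of the integral curve through 1 of the left-invariant
   vector field X. *)
Definition is_exp (X A : Mat) : Prop :=
  exists gam : R -> Mat,
    [/\ gam 0 = 1%:M, gam 1 = A & forall (t : R) i j,
        is_derive t 1 (fun s => complex.Re (gam s i j))
                      (complex.Re ((gam t *m X) i j)) /\
        is_derive t 1 (fun s => complex.Im (gam s i j))
                      (complex.Im ((gam t *m X) i j))].

(* The connected subgroup with Lie algebra h is generated by exp h; inverses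
   need not be added since (exp X)^-1 = exp (- X). For h included in su(1, n) it
   is a subgroup of SU(1, n). *)
Inductive connected_subgroup (h : set Mat) : Mat -> Prop :=
| connected_subgroup1 : connected_subgroup h 1%:M
| connected_subgroupM X A B : h X -> is_exp X A ->
    connected_subgroup h B -> connected_subgroup h (A *m B).

(* a + w + g_{2 alpha} *)
Definition s_alg (a : set Mat) (alpha : Mat -> R) (w : set Mat) : set Mat :=
  [set X | exists H U Z, [/\ a H, w U, root_space a (double_root alpha) Z &
                             X = H + U + Z]].

Definition W_orbit (a : set Mat) (alpha : Mat -> R) (w : set Mat) : set E :=
  [set z | exists2 A, connected_subgroup (s_alg a alpha w) A
                    & z = ball_action A 0].

(* The velocity at t = 0 of exp(tX).o. For X in su(1, n) this is the lower left
   block of X, and it identifies a + n with the tangent space at o. *)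
Definition vec_at_o (X : Mat) : E := vec_of_complex (dlsubmx X).

Definition inner (X Y : Mat) : R := bergman 0 (vec_at_o X) (vec_at_o Y).

Definition innerJ (X Y : Mat) : R :=
  bergman 0 (Jmap (vec_at_o X)) (vec_at_o Y).

Definition ortho_in (V w : set Mat) : set Mat :=
  [set X | V X /\ forall Y, w Y -> inner X Y = 0].

(* phi is the Kaehler angle of xi with respect to V; F is the orthogonal
   projection of J xi onto V. *)
Definition is_kahler_angle (V : set Mat) (xi : Mat) (phi : R) : Prop :=
  [/\ 0 <= phi, phi <= pi / 2 &
      exists F, [/\ V F, forall Y, V Y -> innerJ xi Y = inner F Y &
                    inner F F = cos phi ^+ 2 * inner xi xi]].

Definition constant_kahler_angle (V : set Mat) : Prop :=
  exists phi : R, forall xi, V xi -> xi != 0 -> is_kahler_angle V xi phi.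

End ComplexHyperbolicSpace.

(* Main.v *)
(* Let eta be the unit vector of a, and let P be the orthogonal projection of C^n
   onto w^perp, viewed in the complement of C eta. In the coordinates of C^{1,n}
   adapted to the isotropic line of (1, eta), the orbit W is the zero set of a
   P-valued map of the ball, the group S_w moves every point of the ball to a
   point of w^perp, and it preserves W. So the tube M^r is the S_w-orbit of the
   sphere |xi| = tanh (r / 2) of w^perp, and its shape operator has to be known
   only at such xi, where it is explicit: it is built from P, J eta and the
   components F xi in w^perp and G xi in w of J xi. The eigenvalues
   that are not determined by r alone come from the roots y > 1 of
   y^2 (u - y) = u |G xi|^2, u = cosh^2 (r / 2), and such a root determines
   |G xi|. Hence constant principal curvatures force |G xi|, equivalently the
   Kaehler angle, to be constant. Conversely, if |G xi1| = |G xi2| then a product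
   of three reflections that commutes with P and fixes J eta takes xi1, F xi1,
   G xi1 to xi2, F xi2, G xi2, and it conjugates the shape operators. *)
Require Import Defs.
From HB Require Import structures.
From mathcomp Require Import all_boot all_order all_algebra.
From mathcomp Require Import all_classical all_reals all_analysis.
From mathcomp Require Import complex ring lra.
Set Implicit Arguments.
Unset Strict Implicit.
Unset Printing Implicit Defensive.
Import Order.TTheory GRing.Theory Num.Theory.
Import numFieldNormedType.Exports.
Local Open Scope classical_set_scope.
Local Open Scope complex_scope.
Local Open Scope ring_scope.

(** The shape operator needs the normal field along a whole curve of the tube, while the group
    element carrying a point to w^perp is only known to exist. The normal is therefore written as a
    function of the point alone ([normal_field]), with the group element eliminated. A second
    obstacle is that P is merely real linear, whereas the action multiplies lifts by a complex
    automorphy factor; a multiplication by the conjugate of [mz] makes this factor real, which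
    explains the form of [Qz]. Geodesics and exponentials are given by differential equations; they
    are determined by finding quantities with zero derivative. The cubic is a characteristic
    polynomial. On vectors orthogonal to xi, J eta, F xi and G xi the operator [shape_aux] is P,
    with eigenvalues 0 and 1 only. On the span of J eta, F xi, G xi, when these are independent, its
    characteristic polynomial is y^3 - u y^2 + u |G xi|^2. The condition y > 1 keeps the root apart
    from 0 and 1. A root y > 1 is produced only when F xi is nonzero, which holds for the smaller of
    two different values of |G xi|. *)

Section Calculus.
Context {R : realType}.
Implicit Types (V : normedModType R).

(** The variants ending in [f] take and return explicit lambda terms. Derivatives of long
    expressions are then assembled as proof terms, and [is_derive_eq] reduces the value to an
    algebraic identity. *)
Lemma is_deriveDf V (W : normedModType R) (f g : V -> W) x v a b :
  is_derive x v f a -> is_derive x v g b ->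
  is_derive x v (fun s => f s + g s) (a + b).
Proof. exact: is_deriveD. Qed.

Lemma is_deriveNf V (W : normedModType R) (f : V -> W) x v a :
  is_derive x v f a -> is_derive x v (fun s => - f s) (- a).
Proof. exact: is_deriveN. Qed.

Lemma is_deriveBf V (W : normedModType R) (f g : V -> W) x v a b :
  is_derive x v f a -> is_derive x v g b ->
  is_derive x v (fun s => f s - g s) (a - b).
Proof. exact: is_deriveB. Qed.

Lemma is_deriveMf V (f g : V -> R) x v (a b : R) :
  is_derive x v f a -> is_derive x v g b ->
  is_derive x v (fun s => f s * g s) (a * g x + f x * b).
Proof.
by move=> fa gb; apply: is_derive_eq; rewrite addrC mulrC.
Qed.

Lemma is_deriveVf V (f : V -> R) x v (a : R) :
  is_derive x v f a -> f x != 0 -> is_derive x v (fun s => (f s)^-1) (- a / f x ^+ 2).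
Proof.
move=> [df <-] f0; split; first exact: derivableV.
by rewrite deriveV// [_ *: _]mulrC mulNr mulrN.
Qed.

Lemma is_derive_cstf V (W : normedModType R) (a : W) (x v : V) :
  is_derive x v (fun=> a) 0.
Proof. exact: is_derive_cst. Qed.

Lemma is_derive_sumf V (W : normedModType R) (I : Type) (r : seq I)
    (f : I -> V -> W) (f' : I -> W) (x v : V) :
  (forall i, is_derive x v (f i) (f' i)) ->
  is_derive x v (fun s => \sum_(i <- r) f i s) (\sum_(i <- r) f' i).
Proof.
move=> df; elim: r => [|i r IH].
  rewrite big_nil; rewrite (_ : (fun _ => _) = fun=> 0); last first.
    by apply/funext => s; rewrite big_nil.
  exact: is_derive_cstf.
rewrite big_cons; rewrite (_ : (fun _ => _) =
    fun s => f i s + \sum_(j <- r) f j s); last first.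
  by apply/funext => s; rewrite big_cons.
exact: is_deriveDf.
Qed.

Lemma is_derive_mxP V p q (f : V -> 'M[R]_(p, q)) x v f' :
  is_derive x v f f' <->
  forall i j, is_derive x v (fun s => f s i j) (f' i j).
Proof.
split=> [[df <-] i j|df].
  by split; [exact: (derivable_mxP _ _ _).1|rewrite derive_mx// mxE].
have dv : derivable f x v by apply/derivable_mxP => i j; case: (df i j).
by split => //; rewrite derive_mx//; apply/matrixP => i j; rewrite mxE;
  case: (df i j).
Qed.

Lemma is_derive_unique V (W : normedModType R) (f : V -> W) x v a b :
  is_derive x v f a -> is_derive x v f b -> a = b.
Proof. by case=> _ <- [_ <-]. Qed.

Lemma is_derive_ext V (W : normedModType R) (f g : V -> W) x v a :
  (forall s, f s = g s) -> is_derive x v f a -> is_derive x v g a.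
Proof. by move=> /funext ->. Qed.

Lemma is_derive_linear V p q (L : {linear 'rV[R]_p -> 'rV[R]_q})
    (c : V -> 'rV[R]_p) x v c' :
  is_derive x v c c' -> is_derive x v (fun s => L (c s)) (L c').
Proof.
move=> /is_derive_mxP dc; apply/is_derive_mxP => i j.
have LE u : L u i j = \sum_k u 0 k * L (delta_mx 0 k) i j.
  rewrite {1}(row_sum_delta u) linear_sum summxE; apply: eq_bigr => k _.
  by rewrite linearZ mxE.
rewrite LE; apply: (is_derive_ext (fun s => esym (LE (c s)))).
apply: is_derive_sumf => k.
apply: is_derive_eq (is_deriveMf (dc 0 k)
  (is_derive_cstf (L (delta_mx 0 k) i j : R) x v)) _.
by rewrite mulr0 addr0.
Qed.

(** Away from 0 the difference quotient of a linear functional is constant, so its limit is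
    immediate. *)
Lemma is_derive_direction p (L : 'rV[R]_p -> R) (x v : 'rV[R]_p) :
  (forall a y z, L (a *: y + z) = a * L y + L z) -> is_derive x v L (L v).
Proof.
move=> L_lin.
have Lv h : h != 0 -> h^-1 *: ((L \o shift x) (h *: v) - L x) = L v.
  move=> h0 /=; rewrite L_lin addrK /GRing.scale/=.
  by rewrite mulrA mulVf// mul1r.
have cv : (fun h => h^-1 *: ((L \o shift x) (h *: v) - L x)) @ 0^' --> L v.
  apply: (@cvg_trans _ (cst (L v) @ 0^')); last exact: cvg_cst.
  apply: near_eq_cvg; near=> h; rewrite Lv//.
  by near: h; exact: nbhs_dnbhs_neq.
by split; [apply/cvg_ex; exists (L v)|exact: cvg_lim].
Unshelve. all: by end_near. Qed.

Lemma is_derive_affine V (a b : V) (t : R) :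
  is_derive t 1 (fun s : R => a + s *: b) b.
Proof.
have Lv h : h != 0 ->
    h^-1 *: (((fun s : R => a + s *: b) \o shift t) (h *: (1 : R)) - (a + t *: b))
      = b.
  move=> h0 /=; rewrite scalerDl addrCA addrK scalerA [h *: _]mulr1.
  by rewrite mulVf// scale1r.
have cv : (fun h => h^-1 *: (((fun s : R => a + s *: b) \o shift t)
    (h *: (1 : R)) - (a + t *: b))) @ 0^' --> b.
  apply: (@cvg_trans _ (cst b @ 0^')); last exact: cvg_cst.
  apply: near_eq_cvg; near=> h; rewrite Lv//.
  by near: h; exact: nbhs_dnbhs_neq.
by split; [apply/cvg_ex; exists b|exact: cvg_lim].
Unshelve. all: by end_near. Qed.

(** Real and imaginary parts are treated separately, as in the equation of the integral curve in
    [is_exp]; [mderive] below is the entrywise version. *)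
Definition cderive (f : R -> R[i]) (t : R) (f' : R[i]) : Prop :=
  is_derive t 1 (fun s => complex.Re (f s)) (complex.Re f') /\
  is_derive t 1 (fun s => complex.Im (f s)) (complex.Im f').

Lemma cderive_ext (f g : R -> R[i]) t a :
  (forall s, f s = g s) -> cderive f t a -> cderive g t a.
Proof. by move=> /funext ->. Qed.

Lemma cderive_eq (f : R -> R[i]) t a b : cderive f t a -> a = b -> cderive f t b.
Proof. by move=> ? <-. Qed.

Lemma cderive_cst (a : R[i]) t : cderive (fun=> a) t 0.
Proof. by split; exact: is_derive_cstf. Qed.

Lemma cderiveD (f g : R -> R[i]) t a b : cderive f t a -> cderive g t b ->
  cderive (fun s => f s + g s) t (a + b).
Proof.
move=> [f1 f2] [g1 g2]; split.
  rewrite raddfD; apply: is_derive_ext (is_deriveDf f1 g1) => s.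
  by rewrite raddfD.
rewrite raddfD; apply: is_derive_ext (is_deriveDf f2 g2) => s.
by rewrite raddfD.
Qed.

Lemma cderiveN (f : R -> R[i]) t a : cderive f t a -> cderive (fun s => - f s) t (- a).
Proof.
move=> [f1 f2]; split.
  rewrite raddfN; apply: is_derive_ext (is_deriveNf f1) => s.
  by rewrite raddfN.
rewrite raddfN; apply: is_derive_ext (is_deriveNf f2) => s.
by rewrite raddfN.
Qed.

Lemma cderiveB (f g : R -> R[i]) t a b : cderive f t a -> cderive g t b ->
  cderive (fun s => f s - g s) t (a - b).
Proof. by move=> df /cderiveN; exact: cderiveD. Qed.

Lemma ReM (x y : R[i]) : complex.Re (x * y) =
  complex.Re x * complex.Re y - complex.Im x * complex.Im y.
Proof. by case: x => a b; case: y. Qed.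

Lemma ImM (x y : R[i]) : complex.Im (x * y) =
  complex.Re x * complex.Im y + complex.Im x * complex.Re y.
Proof. by case: x => a b; case: y. Qed.

Lemma ReD (x y : R[i]) : complex.Re (x + y) = complex.Re x + complex.Re y.
Proof. by case: x => a b; case: y. Qed.

Lemma ImD (x y : R[i]) : complex.Im (x + y) = complex.Im x + complex.Im y.
Proof. by case: x => a b; case: y. Qed.

Lemma ReN (x : R[i]) : complex.Re (- x) = - complex.Re x.
Proof. by case: x. Qed.

Lemma ImN (x : R[i]) : complex.Im (- x) = - complex.Im x.
Proof. by case: x. Qed.

Lemma Reconj (x : R[i]) : complex.Re x^* = complex.Re x.
Proof. by case: x. Qed.

Lemma Imconj (x : R[i]) : complex.Im x^* = - complex.Im x.
Proof. by case: x. Qed.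

Lemma ReV (x : R[i]) : complex.Re x^-1 =
  complex.Re x / (complex.Re x ^+ 2 + complex.Im x ^+ 2).
Proof. by case: x. Qed.

Lemma ImV (x : R[i]) : complex.Im x^-1 =
  - complex.Im x / (complex.Re x ^+ 2 + complex.Im x ^+ 2).
Proof. by case: x => a b /=; rewrite mulNr. Qed.

Definition ReImE := (ReM, ImM, ReD, ImD, ReN, ImN, Reconj, Imconj).

Lemma complexP (x y : R[i]) :
  complex.Re x = complex.Re y -> complex.Im x = complex.Im y -> x = y.
Proof. by case: x y => a b [c d] /= -> ->. Qed.

Lemma complex_neq0 (x : R[i]) :
  x != 0 -> complex.Re x ^+ 2 + complex.Im x ^+ 2 != 0.
Proof.
case: x => a b; apply: contra; rewrite eq_complex/= => /eqP.
move=> e; rewrite -(sqrf_eq0 a) -(sqrf_eq0 b).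
have a0 := sqr_ge0 a; have b0 := sqr_ge0 b.
by apply/andP; split; apply/eqP; lra.
Qed.

Lemma cderiveM (f g : R -> R[i]) t a b : cderive f t a -> cderive g t b ->
  cderive (fun s => f s * g s) t (a * g t + f t * b).
Proof.
move=> [f1 f2] [g1 g2]; split.
  apply: (is_derive_ext (fun s => esym (ReM (f s) (g s)))).
  apply: is_derive_eq (is_deriveBf (is_deriveMf f1 g1) (is_deriveMf f2 g2)) _.
  by rewrite !ReImE; ring.
apply: (is_derive_ext (fun s => esym (ImM (f s) (g s)))).
apply: is_derive_eq (is_deriveDf (is_deriveMf f1 g2) (is_deriveMf f2 g1)) _.
by rewrite !ReImE; ring.
Qed.

Lemma cderive_conj (f : R -> R[i]) t a : cderive f t a -> cderive (fun s => (f s)^*) t a^*.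
Proof.
move=> [f1 f2]; split.
  by rewrite Reconj; apply: is_derive_ext f1 => s; rewrite Reconj.
by rewrite Imconj; apply: is_derive_ext (is_deriveNf f2) => s; rewrite Imconj.
Qed.

Lemma cderive_real (f : R -> R) (t a : R) :
  is_derive t 1 f a -> cderive (fun s => (f s)%:C) t a%:C.
Proof. by move=> df; split=> //=; exact: is_derive_cstf. Qed.

Lemma cderiveV (f : R -> R[i]) t a : cderive f t a -> f t != 0 ->
  cderive (fun s => (f s)^-1) t (- a / f t ^+ 2).
Proof.
move=> [f1 f2] ft0; have nz := complex_neq0 ft0.
have dn : is_derive t 1 (fun s => complex.Re (f s) ^+ 2 + complex.Im (f s) ^+ 2)
    (2 * (complex.Re (f t) * complex.Re a + complex.Im (f t) * complex.Im a)).
  apply: is_derive_eq (is_deriveDf (is_deriveMf f1 f1) (is_deriveMf f2 f2)) _.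
  ring.
have dV := is_deriveVf dn nz.
split.
  apply: (is_derive_ext (fun s => esym (ReV (f s)))).
  apply: is_derive_eq (is_deriveMf f1 dV) _.
  rewrite expr2 !ReImE ReV ImV !ReImE.
  by field; rewrite [X in X != 0](_ : _ = (complex.Re (f t) ^+ 2 + complex.Im (f t) ^+ 2)^+2) ?expf_neq0//; ring.
apply: (is_derive_ext (fun s => esym (ImV (f s)))).
apply: is_derive_eq (is_deriveMf (is_deriveNf f2) dV) _.
rewrite expr2 !ReImE ReV ImV !ReImE.
by field; rewrite [X in X != 0](_ : _ = (complex.Re (f t) ^+ 2 + complex.Im (f t) ^+ 2)^+2) ?expf_neq0//; ring.
Qed.

Lemma cderive_sum (I : Type) (r : seq I) (f : I -> R -> R[i]) f' t :
  (forall i, cderive (f i) t (f' i)) ->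
  cderive (fun s => \sum_(i <- r) f i s) t (\sum_(i <- r) f' i).
Proof.
move=> df; elim: r => [|i r IH].
  rewrite big_nil; apply: cderive_ext (cderive_cst 0 t) => s.
  by rewrite big_nil.
rewrite big_cons; apply: cderive_ext (cderiveD (df i) IH) => s.
by rewrite big_cons.
Qed.

Lemma cderive0_cst (f : R -> R[i]) x y : (forall t, cderive f t 0) -> f x = f y.
Proof.
move=> df; apply: complexP.
  by apply: (@is_derive_0_is_cst _ (fun s => complex.Re (f s))) => t; case: (df t).
by apply: (@is_derive_0_is_cst _ (fun s => complex.Im (f s))) => t; case: (df t).
Qed.

Definition mderive p q (f : R -> 'M[R[i]]_(p, q)) (t : R) (f' : 'M[R[i]]_(p, q)) :=
  forall i j, cderive (fun s => f s i j) t (f' i j).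

Lemma mderive_ext p q (f g : R -> 'M[R[i]]_(p, q)) t a :
  (forall s, f s = g s) -> mderive f t a -> mderive g t a.
Proof. by move=> /funext ->. Qed.

Lemma mderive_eq p q (f : R -> 'M[R[i]]_(p, q)) t a b :
  mderive f t a -> a = b -> mderive f t b.
Proof. by move=> ? <-. Qed.

Lemma mderive_cst p q (a : 'M[R[i]]_(p, q)) t : mderive (fun=> a) t 0.
Proof. by move=> i j; rewrite mxE; exact: cderive_cst. Qed.

Lemma mderiveD p q (f g : R -> 'M[R[i]]_(p, q)) t a b :
  mderive f t a -> mderive g t b -> mderive (fun s => f s + g s) t (a + b).
Proof.
move=> df dg i j; rewrite mxE.
by apply: cderive_ext (cderiveD (df i j) (dg i j)) => s; rewrite mxE.
Qed.

Lemma mderiveN p q (f : R -> 'M[R[i]]_(p, q)) t a :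
  mderive f t a -> mderive (fun s => - f s) t (- a).
Proof.
move=> df i j; rewrite mxE.
by apply: cderive_ext (cderiveN (df i j)) => s; rewrite mxE.
Qed.

Lemma mderiveB p q (f g : R -> 'M[R[i]]_(p, q)) t a b :
  mderive f t a -> mderive g t b -> mderive (fun s => f s - g s) t (a - b).
Proof. by move=> df /mderiveN; exact: mderiveD. Qed.

Lemma mderiveM p q r (f : R -> 'M[R[i]]_(p, q)) (g : R -> 'M[R[i]]_(q, r)) t a b :
  mderive f t a -> mderive g t b ->
  mderive (fun s => f s *m g s) t (a *m g t + f t *m b).
Proof.
move=> df dg i j; rewrite !mxE -big_split/=.
apply: (@cderive_ext (fun s => \sum_k f s i k * g s k j)).
  by move=> s; rewrite mxE.
by apply: cderive_sum => k; exact: cderiveM.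
Qed.

Lemma mderiveMl p q r (A : 'M[R[i]]_(p, q)) (g : R -> 'M[R[i]]_(q, r)) t b :
  mderive g t b -> mderive (fun s => A *m g s) t (A *m b).
Proof.
move=> dg; apply: mderive_eq (mderiveM (mderive_cst A t) dg) _.
by rewrite mul0mx add0r.
Qed.

Lemma mderiveMr p q r (A : 'M[R[i]]_(q, r)) (g : R -> 'M[R[i]]_(p, q)) t b :
  mderive g t b -> mderive (fun s => g s *m A) t (b *m A).
Proof.
move=> dg; apply: mderive_eq (mderiveM dg (mderive_cst A t)) _.
by rewrite mulmx0 addr0.
Qed.

Lemma mderiveZ p q (f : R -> R[i]) (g : R -> 'M[R[i]]_(p, q)) t a b :
  cderive f t a -> mderive g t b ->
  mderive (fun s => f s *: g s) t (a *: g t + f t *: b).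
Proof.
move=> df dg i j; rewrite !mxE.
by apply: cderive_ext (cderiveM df (dg i j)) => s; rewrite mxE.
Qed.

Lemma mderive0_cst p q (f : R -> 'M[R[i]]_(p, q)) x y :
  (forall t, mderive f t 0) -> f x = f y.
Proof.
move=> df; apply/matrixP => i j; apply: (@cderive0_cst (fun s => f s i j)) => t.
by have := df t i j; rewrite mxE.
Qed.

Lemma mderive_conjT p q (f : R -> 'M[R[i]]_(p, q)) t a :
  mderive f t a ->
  mderive (fun s => (map_mx (@conjc R) (f s))^T) t (map_mx (@conjc R) a)^T.
Proof.
move=> df i j; rewrite !mxE.
by apply: cderive_ext (cderive_conj (df j i)) => s; rewrite !mxE.
Qed.

End Calculus.

(** * The Hermitian space C^n *)

Section HermitianSpace.
Context {R : realType} {n : nat}.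
Local Notation E := 'rV[R]_(n + n).
Local Notation C := R[i].
Implicit Types (x y z : E) (a b : C) (r s : R).

Fact Jmap_is_linear : linear (@Jmap R n).
Proof.
move=> r x y; rewrite /Jmap scale_row_mx add_row_mx; congr row_mx.
  by rewrite scalerN -opprD linearP.
by rewrite linearP.
Qed.

HB.instance Definition _ :=
  GRing.isLinear.Build R E E *:%R (@Jmap R n) Jmap_is_linear.

Lemma JmapD x y : Jmap (x + y) = Jmap x + Jmap y. Proof. exact: linearD. Qed.
Lemma JmapN x : Jmap (- x) = - Jmap x. Proof. exact: linearN. Qed.
Lemma JmapZ r x : Jmap (r *: x) = r *: Jmap x. Proof. exact: linearZ. Qed.

Lemma JmapK x : Jmap (Jmap x) = - x.
Proof. by rewrite /Jmap row_mxKl row_mxKr -opp_row_mx hsubmxK. Qed.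

Lemma dotEC x y : dotE x y = dotE y x.
Proof. by apply: eq_bigr => j _; rewrite mulrC. Qed.

Lemma dotEDl x y z : dotE (x + y) z = dotE x z + dotE y z.
Proof. by rewrite -big_split; apply: eq_bigr => j _; rewrite mxE mulrDl. Qed.

Lemma dotEZl r x z : dotE (r *: x) z = r * dotE x z.
Proof. by rewrite mulr_sumr; apply: eq_bigr => j _; rewrite mxE mulrA. Qed.

Lemma dotEDr x y z : dotE x (y + z) = dotE x y + dotE x z.
Proof. by rewrite dotEC dotEDl !(dotEC x). Qed.

Lemma dotEZr r x z : dotE x (r *: z) = r * dotE x z.
Proof. by rewrite dotEC dotEZl (dotEC x). Qed.

Lemma dotENl x z : dotE (- x) z = - dotE x z.
Proof. by rewrite -scaleN1r dotEZl mulN1r. Qed.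

Lemma dotENr x z : dotE x (- z) = - dotE x z.
Proof. by rewrite -scaleN1r dotEZr mulN1r. Qed.

Lemma dotE0l z : dotE 0 z = 0.
Proof. by rewrite -(scale0r z) dotEZl mul0r. Qed.

Lemma dotE0r z : dotE z 0 = 0.
Proof. by rewrite dotEC dotE0l. Qed.

Lemma dotE_split x y : dotE x y =
  \sum_(j < n) lsubmx x 0 j * lsubmx y 0 j +
  \sum_(j < n) rsubmx x 0 j * rsubmx y 0 j.
Proof.
by rewrite /dotE big_split_ord/=; congr (_ + _); apply: eq_bigr => j _;
  rewrite !mxE.
Qed.

Lemma dotEJJ x y : dotE (Jmap x) (Jmap y) = dotE x y.
Proof.
rewrite !dotE_split /Jmap !row_mxKl !row_mxKr addrC; congr (_ + _).
by apply: eq_bigr => j _; rewrite !mxE mulrNN.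
Qed.

Lemma dotEJl x y : dotE (Jmap x) y = - dotE x (Jmap y).
Proof. by rewrite -dotEJJ JmapK dotENl. Qed.

Lemma dotExJx x : dotE x (Jmap x) = 0.
Proof. by have := dotEJl x x; rewrite dotEC => e; lra. Qed.

Lemma dotE_ge0 x : 0 <= dotE x x.
Proof. by apply: sumr_ge0 => j _; rewrite -expr2 sqr_ge0. Qed.

Lemma dotE_eq0 x : (dotE x x == 0) = (x == 0).
Proof.
apply/eqP/eqP => [x0|->]; last exact: dotE0l.
apply/rowP => j; rewrite mxE; apply/eqP.
rewrite -sqrf_eq0 expr2; apply/eqP.
by apply: psumr_eq0P x0 j _ => // k _; rewrite -expr2 sqr_ge0.
Qed.

Lemma dotE_gt0 x : (0 < dotE x x) = (x != 0).
Proof. by rewrite lt_def dotE_ge0 andbT dotE_eq0. Qed.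

Definition dotEl := (dotEDl, dotEZl, dotENl, dotE0l).
Definition dotEr := (dotEDr, dotEZr, dotENr, dotE0r).
Definition dotE_lin := (dotEl, dotEr).
Definition Jmap_lin := (JmapD, JmapN, JmapZ, JmapK).

(** Linear in the first argument and conjugate linear in the second; its vanishing means
    orthogonality to [y] and to [Jmap y] at once. *)
Definition hE x y : C := dotE x y +i* dotE x (Jmap y).

Fact cscale_key : unit. Proof. exact: tt. Qed.

(** Complex scalars act on the real vector space [E] through [Jmap]. The lock keeps real and
    imaginary parts from surfacing in calculations over C. *)
Definition cscale a x : E :=
  locked_with cscale_key (complex.Re a *: x + complex.Im a *: Jmap x).

Lemma cscaleE a x : cscale a x = complex.Re a *: x + complex.Im a *: Jmap x.
Proof. exact: locked_withE. Qed.

Lemma hE_conj x y : (hE x y)^* = hE y x.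
Proof. by apply: complexP; rewrite /= -?dotEJl dotEC. Qed.

Lemma hEDl x y z : hE (x + y) z = hE x z + hE y z.
Proof. by apply: complexP; rewrite /= ?ReImE /= !dotE_lin. Qed.

Lemma hEcl a x y : hE (cscale a x) y = a * hE x y.
Proof.
case: a => r s; apply: complexP; rewrite cscaleE /hE /= !dotE_lin.
  by rewrite dotEJl; ring.
by rewrite dotEJJ addrC; ring.
Qed.

Lemma hEDr x y z : hE x (y + z) = hE x y + hE x z.
Proof. by rewrite -hE_conj hEDl rmorphD /= !hE_conj. Qed.

Lemma hEcr a x y : hE x (cscale a y) = a^* * hE x y.
Proof. by rewrite -hE_conj hEcl rmorphM /= !hE_conj. Qed.

Lemma hEZl r x y : hE (r *: x) y = r%:C * hE x y.
Proof. by apply: complexP; rewrite ?ReImE /= !dotE_lin; ring. Qed.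

Lemma hEZr r x y : hE x (r *: y) = r%:C * hE x y.
Proof. by apply: complexP; rewrite ?ReImE /= ?Jmap_lin !dotE_lin; ring. Qed.

Lemma hENl x y : hE (- x) y = - hE x y.
Proof. by apply: complexP; rewrite ?ReImE /= !dotE_lin. Qed.

Lemma hENr x y : hE x (- y) = - hE x y.
Proof. by apply: complexP; rewrite ?ReImE /= ?Jmap_lin !dotE_lin. Qed.

Lemma hE0l y : hE 0 y = 0.
Proof. by rewrite -(scale0r 0) hEZl mul0r. Qed.

Lemma hE0r y : hE y 0 = 0.
Proof. by rewrite -(scale0r 0) hEZr mul0r. Qed.

Lemma hExx x : hE x x = (dotE x x)%:C.
Proof. by rewrite /hE dotExJx. Qed.

Definition hE_lin := (hEDl, hEDr, hENl, hENr, hEZl, hEZr, hEcl, hEcr, hE0l, hE0r).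

Lemma vec_to_complexE x j k :
  vec_to_complex x j k = lsubmx x 0 j +i* rsubmx x 0 j.
Proof. by rewrite mxE. Qed.

Lemma vec_of_complexK (u : 'cV[C]_n) : vec_to_complex (vec_of_complex u) = u.
Proof.
apply/colP => j.
rewrite vec_to_complexE /vec_of_complex row_mxKl row_mxKr !mxE.
by apply: complexP.
Qed.

Lemma vec_to_complexK x : vec_of_complex (vec_to_complex x) = x.
Proof.
rewrite /vec_of_complex -[RHS]hsubmxK.
by congr row_mx; apply/rowP => j; rewrite mxE vec_to_complexE.
Qed.

Lemma vec_to_complex_inj : injective (@vec_to_complex R n).
Proof. exact: can_inj vec_to_complexK. Qed.

Lemma vec_to_complexD x y :
  vec_to_complex (x + y) = vec_to_complex x + vec_to_complex y.
Proof. by apply/colP => j; rewrite !mxE; apply: complexP. Qed.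

Lemma vec_to_complexZ r x : vec_to_complex (r *: x) = r%:C *: vec_to_complex x.
Proof. by apply/colP => j; rewrite !mxE; apply: complexP; rewrite /=; ring. Qed.

Lemma vec_to_complexN x : vec_to_complex (- x) = - vec_to_complex x.
Proof. by apply/colP => j; rewrite !mxE; apply: complexP. Qed.

Lemma vec_to_complex0 : vec_to_complex (0 : E) = 0.
Proof. by rewrite -(scale0r 0) vec_to_complexZ scale0r. Qed.

Lemma vec_to_complexJ x : vec_to_complex (Jmap x) = 'i *: vec_to_complex x.
Proof.
apply/colP => j; rewrite [RHS]mxE !vec_to_complexE /Jmap row_mxKl row_mxKr.
by apply: complexP; rewrite /= !mxE; ring.
Qed.

Lemma vec_to_complex_cscale a x :
  vec_to_complex (cscale a x) = a *: vec_to_complex x.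
Proof.
rewrite cscaleE vec_to_complexD !vec_to_complexZ vec_to_complexJ scalerA -scalerDl.
by congr (_ *: _); case: a => r s; apply: complexP; rewrite /=; ring.
Qed.

Definition vec_to_complex_lin := (vec_to_complexD, vec_to_complexN,
  vec_to_complexZ, vec_to_complexJ, vec_to_complex_cscale, vec_to_complex0).

Lemma hE_vec x y :
  hE x y = ((map_mx (@conjc R) (vec_to_complex y))^T *m vec_to_complex x) 0 0.
Proof.
rewrite mxE; apply: complexP; rewrite raddf_sum /=.
  rewrite dotE_split -big_split/=; apply: eq_bigr => j _.
  by rewrite !mxE /=; ring.
rewrite dotE_split -big_split/=; apply: eq_bigr => j _.
by rewrite /Jmap row_mxKl row_mxKr !mxE /=; ring.
Qed.

Lemma cscaleDl a b x : cscale (a + b) x = cscale a x + cscale b x.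
Proof. by apply: vec_to_complex_inj; rewrite !vec_to_complex_lin scalerDl. Qed.

Lemma cscaleDr a x y : cscale a (x + y) = cscale a x + cscale a y.
Proof. by apply: vec_to_complex_inj; rewrite !vec_to_complex_lin scalerDr. Qed.

Lemma cscaleA a b x : cscale a (cscale b x) = cscale (a * b) x.
Proof. by apply: vec_to_complex_inj; rewrite !vec_to_complex_lin scalerA. Qed.

Lemma cscale_real r x : cscale r%:C x = r *: x.
Proof. by rewrite cscaleE /= scale0r addr0. Qed.

Lemma cscale1 x : cscale 1 x = x.
Proof. by rewrite cscaleE /= scale0r addr0 scale1r. Qed.

Lemma cscale0 x : cscale 0 x = 0.
Proof. by rewrite cscaleE /= !scale0r addr0. Qed.

Lemma cscaler0 a : cscale a 0 = 0.
Proof. by apply: vec_to_complex_inj; rewrite !vec_to_complex_lin scaler0. Qed.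

Lemma cscaleN a x : cscale (- a) x = - cscale a x.
Proof. by apply: vec_to_complex_inj; rewrite !vec_to_complex_lin scaleNr. Qed.

Lemma cscalerN a x : cscale a (- x) = - cscale a x.
Proof. by apply: vec_to_complex_inj; rewrite !vec_to_complex_lin scalerN. Qed.

Lemma is_derive_dotE (V : normedModType R) (u v : V -> E) (t d : V) u' v' :
  is_derive t d u u' -> is_derive t d v v' ->
  is_derive t d (fun q => dotE (u q) (v q)) (dotE u' (v t) + dotE (u t) v').
Proof.
move=> /is_derive_mxP du /is_derive_mxP dv; rewrite /dotE -big_split/=.
by apply: is_derive_sumf => j; exact: is_deriveMf.
Qed.

Lemma is_derive_Jmap (u : R -> E) (t : R) u' :
  is_derive t 1 u u' -> is_derive t 1 (fun s => Jmap (u s)) (Jmap u').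
Proof. exact: is_derive_linear. Qed.

Lemma cderive_hE (u v : R -> E) (t : R) u' v' :
  is_derive t 1 u u' -> is_derive t 1 v v' ->
  cderive (fun s => hE (u s) (v s)) t (hE u' (v t) + hE (u t) v').
Proof.
move=> du dv; split; rewrite ?ReD ?ImD /=; first exact: is_derive_dotE.
by apply: is_derive_dotE => //; exact: is_derive_Jmap.
Qed.

Lemma is_deriveZf m (f : R -> R) (u : R -> 'rV[R]_m) (t f' : R) u' :
  is_derive t 1 f f' -> is_derive t 1 u u' ->
  is_derive t 1 (fun s => f s *: u s) (f' *: u t + f t *: u').
Proof.
move=> df /is_derive_mxP du; apply/is_derive_mxP => i j; rewrite !mxE.
by apply: is_derive_ext (is_deriveMf df (du i j)) => s; rewrite mxE.
Qed.

Lemma is_derive_cscale (f : R -> C) (u : R -> E) (t : R) f' u' :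
  cderive f t f' -> is_derive t 1 u u' ->
  is_derive t 1 (fun s => cscale (f s) (u s)) (cscale f' (u t) + cscale (f t) u').
Proof.
move=> [f1 f2] du; apply: (is_derive_ext (fun q => esym (cscaleE (f q) (u q)))).
apply: is_derive_eq (is_deriveDf (is_deriveZf f1 du)
  (is_deriveZf f2 (is_derive_Jmap du))) _.
by rewrite !cscaleE addrACA.
Qed.

Lemma is_derive_vecP (u : R -> E) (t : R) u' :
  is_derive t 1 u u' <->
  mderive (fun s => vec_to_complex (u s)) t (vec_to_complex u').
Proof.
split=> [/is_derive_mxP du i j|du].
  split; rewrite vec_to_complexE /= mxE.
    apply: is_derive_ext (du 0 (lshift n i)) => s.
    by rewrite vec_to_complexE /= mxE.
  apply: is_derive_ext (du 0 (rshift n i)) => s.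
  by rewrite vec_to_complexE /= mxE.
apply/is_derive_mxP => i j; rewrite (ord1 i).
case: (split_ordP j) => k ->; case: (du k 0) => d1 d2.
  have := d1; rewrite vec_to_complexE /= mxE; apply: is_derive_ext => s.
  by rewrite vec_to_complexE /= mxE.
have := d2; rewrite vec_to_complexE /= mxE; apply: is_derive_ext => s.
by rewrite vec_to_complexE /= mxE.
Qed.

End HermitianSpace.

(** * Levi-Civita connection and geodesics of the Bergman metric *)

Section LeviCivita.
Context {R : realType} {n : nat}.
Local Notation E := 'rV[R]_(n + n).
Local Notation C := R[i].
Implicit Types (x y z p X Y Z : E).

Lemma is_derive_cstR (a t : R) : is_derive t 1 (fun=> a) (0 : R).
Proof. exact: is_derive_cst. Qed.

Lemma is_derive_cstE m (a : 'rV[R]_m) (t : R) : is_derive t 1 (fun=> a) (0 : 'rV[R]_m).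
Proof. exact: is_derive_cst. Qed.

Lemma is_derive_bergman p X Y Z : CH p ->
  is_derive p X (fun q => bergman q Y Z)
    ((4 * (- (2 * dotE X p) * dotE Y Z + (dotE Y X * dotE Z p + dotE Y p * dotE Z X)
       + (dotE Y (Jmap X) * dotE Z (Jmap p) + dotE Y (Jmap p) * dotE Z (Jmap X)))
      + 16 * dotE X p / (1 - dotE p p) *
        ((1 - dotE p p) * dotE Y Z + dotE Y p * dotE Z p
          + dotE Y (Jmap p) * dotE Z (Jmap p))) / (1 - dotE p p) ^+ 2).
Proof.
rewrite /CH /= -subr_gt0 => /lt0r_neq0 N0.
have dY W : is_derive p X (fun q => dotE W q) (dotE W X).
  by apply: is_derive_direction => a y z; rewrite dotEDr dotEZr.
have dYJ W : is_derive p X (fun q => dotE W (Jmap q)) (dotE W (Jmap X)).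
  apply: (@is_derive_direction _ _ (fun q => dotE W (Jmap q))) => a y z.
  by rewrite !Jmap_lin !dotE_lin.
have dN : is_derive p X (fun q => 1 - dotE q q) (- (2 * dotE X p)).
  have := is_deriveBf (is_derive_cstf (1 : R) p X)
    (is_derive_dotE (is_derive_id p X) (is_derive_id p X)).
  move/is_derive_eq; apply; rewrite (dotEC p X) /=; ring.
have dB := is_deriveMf (is_deriveMf (is_derive_cstf (4 : R) p X)
  (is_deriveDf (is_deriveDf (is_deriveMf dN (is_derive_cstf (dotE Y Z) p X))
     (is_deriveMf (dY Y) (dY Z))) (is_deriveMf (dYJ Y) (dYJ Z))))
  (is_deriveVf (is_deriveMf dN dN) (mulf_neq0 N0 N0)).
by apply: is_derive_eq dB _; field.
Qed.

(** The Christoffel symbols of the Bergman metric, complex bilinear in [X] and [Y] as for any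
    Kaehler metric in holomorphic coordinates. *)
Definition christoffel p X Y : E :=
  (1 - dotE p p)^-1 *: (cscale (hE X p) Y + cscale (hE Y p) X).

Lemma koszul_bergman p X Y Z : CH p ->
  koszul bergman p X Y Z = bergman p (christoffel p X Y) Z.
Proof.
move=> pB; rewrite /koszul.
have [_ ->] := is_derive_bergman X Y Z pB.
have [_ ->] := is_derive_bergman Y X Z pB.
have [_ ->] := is_derive_bergman Z X Y pB.
rewrite /bergman /christoffel !cscaleE /= !dotE_lin.
rewrite ?dotEJJ ?dotEJl ?Jmap_lin ?dotE_lin.
rewrite (dotEC Y X) (dotEC Z X) (dotEC Z Y).
rewrite (_ : dotE Y (Jmap X) = - dotE X (Jmap Y)); last by rewrite -dotEJl dotEC.
rewrite (_ : dotE Z (Jmap X) = - dotE X (Jmap Z)); last by rewrite -dotEJl dotEC.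
rewrite (_ : dotE Z (Jmap Y) = - dotE Y (Jmap Z)); last by rewrite -dotEJl dotEC.
by field; rewrite subr_eq0 eq_sym; apply: contraTneq pB => /= e; rewrite /CH /= e ltxx.
Qed.

Lemma bergmanDl p X Y Z : bergman p (X + Y) Z = bergman p X Z + bergman p Y Z.
Proof. by rewrite /bergman !dotE_lin; ring. Qed.

Lemma bergmanBl p X Y Z : bergman p (X - Y) Z = bergman p X Z - bergman p Y Z.
Proof. by rewrite /bergman !dotE_lin; ring. Qed.

Lemma CH_gt0 p : CH p -> 0 < 1 - dotE p p.
Proof. by rewrite subr_gt0. Qed.

Lemma bergman_gt0 p X : CH p -> X != 0 -> 0 < bergman p X X.
Proof.
move=> /CH_gt0 N0 X0; rewrite divr_gt0 ?exprn_gt0// mulr_gt0//.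
by rewrite -addrA ltr_wpDr ?mulr_gt0 ?dotE_gt0// addr_ge0// -expr2 sqr_ge0.
Qed.

Lemma bergman_inj p X Y : CH p ->
  (forall Z, bergman p X Z = bergman p Y Z) -> X = Y.
Proof.
move=> pB XY; apply/eqP; rewrite -subr_eq0.
apply: contraT => /(bergman_gt0 pB); rewrite bergmanBl XY subrr ltxx //.
Qed.

Lemma is_covariant_derivative_bergmanP (c V : R -> E) t A : CH (c t) ->
  is_covariant_derivative bergman c V t A <->
  exists c' V', [/\ is_derive t 1 c c', is_derive t 1 V V' &
                    A = V' + christoffel (c t) c' (V t)].
Proof.
move=> cB; split=> -[c' [V' [dc dV AE]]]; exists c', V'; split=> //.
  apply: (bergman_inj cB) => Z.
  by rewrite AE bergmanDl koszul_bergman.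
by move=> Z; rewrite AE bergmanDl koszul_bergman.
Qed.

(* The geodesics through the origin. The components of the moment map of the
   isometry group at the velocity of a geodesic, Im h(c', c) / (1 - |c|^2)^2
   and, when this vanishes, c' / (1 - |c|^2), are constant. *)
Lemma geodesic_velocity (c : R -> E) (xi : E) : is_geodesic CH bergman c ->
  c 0 = 0 -> c^`()%classic 0 = xi ->
  forall t : R, is_derive t 1 c ((1 - dotE (c t) (c t)) *: xi).
Proof.
move=> geo c0 xiE; set u := c^`()%classic in xiE *.
have cB t : CH (c t) by case: (geo t).
have du (t : R) : is_derive t 1 c (u t) /\
    is_derive t 1 u (- ((2 / (1 - dotE (c t) (c t))) *: cscale (hE (u t) (c t)) (u t))).
  have [_ /(is_covariant_derivative_bergmanP _ _ (cB t))] := geo t.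
  move=> [c' [V' [dc dV]]]; rewrite -/u.
  have c'E : c' = u t by case: dc => _ <-; rewrite /u derive1E.
  rewrite {c'}c'E in dc * => e.
  split=> //; apply: is_derive_eq dV _.
  move: e => /esym/eqP; rewrite addr_eq0 => /eqP ->.
  rewrite /christoffel -mulr2n -scaler_nat scalerA mulrC //.
pose N t := 1 - dotE (c t) (c t).
have N0 t : N t != 0 by exact: lt0r_neq0 (CH_gt0 (cB t)).
have dN (t : R) : is_derive t 1 N (- (2 * dotE (u t) (c t))).
  have [dc _] := du t.
  apply: is_derive_eq (is_deriveBf (is_derive_cstR 1 _) (is_derive_dotE dc dc)) _.
  by rewrite (dotEC (c t) (u t)); ring.
have h0 t : dotE (u t) (Jmap (c t)) = 0.
  have : dotE (u t) (Jmap (c t)) / (N t * N t) = dotE (u 0) (Jmap (c 0)) / (N 0 * N 0).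
    apply: (@is_derive_0_is_cst R
      (fun t => dotE (u t) (Jmap (c t)) / (N t * N t))) => s.
    have [dc dus] := du s; have Ns := N0 s.
    apply: is_derive_eq (is_deriveMf (is_derive_dotE dus (is_derive_Jmap dc))
      (is_deriveVf (is_deriveMf (dN s) (dN s)) (mulf_neq0 Ns Ns))) _.
    rewrite -/(N s) cscaleE !dotE_lin dotEJJ dotExJx /=.
    by field.
  rewrite c0 linear0 dotE0r mul0r => /eqP.
  by rewrite mulf_eq0 invr_eq0 mulf_eq0 !(negPf (N0 t)) !orbF => /eqP.
have uN t : (N t)^-1 *: u t = xi.
  rewrite -xiE -[RHS]scale1r.
  have -> : 1 = (N 0)^-1 :> R by rewrite /N c0 dotE0l subr0 invr1.
  apply/rowP => j.
  apply: (@is_derive_0_is_cst R (fun t => ((N t)^-1 *: u t) 0 j)) => s.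
  have [dc dus] := du s; have Ns := N0 s.
  have := (is_derive_mxP _ _ _ _).1 (is_deriveZf (is_deriveVf (dN s) Ns) dus) 0 j.
  move/is_derive_eq; apply; rewrite !cscaleE /= h0 scale0r addr0 -/(N s) !mxE.
  by field.
move=> t; have [dc _] := du t; apply: is_derive_eq dc _.
by rewrite -(uN t) scalerA divff ?scale1r//; exact: N0.
Qed.

(** tanh (t / 2), the Euclidean distance from 0 of a point at hyperbolic distance t. *)
Definition thalf (t : R) : R := (expR t - 1) / (expR t + 1).

Lemma expR1_neq0 (t : R) : expR t + 1 != 0.
Proof. by rewrite gt_eqF// addr_gt0 ?expR_gt0. Qed.

Lemma is_derive_thalf (t : R) : is_derive t 1 thalf ((1 - thalf t ^+ 2) / 2).
Proof.
have de := is_derive_expR t; have e0 := expR1_neq0 t.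
apply: is_derive_eq (is_deriveMf (is_deriveBf de (is_derive_cstR 1 _))
  (is_deriveVf (is_deriveDf de (is_derive_cstR 1 _)) e0)) _.
by rewrite /thalf /=; field.
Qed.

Lemma thalf0 : thalf 0 = 0.
Proof. by rewrite /thalf expR0 subrr mul0r. Qed.

Lemma thalf_bound t : thalf t ^+ 2 < 1.
Proof.
have e0 := expR_gt0 t; have e1 := expR1_neq0 t.
rewrite /thalf expr_div_n ltr_pdivrMr ?exprn_gt0 ?addr_gt0// mul1r; nra.
Qed.

Lemma thalf_gt0 t : 0 < t -> 0 < thalf t.
Proof.
move=> t0; apply: divr_gt0; first by rewrite subr_gt0 expR_gt1.
by rewrite addr_gt0 ?expR_gt0.
Qed.

(** The function (1 + y) / (1 - y) satisfies f' = f, so its quotient by [expR] is constant; solving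
    for y gives tanh (t / 2). *)
Lemma riccati_unique (y : R -> R) :
  (forall t : R, is_derive t 1 y ((1 - y t ^+ 2) / 2)) -> (forall t, y t ^+ 2 < 1) ->
  y 0 = 0 -> y =1 thalf.
Proof.
move=> dy yb y0 t.
have ny s : 1 - y s != 0.
  by rewrite subr_eq0 eq_sym; apply: contraTneq (yb s) => ->; rewrite expr1n ltxx.
have en (s : R) : expR s != 0 by rewrite gt_eqF ?expR_gt0.
have : (1 + y t) / (1 - y t) / expR t = (1 + y 0) / (1 - y 0) / expR 0.
  apply: (@is_derive_0_is_cst R (fun t => (1 + y t) / (1 - y t) / expR t)) => s.
  have nys := ny s.
  have d1 := is_deriveDf (is_derive_cstR 1 s) (dy s).
  have d2 := is_deriveVf (is_deriveBf (is_derive_cstR 1 s) (dy s)) nys.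
  have d3 := is_deriveVf (is_derive_expR s) (en s).
  apply: is_derive_eq (is_deriveMf (is_deriveMf d1 d2) d3) _.
  by have ens := en s; field; rewrite ens.
rewrite y0 expR0 addr0 subr0 !divr1 => e; rewrite /thalf.
have nyt := ny t; have ent := en t; have et := expR1_neq0 t.
have {}e : 1 + y t = expR t * (1 - y t).
  transitivity ((1 + y t) / (1 - y t) / expR t * (expR t * (1 - y t))).
    by field; rewrite ?nyt ?ent.
  by rewrite e mul1r.
by apply: (mulIf et); rewrite divfK//; lra.
Qed.

(** By [geodesic_velocity] the velocity stays a multiple of its initial value xi, where |xi|^2 = 1/4
    because the metric at 0 is four times the Euclidean one. So c = s xi with s = 4 <c, xi>, and s /
    2 solves the Riccati equation. *)
Lemma geodesic0E (c : R -> E) : is_geodesic CH bergman c -> c 0 = 0 ->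
  bergman 0 (c^`()%classic 0) (c^`()%classic 0) = 1 ->
  forall t, c t = (2 * thalf t) *: c^`()%classic 0.
Proof.
set xi := c^`()%classic 0 => geo c0 n1.
have dc := geodesic_velocity geo c0 (erefl xi).
have xi1 : dotE xi xi = 4^-1.
  move: n1; rewrite /bergman !linear0 !dotE_lin subr0 mul1r.
  by rewrite !mul0r !addr0 expr1n divr1 => n1; lra.
pose s t := 4 * dotE (c t) xi.
have ds (t : R) : is_derive t 1 s (1 - dotE (c t) (c t)).
  apply: is_derive_eq (is_deriveMf (is_derive_cstR 4 _)
    (is_derive_dotE (dc t) (is_derive_cstE xi _))) _.
  by rewrite !dotE_lin xi1; field.
have cE t : c t = s t *: xi.
  apply/rowP => j; rewrite mxE; apply/eqP; rewrite -subr_eq0; apply/eqP.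
  transitivity (c 0 0 j - s 0 * xi 0 j); last first.
    by rewrite /s c0 mxE dotE0l; ring.
  apply: (@is_derive_0_is_cst R (fun t => c t 0 j - s t * xi 0 j)) => v.
  have dcj := (is_derive_mxP _ _ _ _).1 (dc v) 0 j.
  apply: is_derive_eq (is_deriveBf dcj
    (is_deriveMf (ds v) (is_derive_cstR (xi 0 j) _))) _.
  by rewrite mxE; ring.
have ccE t : dotE (c t) (c t) = (s t / 2) ^+ 2.
  by rewrite {1 2}cE !dotE_lin xi1; field.
have y_th : (fun t => s t / 2) =1 thalf.
  apply: (@riccati_unique (fun t => s t / 2)) => [t|t|].
  - apply: is_derive_eq (is_deriveMf (ds t) (is_derive_cstR 2^-1 _)) _.
    by rewrite ccE; field.
  - by rewrite -ccE; case: (geo t).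
  - by rewrite /s c0 dotE0l; field.
by move=> t; rewrite {1}cE -y_th; congr (_ *: _); field.
Qed.

Lemma is_derive_thalfZ (t : R) (xi : E) : is_derive t 1 (fun t => (2 * thalf t) *: xi)
  ((1 - thalf t ^+ 2) *: xi).
Proof.
apply: is_derive_eq (is_deriveZf (is_deriveMf (is_derive_cstR 2 _)
  (is_derive_thalf t)) (is_derive_cstE xi _)) _.
by rewrite scaler0 addr0; congr (_ *: _); field.
Qed.

Lemma geodesic_thalf (xi : E) : dotE xi xi = 4^-1 ->
  is_geodesic CH bergman (fun t => (2 * thalf t) *: xi).
Proof.
move=> xi1 t.
have nE s : dotE ((2 * thalf s) *: xi) ((2 * thalf s) *: xi) = thalf s ^+ 2.
  by rewrite !dotE_lin xi1; field.
have cB : CH ((2 * thalf t) *: xi) by rewrite /CH /= nE thalf_bound.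
split=> //; apply/is_covariant_derivative_bergmanP => //.
have -> : (fun t => (2 * thalf t) *: xi)^`()%classic =
    fun t => (1 - thalf t ^+ 2) *: xi.
  apply/funext => s; rewrite derive1E.
  by case: (is_derive_thalfZ s xi).
exists ((1 - thalf t ^+ 2) *: xi), (- (thalf t * (1 - thalf t ^+ 2)) *: xi).
split; first exact: is_derive_thalfZ.
  apply: is_derive_eq (is_deriveZf (is_deriveBf (is_derive_cstR 1 _)
    (is_deriveMf (is_derive_thalf t) (is_derive_thalf t)))
    (is_derive_cstE xi _)) _.
  by rewrite scaler0 addr0; congr (_ *: _); field.
have N0 : 1 - thalf t ^+ 2 != 0 by rewrite subr_eq0 gt_eqF ?thalf_bound.
rewrite /christoffel nE !hE_lin hExx xi1 -!rmorphM /= cscale_real.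
by apply/rowP => j; rewrite !mxE; field.
Qed.

End LeviCivita.

(** * Isometries of the ball *)

Section Isometries.
Context {R : realType} {n : nat}.
Local Notation E := 'rV[R]_(n + n).
Local Notation C := R[i].
Local Notation Mat := 'M[C]_(1 + n).
Implicit Types (z w X Y : E) (x y : 'cV[C]_(1 + n)) (A B : Mat) (a b : C).

Lemma sub1C (r : R) : 1 - r%:C = (1 - r)%:C :> C.
Proof. by rewrite rmorphB rmorph1. Qed.

Lemma conjCK a : (a^*)^* = a.
Proof. by apply: complexP; rewrite !(Reconj, Imconj) ?opprK. Qed.

Definition adj p q (M : 'M[C]_(p, q)) : 'M[C]_(q, p) := (map_mx (@conjc R) M)^T.

Lemma adjM p q r (M : 'M[C]_(p, q)) (N : 'M[C]_(q, r)) :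
  adj (M *m N) = adj N *m adj M.
Proof. by rewrite /adj map_mxM trmx_mul. Qed.

Lemma adjD p q (M N : 'M[C]_(p, q)) : adj (M + N) = adj M + adj N.
Proof. by apply/matrixP => i j; rewrite !mxE rmorphD. Qed.

Lemma adjN p q (M : 'M[C]_(p, q)) : adj (- M) = - adj M.
Proof. by apply/matrixP => i j; rewrite !mxE rmorphN. Qed.

Lemma adjZ p q a (M : 'M[C]_(p, q)) : adj (a *: M) = a^* *: adj M.
Proof. by apply/matrixP => i j; rewrite !mxE rmorphM. Qed.

Lemma adjK p q (M : 'M[C]_(p, q)) : adj (adj M) = M.
Proof. by apply/matrixP => i j; rewrite !mxE conjcK. Qed.

Definition head_coord x : C := usubmx x 0 0.

Definition tail_coord x : 'cV[C]_n := dsubmx x.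

Lemma head_coordD x y : head_coord (x + y) = head_coord x + head_coord y.
Proof. by rewrite /head_coord !mxE. Qed.

Lemma head_coordZ a x : head_coord (a *: x) = a * head_coord x.
Proof. by rewrite /head_coord !mxE. Qed.

Lemma tail_coordD x y : tail_coord (x + y) = tail_coord x + tail_coord y.
Proof. exact: linearD. Qed.

Lemma tail_coordZ a x : tail_coord (a *: x) = a *: tail_coord x.
Proof. exact: linearZ. Qed.

Definition coord_lin := (head_coordD, head_coordZ, tail_coordD, tail_coordZ).

Lemma coord_ext x y :
  head_coord x = head_coord y -> tail_coord x = tail_coord y -> x = y.
Proof.
move=> h t; rewrite -(vsubmxK x) -(vsubmxK y); congr col_mx => //.
by apply/matrixP => i j; rewrite !ord1.
Qed.

Definition lift z : 'cV[C]_(1 + n) := col_mx 1%:M (vec_to_complex z).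

Definition hlift X : 'cV[C]_(1 + n) := col_mx 0 (vec_to_complex X).

Lemma head_lift z : head_coord (lift z) = 1.
Proof. by rewrite /head_coord col_mxKu mxE. Qed.

Lemma tail_lift z : tail_coord (lift z) = vec_to_complex z.
Proof. exact: col_mxKd. Qed.

Lemma head_hlift X : head_coord (hlift X) = 0.
Proof. by rewrite /head_coord col_mxKu mxE. Qed.

Lemma tail_hlift X : tail_coord (hlift X) = vec_to_complex X.
Proof. exact: col_mxKd. Qed.

Lemma head_scale_lift a z : head_coord (a *: lift z) = a.
Proof. by rewrite head_coordZ head_lift mulr1. Qed.

Lemma tail_scale_lift a z : tail_coord (a *: lift z) = a *: vec_to_complex z.
Proof. by rewrite tail_coordZ tail_lift. Qed.

Lemma head_comb a X b z : head_coord (a *: hlift X + b *: lift z) = b.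
Proof. by rewrite head_coordD !head_coordZ head_hlift head_lift mulr0 add0r mulr1. Qed.

Lemma tail_comb a X b z : tail_coord (a *: hlift X + b *: lift z) =
  a *: vec_to_complex X + b *: vec_to_complex z.
Proof. by rewrite tail_coordD !tail_coordZ tail_hlift tail_lift. Qed.

Definition liftE := (head_lift, tail_lift, head_hlift, tail_hlift).

(* The Hermitian form of C^{1,n}, linear in the first argument. *)
Definition lorentz x y : C :=
  - (head_coord x * (head_coord y)^*) + (adj (tail_coord y) *m tail_coord x) 0 0.

Lemma lorentz_hform x y : lorentz x y = (adj y *m hform *m x) 0 0.
Proof.
rewrite /lorentz -[in RHS](vsubmxK x) -[in RHS](vsubmxK y) /adj map_col_mx tr_col_mx.
rewrite /hform mul_row_block mul_row_col !mulmx0 !addr0 add0r mulmx1 mulmxN mulmx1.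
rewrite mulNmx [RHS]mxE [X in _ = X + _]mxE; congr (- _ + _).
by rewrite /head_coord [RHS]mxE big_ord1 !mxE mulrC.
Qed.

Lemma lorentzDl x y v : lorentz (x + y) v = lorentz x v + lorentz y v.
Proof. by rewrite !lorentz_hform mulmxDr mxE. Qed.

Lemma lorentzZl a x v : lorentz (a *: x) v = a * lorentz x v.
Proof. by rewrite !lorentz_hform -scalemxAr mxE. Qed.

Lemma lorentzDr x y v : lorentz x (y + v) = lorentz x y + lorentz x v.
Proof. by rewrite !lorentz_hform adjD !mulmxDl mxE. Qed.

Lemma lorentzZr a x v : lorentz x (a *: v) = a^* * lorentz x v.
Proof. by rewrite !lorentz_hform adjZ -!scalemxAl mxE. Qed.

Definition lorentz_lin := (lorentzDl, lorentzDr, lorentzZl, lorentzZr).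

Lemma lorentzE x y X Y : tail_coord x = vec_to_complex X ->
  tail_coord y = vec_to_complex Y ->
  lorentz x y = - (head_coord x * (head_coord y)^*) + hE X Y.
Proof. by rewrite /lorentz hE_vec => -> ->. Qed.

Lemma lorentz_lift z w : lorentz (lift z) (lift w) = hE z w - 1.
Proof. by rewrite (lorentzE (tail_lift _) (tail_lift _)) !liftE rmorph1 mulr1 addrC. Qed.

Lemma lorentz_hlift X Y : lorentz (hlift X) (hlift Y) = hE X Y.
Proof. by rewrite (lorentzE (tail_hlift _) (tail_hlift _)) !liftE mul0r oppr0 add0r. Qed.

Lemma lorentz_hlift_lift X z : lorentz (hlift X) (lift z) = hE X z.
Proof. by rewrite (lorentzE (tail_hlift _) (tail_lift _)) !liftE mul0r oppr0 add0r. Qed.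

Lemma lorentz_lift_hlift X z : lorentz (lift z) (hlift X) = hE z X.
Proof. by rewrite (lorentzE (tail_lift _) (tail_hlift _)) !liftE rmorph0 mulr0 oppr0 add0r. Qed.

Definition lorentz_liftE :=
  (lorentz_lift, lorentz_hlift, lorentz_hlift_lift, lorentz_lift_hlift).

Lemma lorentz_comb a X b z c Y d w :
  lorentz (a *: hlift X + b *: lift z) (c *: hlift Y + d *: lift w) =
  a * c^* * hE X Y + a * d^* * hE X w + b * c^* * hE z Y
  + b * d^* * (hE z w - 1).
Proof. by rewrite !lorentz_lin !lorentz_liftE; ring. Qed.

Lemma lorentz_comb_lift a X b z d w :
  lorentz (a *: hlift X + b *: lift z) (d *: lift w) =
  a * d^* * hE X w + b * d^* * (hE z w - 1).
Proof. by rewrite !lorentz_lin !lorentz_liftE; ring. Qed.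

Lemma lorentz_lift_lift b z d w :
  lorentz (b *: lift z) (d *: lift w) = b * d^* * (hE z w - 1).
Proof. by rewrite !lorentz_lin !lorentz_liftE; ring. Qed.

Definition unitary A := adj A *m hform *m A = hform.

Lemma lorentz_unitary A x y : unitary A ->
  lorentz (A *m x) (A *m y) = lorentz x y.
Proof.
move=> AU; rewrite !lorentz_hform adjM -[in RHS]AU !mulmxA.
by [].
Qed.

Lemma unitaryM A B : unitary A -> unitary B -> unitary (A *m B).
Proof.
move=> AU BU; rewrite /unitary adjM -!mulmxA (mulmxA hform) (mulmxA (adj A)).
by rewrite (mulmxA (adj A)) AU mulmxA BU.
Qed.

Lemma unitary1 : unitary 1%:M.
Proof. by rewrite /unitary /adj map_mx1 trmx1 mulmx1 mul1mx. Qed.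

Lemma hformK : hform *m hform = 1%:M :> Mat.
Proof.
rewrite /hform mulmx_block !mulmx0 !mul0mx !addr0 !add0r mulmx1 mulNmx mul1mx opprK.
by rewrite -scalar_mx_block.
Qed.

Lemma adj_hform : adj hform = hform :> Mat.
Proof.
rewrite /adj /hform map_block_mx tr_block_mx !map_mx0 !trmx0 map_mx1 trmx1.
by rewrite map_mxN map_mx1 raddfN /= trmx1.
Qed.

Definition unitary_inv A := hform *m adj A *m hform.

Lemma unitary_invl A : unitary A -> unitary_inv A *m A = 1%:M.
Proof. by move=> AU; rewrite /unitary_inv -!mulmxA (mulmxA (adj A)) AU hformK. Qed.

Lemma unitary_invr A : unitary A -> A *m unitary_inv A = 1%:M.
Proof. by move/unitary_invl/mulmx1C. Qed.

Lemma unitary_unitary_inv A : unitary A -> unitary (unitary_inv A).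
Proof.
move=> AU; rewrite /unitary.
have -> : adj (unitary_inv A) = hform *m A *m hform.
  by rewrite !adjM adjK adj_hform mulmxA.
by rewrite -(mulmxA _ hform hform) hformK mulmx1 -mulmxA unitary_invr// mulmx1.
Qed.

(* Locked: otherwise unification unfolds matrix products. *)
Fact action_key : unit. Proof. exact: tt. Qed.

Definition denom A z : C := locked_with action_key (head_coord (A *m lift z)).

Definition ddenom A X : C := locked_with action_key (head_coord (A *m hlift X)).

(** The differential of [ball_action A] at [z], by the quotient rule: [denom A z] is the automorphy
    factor, the head coordinate of A (1, z), and [ddenom A X] is its derivative in the direction
    [X]. *)
Definition dball_action A z X : E := locked_with action_key
  (vec_of_complex ((denom A z)^-1 *: (tail_coord (A *m hlift X) -
     ddenom A X *: vec_to_complex (ball_action A z)))).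

Lemma denomE A z : denom A z = head_coord (A *m lift z).
Proof. exact: locked_withE. Qed.

Lemma ddenomE A X : ddenom A X = head_coord (A *m hlift X).
Proof. exact: locked_withE. Qed.

Lemma vec_dball_action A z X : vec_to_complex (dball_action A z X) =
  (denom A z)^-1 *: (tail_coord (A *m hlift X) -
     ddenom A X *: vec_to_complex (ball_action A z)).
Proof.
transitivity (vec_to_complex (vec_of_complex ((denom A z)^-1 *:
  (tail_coord (A *m hlift X) - ddenom A X *: vec_to_complex (ball_action A z))))).
  by congr vec_to_complex; exact: locked_withE.
exact: vec_of_complexK.
Qed.

Lemma vec_ball_action A z : vec_to_complex (ball_action A z) =
  (denom A z)^-1 *: tail_coord (A *m lift z).
Proof. by rewrite denomE vec_of_complexK. Qed.

Section Action.
Variables (A : Mat) (z : E).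
Hypotheses (AU : unitary A) (zB : CH z).

(** The vector (1, z) has negative Lorentz norm and A preserves the norm; a vanishing head
    coordinate would make the norm of A (1, z) nonnegative. *)
Lemma denom_neq0 : denom A z != 0.
Proof.
apply: contraTneq zB => d0; rewrite /CH /= -leNgt -subr_ge0.
have := lorentz_unitary (lift z) (lift z) AU.
rewrite (@lorentzE _ _ _ _ (esym (vec_of_complexK _)) (esym (vec_of_complexK _))).
rewrite -denomE d0 mul0r oppr0 add0r lorentz_lift !hExx => -[+].
by move=> <- _; exact: dotE_ge0.
Qed.

Lemma mul_lift : A *m lift z = denom A z *: lift (ball_action A z).
Proof.
have d0 := denom_neq0; apply: coord_ext.
  by rewrite [RHS]head_scale_lift denomE.
by rewrite [RHS]tail_scale_lift vec_ball_action scalerA divff// scale1r.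
Qed.

Lemma mul_hlift X : A *m hlift X = denom A z *: hlift (dball_action A z X) +
  ddenom A X *: lift (ball_action A z).
Proof.
have d0 := denom_neq0; apply: coord_ext; first by rewrite [RHS]head_comb ddenomE.
by rewrite [RHS]tail_comb vec_dball_action scalerA divff// scale1r subrK.
Qed.

Lemma dball_action_unique X Y a :
  A *m hlift X = denom A z *: hlift Y + a *: lift (ball_action A z) ->
  dball_action A z X = Y.
Proof.
have d0 := denom_neq0; rewrite mul_hlift => e.
have := congr1 head_coord e; rewrite [LHS]head_comb [RHS]head_comb => ha.
have := congr1 tail_coord e; rewrite [LHS]tail_comb [RHS]tail_comb ha.
by move=> /addIr /(scalerI d0) /vec_to_complex_inj.
Qed.

Lemma denom_norm :
  (denom A z) * (denom A z)^* * (1 - hE (ball_action A z) (ball_action A z)) =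
  1 - hE z z.
Proof.
have := lorentz_unitary (lift z) (lift z) AU.
rewrite lorentz_lift mul_lift lorentz_lift_lift => e; rewrite -[RHS]opprB -e; ring.
Qed.

Lemma ball_action_CH : CH (ball_action A z).
Proof.
have d0 := complex_neq0 denom_neq0; rewrite /CH /= -subr_gt0.
have := denom_norm; rewrite !hExx !sub1C => /(congr1 (@complex.Re R)).
rewrite !ReImE /= mulr0 subr0 => e.
have : 0 < 1 - dotE z z by exact: CH_gt0.
rewrite -e mulrN opprK -!expr2 pmulr_rgt0// lt_def d0.
by rewrite addr_ge0 ?sqr_ge0.
Qed.

(** Invariance of the Lorentz form on the pair (0, X), (1, z), expanded by [mul_hlift] and
    [mul_lift]; [denom_norm] and [hE_dball] treat the other pairs likewise. *)
Lemma hE_base X : hE X z = denom A z * (denom A z)^* *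
    hE (dball_action A z X) (ball_action A z) -
  ddenom A X * (denom A z)^* *
    (1 - hE (ball_action A z) (ball_action A z)).
Proof.
have := lorentz_unitary (hlift X) (lift z) AU.
by rewrite lorentz_hlift_lift mul_hlift mul_lift lorentz_comb_lift => <-; ring.
Qed.

Lemma hE_dball X Y : hE X Y = denom A z * (denom A z)^* *
    hE (dball_action A z X) (dball_action A z Y)
  + denom A z * (ddenom A Y)^* *
    hE (dball_action A z X) (ball_action A z)
  + ddenom A X * (denom A z)^* *
    hE (ball_action A z) (dball_action A z Y)
  - ddenom A X * (ddenom A Y)^* *
    (1 - hE (ball_action A z) (ball_action A z)).
Proof.
have := lorentz_unitary (hlift X) (hlift Y) AU.
rewrite lorentz_hlift 2!mul_hlift lorentz_comb => <-.
move: (dball_action A z X) (dball_action A z Y) (ball_action A z) => u v w.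
move: (denom A z) (ddenom A X) (ddenom A Y) => a b c; ring.
Qed.

Lemma bergmanE w X Y : (bergman w X Y)%:C = 4 * (complex.Re
  (((1 - hE w w) * hE X Y + hE X w * hE w Y) / (1 - hE w w) ^+ 2))%:C.
Proof.
rewrite /bergman hExx sub1C -rmorphXn -fmorphV ReM /=.
have -> : 4 = 4%:C :> C by rewrite rmorph_nat.
rewrite -rmorphM /=; congr (_%:C).
by rewrite (dotEC w (Jmap Y)) dotEJl (dotEC w Y); ring.
Qed.

(** [denom_norm], [hE_base] and [hE_dball] express every term at z through the transported data. The
    terms with [ddenom] cancel, and numerator and denominator share the factor |denom|^4. *)
Lemma bergman_dball X Y :
  bergman (ball_action A z) (dball_action A z X) (dball_action A z Y) =
  bergman z X Y.
Proof.
apply: complexI; rewrite !bergmanE; congr (_ * (complex.Re _)%:C).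
have d0 := denom_neq0; have dc0 : (denom A z)^* != 0 by rewrite conjc_eq0.
have zY : hE z Y = (hE Y z)^* by rewrite hE_conj.
have wY : hE (ball_action A z) (dball_action A z Y) =
  (hE (dball_action A z Y) (ball_action A z))^* by rewrite hE_conj.
have N0 : 1 - hE (ball_action A z) (ball_action A z) != 0.
  rewrite hExx sub1C fmorph_eq0 gt_eqF// CH_gt0//.
  exact: ball_action_CH.
rewrite zY -denom_norm (hE_base X) (hE_base Y) (hE_dball X Y).
rewrite !(rmorphB, rmorphD, rmorphM) /= !hE_conj conjCK.
move: (hE _ _) (hE _ _) (hE _ _) (hE _ _) (denom A z)^* (denom A z) (ddenom A X)
  (ddenom A Y)^* d0 dc0 N0 => h1 h2 h3 h4 d' d e e' d0 d'0 N0.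
by field; rewrite d0 d'0 N0.
Qed.

Lemma hlift_lin a X Y : hlift (cscale a X + Y) = a *: hlift X + hlift Y.
Proof. by apply: coord_ext; rewrite !coord_lin !liftE ?vec_to_complex_lin //; ring. Qed.

Lemma dball_action_lin a X Y : dball_action A z (cscale a X + Y) =
  cscale a (dball_action A z X) + dball_action A z Y.
Proof.
apply: (@dball_action_unique _ _
  (a * ddenom A X + ddenom A Y)).
rewrite hlift_lin mulmxDr -scalemxAr 2!mul_hlift hlift_lin !scalerDr !scalerA.
rewrite scalerDl (mulrC (denom A z) a) !addrA; congr (_ + _).
by rewrite -!addrA; congr (_ + _); rewrite addrC.
Qed.

Lemma dball_action0 : dball_action A z 0 = 0.
Proof.
have := dball_action_lin 1 0 0; rewrite !cscale1 addr0 => e.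
by apply: (addrI (dball_action A z 0)); rewrite addr0 -e.
Qed.

Lemma dball_action_cscale a X :
  dball_action A z (cscale a X) = cscale a (dball_action A z X).
Proof. by have := dball_action_lin a X 0; rewrite dball_action0 !addr0. Qed.

Lemma dball_actionD X Y :
  dball_action A z (X + Y) = dball_action A z X + dball_action A z Y.
Proof. by have := dball_action_lin 1 X Y; rewrite !cscale1. Qed.

Lemma dball_actionZ (r : R) X :
  dball_action A z (r *: X) = r *: dball_action A z X.
Proof. by rewrite -!cscale_real dball_action_cscale. Qed.

Lemma dball_actionN X : dball_action A z (- X) = - dball_action A z X.
Proof. by rewrite -scaleN1r dball_actionZ scaleN1r. Qed.

Lemma christoffelE w X Y : christoffel w X Y =
  cscale (hE X w / (1 - hE w w)) Y + cscale (hE Y w / (1 - hE w w)) X.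
Proof.
rewrite /christoffel -cscale_real cscaleDr !cscaleA hExx fmorphV rmorphB rmorph1.
by rewrite !(mulrC _^-1).
Qed.

(** [ddenom A X / denom A z] is the logarithmic derivative of the automorphy factor. The two
    correction terms are the ones that the second derivative of the action subtracts in
    [is_derive_dball_action], so covariant derivatives are carried along by the action. *)
Lemma christoffel_dball X Y :
  christoffel (ball_action A z) (dball_action A z X) (dball_action A z Y) =
  dball_action A z (christoffel z X Y)
  + cscale (ddenom A X / denom A z) (dball_action A z Y)
  + cscale (ddenom A Y / denom A z) (dball_action A z X).
Proof.
have d0 := denom_neq0; have dc0 : (denom A z)^* != 0 by rewrite conjc_eq0.
have N0 : 1 - hE (ball_action A z) (ball_action A z) != 0.
  rewrite hExx sub1C fmorph_eq0 gt_eqF// CH_gt0//.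
  exact: ball_action_CH.
have hw U : hE (dball_action A z U) (ball_action A z) /
      (1 - hE (ball_action A z) (ball_action A z)) =
    hE U z / (1 - hE z z) + ddenom A U / denom A z.
  by rewrite -denom_norm (hE_base U); field; rewrite d0 dc0 N0.
have DE := dball_actionD (cscale (hE X z / (1 - hE z z)) Y)
  (cscale (hE Y z / (1 - hE z z)) X).
rewrite (dball_action_cscale _ Y) (dball_action_cscale _ X) in DE.
rewrite (christoffelE z) DE.
move: (dball_action A z X) (dball_action A z Y) (ball_action A z) (hw X) (hw Y).
move=> DX DY w hX hY.
rewrite christoffelE hX hY !cscaleDl.
have arr (u v u' v' : E) : u + v + (u' + v') = u + u' + v + v'.
  by rewrite addrACA addrA.
exact: arr.
Qed.

End Action.

Lemma mderive_lift (c : R -> E) (t : R) c' : is_derive t 1 c c' ->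
  mderive (fun s => lift (c s)) t (hlift c').
Proof.
move=> /is_derive_vecP dc i j; case: (split_ordP i) => k ->.
  rewrite /hlift col_mxEu mxE.
  apply: cderive_ext (cderive_cst (1%:M k j) t) => s; by rewrite /lift col_mxEu.
rewrite /hlift col_mxEd.
by apply: cderive_ext (dc k j) => s; rewrite /lift col_mxEd.
Qed.

Lemma mderive_hlift (c : R -> E) (t : R) c' : is_derive t 1 c c' ->
  mderive (fun s => hlift (c s)) t (hlift c').
Proof.
move=> /is_derive_vecP dc i j; case: (split_ordP i) => k ->.
  rewrite /hlift col_mxEu mxE.
  apply: cderive_ext (cderive_cst 0 t) => s; by rewrite /hlift col_mxEu mxE.
rewrite /hlift col_mxEd.
by apply: cderive_ext (dc k j) => s; rewrite /hlift col_mxEd.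
Qed.

Lemma cderive_head (x : R -> 'cV[C]_(1 + n)) (t : R) x' : mderive x t x' ->
  cderive (fun s => head_coord (x s)) t (head_coord x').
Proof.
move=> dx; rewrite /head_coord mxE.
by apply: cderive_ext (dx (lshift n 0) 0) => s; rewrite mxE.
Qed.

Lemma mderive_tail (x : R -> 'cV[C]_(1 + n)) (t : R) x' : mderive x t x' ->
  mderive (fun s => tail_coord (x s)) t (tail_coord x').
Proof.
move=> dx i j; rewrite /tail_coord mxE.
by apply: cderive_ext (dx (rshift 1 i) j) => s; rewrite mxE.
Qed.

Lemma is_derive_ball_action A (c : R -> E) (t : R) c' : unitary A -> CH (c t) ->
  is_derive t 1 c c' ->
  is_derive t 1 (fun s => ball_action A (c s)) (dball_action A (c t) c').
Proof.
move=> AU cB dc; have d0 := denom_neq0 AU cB.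
have dx := mderiveMl A (mderive_lift dc).
have dd : cderive (fun s => denom A (c s)) t (ddenom A c').
  rewrite ddenomE; apply: cderive_ext (cderive_head dx) => s.
  by rewrite denomE.
apply/is_derive_vecP.
apply: (mderive_ext (fun s => esym (vec_ball_action A (c s)))).
apply: mderive_eq (mderiveZ (cderiveV dd d0) (mderive_tail dx)) _.
have -> : tail_coord (A *m lift (c t)) = denom A (c t) *: vec_to_complex (ball_action A (c t)).
  by rewrite mul_lift// [LHS]tail_scale_lift.
rewrite vec_dball_action scalerBr scalerA addrC; congr (_ + _).
by rewrite scalerA -scaleNr; congr (_ *: _); field.
Qed.

Lemma is_derive_dball_action A (c V : R -> E) (t : R) c' V' :
  unitary A -> CH (c t) -> is_derive t 1 c c' -> is_derive t 1 V V' ->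
  is_derive t 1 (fun s => dball_action A (c s) (V s))
    (dball_action A (c t) V'
     - cscale (ddenom A (V t) / denom A (c t)) (dball_action A (c t) c')
     - cscale (ddenom A c' / denom A (c t)) (dball_action A (c t) (V t))).
Proof.
move=> AU cB dc dV; have d0 := denom_neq0 AU cB.
have dx := mderiveMl A (mderive_lift dc).
have dy := mderiveMl A (mderive_hlift dV).
have dd : cderive (fun s => denom A (c s)) t (ddenom A c').
  rewrite ddenomE; apply: cderive_ext (cderive_head dx) => s.
  by rewrite denomE.
have de : cderive (fun s => ddenom A (V s)) t (ddenom A V').
  rewrite ddenomE; apply: cderive_ext (cderive_head dy) => s.
  by rewrite ddenomE.
have /is_derive_vecP dw := is_derive_ball_action AU cB dc.
apply/is_derive_vecP.
apply: (mderive_ext (fun s => esym (vec_dball_action A (c s) (V s)))).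
apply: mderive_eq (mderiveZ (cderiveV dd d0)
  (mderiveB (mderive_tail dy) (mderiveZ de dw))) _.
have tE X : tail_coord (A *m hlift X) = denom A (c t) *: vec_to_complex (dball_action A (c t) X)
    + ddenom A X *: vec_to_complex (ball_action A (c t)).
  by rewrite {1}(mul_hlift AU cB) [LHS]tail_comb.
rewrite (tE (V t)) (tE V'); move: (ball_action A (c t)) => w.
move: (dball_action A (c t) V') (dball_action A (c t) (V t)) (dball_action A (c t) c').
move: (denom A (c t)) d0 (ddenom A V') (ddenom A (V t)) (ddenom A c').
move=> d d0 e e' f X Y Z; rewrite !vec_to_complex_lin.
move: (vec_to_complex X) (vec_to_complex Y) (vec_to_complex Z) (vec_to_complex w).
move=> x y x' y'; apply/matrixP => i j; rewrite !mxE.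
by field.
Qed.

Lemma is_covariant_derivative_ball_action A (c V : R -> E) (t : R) W :
  unitary A -> CH (c t) -> is_covariant_derivative bergman c V t W ->
  is_covariant_derivative bergman (fun s => ball_action A (c s))
    (fun s => dball_action A (c s) (V s)) t (dball_action A (c t) W).
Proof.
move=> AU cB /(is_covariant_derivative_bergmanP _ _ cB) [c' [V' [dc dV ->]]].
apply/is_covariant_derivative_bergmanP; first exact: ball_action_CH.
have dw := is_derive_ball_action AU cB dc.
have dDV := is_derive_dball_action AU cB dc dV.
do 2 eexists; split; [exact: dw|exact: dDV|].
rewrite christoffel_dball// dball_actionD//.
have arr (x y a b : E) : x + y = x - a - b + (y + b + a).
  by apply/rowP => j; rewrite !mxE; ring.
exact: arr.
Qed.

Lemma ball_actionM A B z : unitary A -> unitary B -> CH z ->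
  ball_action (A *m B) z = ball_action A (ball_action B z) /\
  denom (A *m B) z = denom A (ball_action B z) * denom B z.
Proof.
move=> AU BU zB; have wB := ball_action_CH BU zB.
have e := mul_lift (unitaryM AU BU) zB.
have d0 := denom_neq0 (unitaryM AU BU) zB.
rewrite -mulmxA (mul_lift BU zB) -scalemxAr (mul_lift AU wB) scalerA in e.
have e1 : denom (A *m B) z = denom A (ball_action B z) * denom B z.
  have := congr1 head_coord e.
  by rewrite [LHS]head_scale_lift [RHS]head_scale_lift mulrC => <-.
split; last exact: e1.
have := congr1 tail_coord e; rewrite [LHS]tail_scale_lift [RHS]tail_scale_lift.
rewrite e1 (mulrC (denom B z)) => /esym; rewrite e1 in d0.
by move=> /(scalerI d0)/vec_to_complex_inj.
Qed.

Lemma dball_actionM A B z X : unitary A -> unitary B -> CH z ->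
  dball_action (A *m B) z X =
  dball_action A (ball_action B z) (dball_action B z X).
Proof.
move=> AU BU zB; have wB := ball_action_CH BU zB.
have [bE dE] := ball_actionM AU BU zB.
apply: (dball_action_unique (unitaryM AU BU) zB (a :=
  denom B z * ddenom A (dball_action B z X) +
  ddenom B X * denom A (ball_action B z))).
rewrite -(mulmxA A B) (mul_hlift BU zB X) mulmxDr -!scalemxAr (mul_hlift AU wB).
rewrite (mul_lift AU wB).
rewrite bE dE; move: (ball_action A _) (dball_action A _ _) => w Z.
move: (ddenom A _) (ddenom B _) (denom A _) (denom B z) (lift w) (hlift Z).
move=> a b c d x y; rewrite scalerDl !scalerDr !scalerA -addrA.
by rewrite (mulrC d c).
Qed.

Lemma ball_action1 z : ball_action 1%:M z = z.
Proof.
rewrite /ball_action mul1mx col_mxKd col_mxKu mxE invr1 scale1r.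
exact: vec_to_complexK.
Qed.

Lemma dball_action1 z X : CH z -> dball_action 1%:M z X = X.
Proof.
move=> zB; apply: (dball_action_unique unitary1 zB (a := 0)).
by rewrite scale0r addr0 mul1mx denomE mul1mx liftE scale1r.
Qed.

Lemma ball_actionK A z : unitary A -> CH z ->
  ball_action (unitary_inv A) (ball_action A z) = z.
Proof.
move=> AU zB; have [<- _] := ball_actionM (unitary_unitary_inv AU) AU zB.
by rewrite unitary_invl// ball_action1.
Qed.

Lemma ball_actionVK A z : unitary A -> CH z ->
  ball_action A (ball_action (unitary_inv A) z) = z.
Proof.
move=> AU zB; have [<- _] := ball_actionM AU (unitary_unitary_inv AU) zB.
by rewrite unitary_invr// ball_action1.
Qed.

Lemma dball_actionK A z X : unitary A -> CH z ->
  dball_action (unitary_inv A) (ball_action A z) (dball_action A z X) = X.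
Proof.
move=> AU zB; rewrite -dball_actionM//; last exact: unitary_unitary_inv.
by rewrite unitary_invl// dball_action1.
Qed.

Lemma dball_actionVK A z X : unitary A -> CH z ->
  dball_action A (ball_action (unitary_inv A) z) (dball_action (unitary_inv A) z X) = X.
Proof.
move=> AU zB; rewrite -dball_actionM//; last exact: unitary_unitary_inv.
by rewrite unitary_invr// dball_action1.
Qed.

End Isometries.

(** * Coordinates adapted to the isotropic line fixed by AN *)

Section HorosphericalChart.
Context {R : realType} {n : nat}.
Local Notation E := 'rV[R]_(n + n).
Local Notation C := R[i].
Local Notation Mat := 'M[C]_(1 + n).
Variable eta : E.
Hypothesis eta1 : dotE eta eta = 1.
Implicit Types (z w X U xi : E) (x y : 'cV[C]_(1 + n)) (A B : Mat) (a b : C).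

Definition normsq a : R :=
  locked_with action_key (complex.Re a ^+ 2 + complex.Im a ^+ 2).

Lemma normsq_ReIm a : normsq a = complex.Re a ^+ 2 + complex.Im a ^+ 2.
Proof. exact: locked_withE. Qed.

Lemma normsq1 : normsq 1 = 1.
Proof. by rewrite normsq_ReIm /= expr1n expr0n addr0. Qed.

Lemma conjRC (r : R) : (r%:C)^* = r%:C.
Proof. by apply: complexP; rewrite ?Reconj ?Imconj //= oppr0. Qed.

Lemma cjM a b : (a * b)^* = a^* * b^*. Proof. exact: rmorphM. Qed.
Lemma cjD a b : (a + b)^* = a^* + b^*. Proof. exact: rmorphD. Qed.
Lemma cjN a : (- a)^* = - a^*. Proof. exact: rmorphN. Qed.
Lemma cjV a : (a^-1)^* = (a^*)^-1. Proof. exact: fmorphV. Qed.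

Lemma rcM (r s : R) : (r * s)%:C = r%:C * s%:C :> C. Proof. exact: rmorphM. Qed.
Lemma rcD (r s : R) : (r + s)%:C = r%:C + s%:C :> C. Proof. exact: rmorphD. Qed.
Lemma rcN (r : R) : (- r)%:C = - r%:C :> C. Proof. exact: rmorphN. Qed.
Lemma rcV (r : R) : (r^-1)%:C = (r%:C)^-1 :> C. Proof. exact: fmorphV. Qed.
Lemma rcX (r : R) k : (r ^+ k)%:C = r%:C ^+ k :> C. Proof. exact: rmorphXn. Qed.
Lemma rc_nat k : (k%:R : R)%:C = k%:R :> C. Proof. exact: rmorph_nat. Qed.
Definition rcE := (rc_nat, rcM, rcN, rcV, rcX, rcD).

Lemma normsqE a : a * a^* = (normsq a)%:C.
Proof. by apply: complexP; rewrite !ReImE normsq_ReIm /=; ring. Qed.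

Lemma normsq_gt0 a : (0 < normsq a) = (a != 0).
Proof.
rewrite normsq_ReIm; apply/idP/idP => [|/complex_neq0 a0].
  by apply: contraTneq => ->; rewrite /= expr0n addr0 ltxx.
by rewrite lt_def a0 addr_ge0 ?sqr_ge0.
Qed.

Lemma realC_neq0 (r : R) : (r%:C != 0 :> C) = (r != 0).
Proof. by rewrite fmorph_eq0. Qed.

(* The coordinates of a column vector with respect to the null vectors
   (1, - eta), (1, eta) and the complement eta^perp of their span: the
   coefficient of (1, - eta) is mcol / 2, the component in eta^perp is vcol. *)
Definition tailE x : E := locked_with action_key (vec_of_complex (tail_coord x)).

Definition mcol x : C :=
  locked_with action_key (head_coord x - hE (tailE x) eta).

Definition vcol x : E :=
  locked_with action_key (tailE x - cscale (hE (tailE x) eta) eta).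

Lemma mcolE x : mcol x = head_coord x - hE (tailE x) eta.
Proof. exact: locked_withE. Qed.

Lemma vcolE x : vcol x = tailE x - cscale (hE (tailE x) eta) eta.
Proof. exact: locked_withE. Qed.

Lemma vec_tailE x : vec_to_complex (tailE x) = tail_coord x.
Proof. by rewrite /tailE unlock vec_of_complexK. Qed.

Lemma tailE_lift z : tailE (lift z) = z.
Proof. by apply: vec_to_complex_inj; rewrite vec_tailE tail_lift. Qed.

Lemma tailE_hlift z : tailE (hlift z) = z.
Proof. by apply: vec_to_complex_inj; rewrite vec_tailE tail_hlift. Qed.

Lemma tailED x y : tailE (x + y) = tailE x + tailE y.
Proof.
by apply: vec_to_complex_inj; rewrite vec_to_complexD !vec_tailE tail_coordD.
Qed.

Lemma tailEZ a x : tailE (a *: x) = cscale a (tailE x).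
Proof.
by apply: vec_to_complex_inj; rewrite vec_to_complex_cscale !vec_tailE tail_coordZ.
Qed.

Definition mz z : C := locked_with action_key (1 - hE z eta).

Definition vz z : E := locked_with action_key (z - cscale (hE z eta) eta).

Lemma mzE z : mz z = 1 - hE z eta. Proof. exact: locked_withE. Qed.

Lemma vzE z : vz z = z - cscale (hE z eta) eta. Proof. exact: locked_withE. Qed.

Lemma mcol_lift z : mcol (lift z) = mz z.
Proof. by rewrite mcolE mzE head_lift tailE_lift. Qed.

Lemma vcol_lift z : vcol (lift z) = vz z.
Proof. by rewrite vcolE vzE tailE_lift. Qed.

Lemma mcol_hlift X : mcol (hlift X) = - hE X eta.
Proof. by rewrite !mcolE head_hlift tailE_hlift add0r. Qed.

Lemma vcol_hlift X : vcol (hlift X) = vz X.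
Proof. by rewrite vcolE vzE tailE_hlift. Qed.

Lemma mcolD x y : mcol (x + y) = mcol x + mcol y.
Proof. by rewrite !mcolE head_coordD tailED hEDl; ring. Qed.

Lemma mcolZ a x : mcol (a *: x) = a * mcol x.
Proof. by rewrite !mcolE head_coordZ tailEZ hEcl; ring. Qed.

Lemma vcolD x y : vcol (x + y) = vcol x + vcol y.
Proof. by rewrite !vcolE tailED hEDl cscaleDl opprD addrACA. Qed.

Lemma vcolZ a x : vcol (a *: x) = cscale a (vcol x).
Proof. by rewrite !vcolE tailEZ hEcl cscaleDr cscalerN cscaleA. Qed.

Lemma tailE_vcol x : tailE x = vcol x + cscale (head_coord x - mcol x) eta.
Proof. by rewrite vcolE mcolE subKr subrK. Qed.

Lemma hE_eta : hE eta eta = 1.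
Proof. by rewrite hExx eta1. Qed.

Lemma hE_vcol x : hE (vcol x) eta = 0.
Proof. by rewrite !vcolE !hE_lin hE_eta mulr1 subrr. Qed.

Lemma hE_vz z : hE (vz z) eta = 0.
Proof. by rewrite -vcol_lift hE_vcol. Qed.

Lemma hE_perpC U : hE U eta = 0 -> hE eta U = 0.
Proof. by rewrite -(hE_conj U) => ->; rewrite rmorph0. Qed.

Lemma lorentz_mv x y : lorentz x y =
  - (mcol x * (head_coord y)^*) - head_coord x * (mcol y)^* + mcol x * (mcol y)^*
  + hE (vcol x) (vcol y).
Proof.
rewrite (@lorentzE _ _ x y (tailE x) (tailE y)) ?vec_tailE// !tailE_vcol.
move: (vcol x) (vcol y) (hE_vcol x) (hE_perpC (hE_vcol y)) => u v hu hv.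
by rewrite !hE_lin hE_eta hu hv !rmorphB /=; ring.
Qed.

Lemma col_ext x y : mcol x = mcol y -> vcol x = vcol y ->
  head_coord x = head_coord y -> x = y.
Proof.
move=> m v h; apply: coord_ext => //.
by rewrite -!vec_tailE !tailE_vcol m v h.
Qed.

(** If <z, eta> = 1, then |z - eta|^2 = |z|^2 - 1, which is negative in the ball. *)
Lemma mz_neq0 z : CH z -> mz z != 0.
Proof.
move=> zB; apply/negP => /eqP /(congr1 (@complex.Re R)); rewrite mzE !ReImE /=.
have := dotE_ge0 (z - eta); rewrite !dotE_lin eta1 (dotEC eta z).
by have := CH_gt0 zB => ? ? ?; lra.
Qed.

(* The elements of the group with Lie algebra a + g_alpha + g_{2 alpha}, for
   which (1, eta) spans the fixed isotropic line. *)
Definition shaped A (lam : R) U := [/\ unitary A, 0 < lam, hE U eta = 0,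
  forall x, mcol (A *m x) = lam%:C * mcol x &
  forall x, vcol (A *m x) = vcol x + cscale (mcol x / 2) U].

Lemma shaped_unitary A lam U : shaped A lam U -> unitary A.
Proof. by case. Qed.

Lemma shaped1 : shaped 1%:M 1 0.
Proof.
split=> //; [exact: unitary1|by rewrite hE0l|by move=> x; rewrite mul1mx mul1r|].
by move=> x; rewrite mul1mx cscaler0 addr0.
Qed.

Lemma shapedM A B lam mu U V : shaped A lam U -> shaped B mu V ->
  shaped (A *m B) (lam * mu) (V + mu *: U).
Proof.
move=> [Au l0 Ue Am Av] [Bu m0 Ve Bm Bv]; split.
- exact: unitaryM.
- exact: mulr_gt0.
- by rewrite !hE_lin Ue Ve mulr0 addr0.
- by move=> x; rewrite -mulmxA Am Bm mulrA -rmorphM.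
- move=> x; rewrite -mulmxA Av Bv Bm; move: (mcol x) (vcol x) => a v.
  rewrite -addrA cscaleDr -(cscale_real mu) cscaleA.
  by have -> : a / 2 * mu%:C = mu%:C * a / 2 by ring.
Qed.

Lemma shapedV A lam U : shaped A lam U ->
  shaped (unitary_inv A) lam^-1 (- (lam^-1 *: U)).
Proof.
move=> [Au l0 Ue Am Av].
have l0' : lam%:C != 0 :> C by rewrite realC_neq0 gt_eqF.
have mE x : mcol (unitary_inv A *m x) = (lam^-1)%:C * mcol x.
  by rewrite -[in RHS](mul1mx x) -(unitary_invr Au) -mulmxA Am mulrA -rmorphM /= mulVf ?gt_eqF// mul1r.
split=> //; [exact: unitary_unitary_inv|by rewrite invr_gt0| |].
  by rewrite !hE_lin Ue mulr0 oppr0.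
move=> x; rewrite -[in RHS](mul1mx x) -(unitary_invr Au) -mulmxA Av Am.
move: (mcol _) (vcol _) => a v.
have -> : cscale (lam%:C * a / 2) (- (lam^-1 *: U)) = - cscale (a / 2) U.
  rewrite -cscale_real cscalerN cscaleA rcV; congr (- cscale _ _).
  by field; exact: l0'.
by rewrite addrK.
Qed.

Section ShapedAction.
Variables (A : Mat) (lam : R) (U z : E).
Hypotheses (As : shaped A lam U) (zB : CH z).

Let Au : unitary A := shaped_unitary As.

Lemma mz_action : denom A z * mz (ball_action A z) = lam%:C * mz z.
Proof.
have [_ _ _ Am _] := As.
by rewrite -!mcol_lift -mcolZ -mul_lift.
Qed.

Lemma vz_action : cscale (denom A z) (vz (ball_action A z)) =
  vz z + cscale (mz z / 2) U.
Proof.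
have [_ _ _ _ Av] := As.
by rewrite -!vcol_lift -vcolZ -mul_lift// Av mcol_lift.
Qed.

(** Under the action both [mz] and [vz] acquire the complex factor 1 / [denom]. Multiplying vz by
    the conjugate of mz turns it into the positive real factor lam / |denom|^2, and the translation
    term becomes a real multiple of [U]. Only such real factors pass through a real linear
    projection. *)
Lemma conj_mz_vz_action :
  cscale (mz (ball_action A z))^* (vz (ball_action A z)) =
  (lam / normsq (denom A z)) *: (cscale (mz z)^* (vz z) + (normsq (mz z) / 2) *: U).
Proof.
have d0 := denom_neq0 Au zB.
have dc0 : (denom A z)^* != 0 by rewrite conjc_eq0.
have mE : (mz (ball_action A z))^* = lam%:C * (mz z)^* / (denom A z)^*.
  have := congr1 Num.conj mz_action; rewrite !cjM conjRC => <-.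
  by field.
have vE : vz (ball_action A z) =
    cscale (denom A z)^-1 (vz z + cscale (mz z / 2) U).
  by rewrite -vz_action cscaleA mulVf// cscale1.
rewrite mE vE -!cscale_real !cscaleDr !cscaleA !rcE -!normsqE.
by congr (cscale _ _ + cscale _ _); field; rewrite dc0 d0.
Qed.

End ShapedAction.

(* The orthogonal projection onto the real subspace w^perp of eta^perp. *)
Variable P : {linear E -> E}.
Hypotheses (PK : forall X, P (P X) = P X)
  (P_sym : forall X Y, dotE (P X) Y = dotE X (P Y))
  (P_eta : P eta = 0) (P_Jeta : P (Jmap eta) = 0).

(** Up to the factor |mz|^2 this is P applied to the horospherical coordinate vz / mz, since P kills
    the component of z along C eta. *)
Definition Qz z : E := locked_with action_key (P (cscale (mz z)^* z)).

Lemma Qz_def z : Qz z = P (cscale (mz z)^* z). Proof. exact: locked_withE. Qed.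

Lemma P_cscale_eta a : P (cscale a eta) = 0.
Proof. by rewrite cscaleE linearD !linearZ /= P_eta P_Jeta !scaler0 addr0. Qed.

Lemma QzE z : Qz z = P (cscale (mz z)^* (vz z)).
Proof. by rewrite Qz_def vzE cscaleDr cscalerN cscaleA linearB /= P_cscale_eta subr0. Qed.

Lemma P_perp X : P X = X -> hE X eta = 0.
Proof.
move=> PX; apply: complexP; rewrite /hE /= -PX P_sym ?P_eta ?P_Jeta; exact: dotE0r.
Qed.

Lemma mz_perp X : hE X eta = 0 -> mz X = 1.
Proof. by rewrite mzE => ->; rewrite subr0. Qed.

Lemma vz_perp X : hE X eta = 0 -> vz X = X.
Proof. by rewrite vzE => ->; rewrite cscale0 subr0. Qed.

(** A translation part [U] in the kernel of P is invisible to [Qz], which is only rescaled; in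
    particular its zero set is invariant. *)
Lemma Qz_action A lam U z : shaped A lam U -> P U = 0 -> CH z ->
  Qz (ball_action A z) = (lam / normsq (denom A z)) *: Qz z.
Proof.
move=> As PU zB; rewrite !QzE (conj_mz_vz_action As zB) linearZ linearD /=.
by rewrite linearZ /= PU scaler0 addr0.
Qed.

(** * The normal of a tube at a translate of a point of w^perp *)

Section Normal.
Variables (A : Mat) (lam : R) (U xi : E).
Hypotheses (As : shaped A lam U) (PU : P U = 0) (Pxi : P xi = xi) (xiB : CH xi).

Local Notation w := (ball_action A xi).

Let Au : unitary A := shaped_unitary As.

Let lam0 : lam != 0.
Proof. by case: As => _ l0 _ _ _; rewrite gt_eqF. Qed.

Let m0 : mz w != 0. Proof. exact/mz_neq0/ball_action_CH. Qed.

Lemma denom_perp : denom A xi = lam%:C / mz w.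
Proof.
have := mz_action As xiB; rewrite (mz_perp (P_perp Pxi)) mulr1 => <-.
by rewrite mulfK.
Qed.

Lemma normsq_denom : normsq (denom A xi) = lam ^+ 2 / normsq (mz w).
Proof.
have mc0 : (mz w)^* != 0 by rewrite conjc_eq0.
apply: complexI; rewrite -normsqE denom_perp cjM conjRC cjV !rcE -normsqE.
 field; by rewrite mc0 m0.
Qed.

Lemma Qz_perp : Qz w = (normsq (mz w) / lam) *: xi.
Proof.
rewrite (Qz_action As PU xiB) normsq_denom QzE.
rewrite (mz_perp (P_perp Pxi)) (vz_perp (P_perp Pxi)) rmorph1 cscale1 Pxi.
have := m0; rewrite -normsq_gt0 => /lt0r_neq0 mm.
by congr (_ *: _); field; rewrite mm lam0.
Qed.

Lemma one_sub_norm_action :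
  1 - dotE w w = (1 - dotE xi xi) * normsq (mz w) / lam ^+ 2.
Proof.
have := denom_norm Au xiB; rewrite normsqE normsq_denom !hExx !sub1C -rmorphM.
move=> /complexI <-; have := m0; rewrite -normsq_gt0 => /lt0r_neq0 mm.
by field; rewrite mm lam0.
Qed.

(** A shaped matrix is prescribed on [mcol] and [vcol] only; its head coordinate is recovered from
    unitarity. The images of the orthogonal vectors (0, xi) and (1, 0) stay orthogonal, which reads
    - lam ddenom + <xi, U> / 2 = 0. *)
Lemma ddenom_perp : ddenom A xi = hE xi U / (2 * lam%:C).
Proof.
have [_ _ Ue Am Av] := As.
have l0 : lam%:C != 0 :> C by rewrite realC_neq0.
have := lorentz_unitary (hlift xi) (lift 0) Au.
rewrite lorentz_hlift_lift lorentz_mv !Am !Av mcol_hlift vcol_hlift mcol_lift vcol_lift.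
rewrite (P_perp Pxi) oppr0 !(mulr0, mul0r) (vz_perp (P_perp Pxi)) cscale0 addr0.
rewrite -ddenomE mzE vzE hE0l subr0 cscale0 subr0 add0r hE0r mulr1 conjRC.
rewrite hEcr mul1r cjV conjC_nat oppr0 add0r addr0 => e.
apply: (mulIf l0); move/eqP: e; rewrite addrC subr_eq0 => /eqP <-.
by field; exact: l0.
Qed.

Lemma dball_action_perp : dball_action A xi xi =
  cscale (mz w / lam%:C) (xi + cscale (hE xi U / (2 * lam%:C)) (eta - w)).
Proof.
have [_ _ Ue Am Av] := As.
apply: vec_to_complex_inj; rewrite vec_dball_action -(vec_tailE (A *m _)) tailE_vcol.
rewrite Am Av mcol_hlift vcol_hlift (P_perp Pxi) oppr0 mul0r mulr0 cscale0 addr0.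
rewrite subr0 -ddenomE (vz_perp (P_perp Pxi)) ddenom_perp denom_perp.
rewrite invf_div; move: w => v; rewrite !vec_to_complex_lin.
move: (_ / _) (_ / _) (vec_to_complex v) (vec_to_complex xi) (vec_to_complex eta).
by move=> a b x y z; rewrite (scalerBr a) addrA.
Qed.

(** The formula of [dball_action_perp] with the group element eliminated: at A xi, with c = |mz|^2 /
    lam, [Qz] is c xi and conj (mz) vz - Qz is (c / 2) U. Being explicit in z, it can be
    differentiated along a curve. *)
Definition normal_field (k : R) z : E := - k *: cscale ((mz z)^*)^-1
  (Qz z + cscale (hE (Qz z) (cscale (mz z)^* (vz z) - Qz z) / (normsq (mz z))%:C)
    (eta - z)).

Lemma normal_fieldE k : normal_field k w = - k *: dball_action A xi xi.
Proof.
have mc0 : (mz w)^* != 0 by rewrite conjc_eq0.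
have l0 : lam%:C != 0 :> C by rewrite realC_neq0.
have vE := conj_mz_vz_action As xiB.
rewrite (mz_perp (P_perp Pxi)) (vz_perp (P_perp Pxi)) rmorph1 cscale1 in vE.
rewrite /normal_field vE Qz_perp dball_action_perp normsq_denom; congr (_ *: _).
have mm : normsq (mz w) != 0 by apply/lt0r_neq0; rewrite normsq_gt0.
have -> : lam / (lam ^+ 2 / normsq (mz w)) = normsq (mz w) / lam.
  by field; rewrite mm lam0.
set c := normsq (mz w) / lam.
have -> : c *: (xi + (normsq 1 / 2) *: U) - c *: xi = (c / 2) *: U.
  by rewrite normsq1 scalerDr addrC addKr scalerA mul1r.
rewrite /c hEZl hEZr -!cscale_real !cscaleDr !cscaleA.
have mE := normsqE (mz w); move: mE mm; clear c.
move: (normsq (mz w)) => s; move: (mz w) m0 mc0 => m m_0 mc0 mE mm.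
move: (ball_action A xi) => v.
have mm' : s%:C != 0 :> C by rewrite realC_neq0.
rewrite !rcE -mE.
congr (cscale _ _ + (cscale _ _ + cscale _ _)); field; by rewrite ?l0 ?mc0 ?m_0.
Qed.

End Normal.
End HorosphericalChart.

(** * Root spaces *)

Section RootSpaces.
Context {R : realType} {n : nat}.
Local Notation E := 'rV[R]_(n + n).
Local Notation C := R[i].
Local Notation Mat := 'M[C]_(1 + n).
Implicit Types (X Y Z H : Mat) (x y : 'cV[C]_(1 + n)) (c e u : 'cV[C]_n).

Definition iprod u c : C := (adj c *m u) 0 0.

Lemma iprod_hE u c : iprod u c = hE (vec_of_complex u) (vec_of_complex c).
Proof. by rewrite hE_vec !vec_of_complexK. Qed.

Lemma iprod_mx u c : adj c *m u = (iprod u c)%:M.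
Proof. exact: mx11_scalar. Qed.

Lemma outerE u c v : (u *m adj c) *m v = iprod v c *: u.
Proof. by rewrite -mulmxA iprod_mx mul_mx_scalar. Qed.

Lemma iprodC u c : (iprod u c)^* = iprod c u.
Proof. by rewrite !iprod_hE hE_conj. Qed.

Lemma iprodZl a u c : iprod (a *: u) c = a * iprod u c.
Proof. by rewrite /iprod -scalemxAr mxE. Qed.

Lemma iprodZr a u c : iprod u (a *: c) = a^* * iprod u c.
Proof. by rewrite /iprod adjZ -scalemxAl mxE. Qed.

Lemma iprod0r u : iprod u 0 = 0.
Proof. by rewrite -(scale0r u) iprodZr rmorph0 mul0r. Qed.

Definition pH c : Mat := block_mx 0 (adj c) c 0.

Lemma block_su1n X : su1n X ->
  exists p c D, [/\ X = block_mx p%:M (adj c) c D, p^* = - p & adj D = - D].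
Proof.
move=> [+ _]; rewrite -(submxK X) [ulsubmx X]mx11_scalar.
set p := ulsubmx X 0 0; set c := dlsubmx X; set D := drsubmx X; set r := ursubmx X.
rewrite /conj_transpose map_block_mx tr_block_mx /hform !mulmx_block.
rewrite !mulmx0 !mul0mx !addr0 !add0r !mulmx1 !mul1mx !mulmxN !mulNmx !mulmx1 !mul1mx.
rewrite add_block_mx -[0]submxK => /eq_block_mx [+ + _ +].
move=> e1 e2 e3; exists p, c, D; split.
- congr block_mx; apply/esym/eqP; rewrite -subr_eq0; apply/eqP.
  by apply: (etrans e2); apply/matrixP => i j; rewrite !mxE.
- have := congr1 (fun M : 'M[C]_1 => M 0 0) e1; rewrite !mxE !eqxx !mulr1n => e.
  apply/eqP; rewrite -addr_eq0 -oppr_eq0 opprD; apply/eqP; exact: e.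
- apply/eqP; rewrite -addr_eq0; apply/eqP.
  by apply: (etrans e3); apply/matrixP => i j; rewrite !mxE.
Qed.

Lemma complex_eqN (p : C) : p = - p -> p = 0.
Proof.
move=> e; apply: complexP => /=.
  by have := congr1 (@complex.Re R) e; rewrite ReN => ?; lra.
by have := congr1 (@complex.Im R) e; rewrite ImN => ?; lra.
Qed.

Lemma mx_eqN p q (D : 'M[C]_(p, q)) : D = - D -> D = 0.
Proof.
move=> /matrixP e; apply/matrixP => i j; rewrite [RHS]mxE; apply: complex_eqN.
by have := e i j; rewrite [RHS]mxE.
Qed.

Lemma adj_block p r c D : adj (block_mx (p%:M : 'M[C]_1) r c D : Mat) =
  block_mx (p^*)%:M (adj c) (adj r) (adj D).
Proof.
rewrite /adj map_block_mx tr_block_mx; congr block_mx.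
by apply/matrixP => i j; rewrite !ord1 !mxE !eqxx !mulr1n.
Qed.

Lemma cartan_pH X : cartan_p X -> exists c, X = pH c.
Proof.
move=> [/block_su1n [p [c [D [-> pc Dc]]]]]; rewrite [conj_transpose _]adj_block adjK.
move=> /eq_block_mx[+ _ _ +]; rewrite pc Dc => e1 e2; exists c; congr block_mx.
  rewrite (_ : p = 0) ?raddf0//; apply: complex_eqN.
  by have := congr1 (fun M : 'M[C]_1 => M 0 0) e1; rewrite !mxE !eqxx !mulr1n.
by apply: mx_eqN.
Qed.

Lemma mul_block_scal (p q : C) (r v : 'rV[C]_n) c u (D B : 'M[C]_n) :
  block_mx (p%:M : 'M[C]_1) r c D *m block_mx (q%:M : 'M[C]_1) v u B =
  block_mx ((p * q)%:M + r *m u) (p *: v + r *m B)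
    (q *: c + D *m u) (c *m v + D *m B).
Proof.
rewrite mulmx_block -scalar_mxM mul_scalar_mx mul_mx_scalar //.
Qed.

Lemma bracket_pH e p c D :
  bracket (pH e) (block_mx p%:M (adj c) c D) =
  block_mx (iprod c e - iprod e c)%:M (adj e *m D - p *: adj e)
    (p *: e - D *m e) (e *m adj c - c *m adj e).
Proof.
have -> : pH e = block_mx (0%:M : 'M[C]_1) (adj e) e 0 by rewrite raddf0.
rewrite /bracket !mul_block_scal.
rewrite opp_block_mx add_block_mx; congr block_mx.
- by rewrite mul0r mulr0 !raddf0 !add0r !iprod_mx raddfB.
- by rewrite scale0r add0r mulmx0 addr0.
- by rewrite mul0mx addr0 scale0r add0r.
- by rewrite mul0mx mulmx0 !addr0.
Qed.

(* Solving [pH e, X] = mu X for |e| = 1: with X = (p, c*; c, D) and k = <c, e>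
   one gets (mu^2 - 1) c = (k - 2 conj k) e. *)
Lemma root_vector e (mu : R) X : iprod e e = 1 -> mu != 0 -> su1n X ->
  bracket (pH e) X = mu%:C *: X ->
  exists p c D, [/\ X = block_mx p%:M (adj c) c D,
    mu%:C * p = iprod c e - iprod e c,
    mu%:C *: D = e *m adj c - c *m adj e,
    ((mu ^+ 2 - 1)%:C) *: c = (iprod c e - 2 * (iprod c e)^*) *: e &
    [/\ (mu ^+ 2 = 4 \/ iprod c e = 0) & complex.Re (iprod c e) = 0]].
Proof.
move=> e1 mu0 /block_su1n [p [c [D [-> pc Dc]]]].
rewrite bracket_pH scale_block_mx => /eq_block_mx[hp _ hc hD].
have hp' : mu%:C * p = iprod c e - iprod e c.
  have := congr1 (fun M : 'M[C]_1 => M 0 0) hp; rewrite !mxE !eqxx !mulr1n => -> //.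
have h : (mu%:C * mu%:C) *: c = c + (iprod c e - 2 * (iprod c e)^*) *: e.
  rewrite -scalerA -hc scalerBr scalerA hp' scalemxAl -hD mulmxBl !outerE e1.
  rewrite scale1r opprB addrCA -scalerBl iprodC; congr (_ + _ *: _); ring.
have h2 : ((mu ^+ 2 - 1)%:C) *: c = (iprod c e - 2 * (iprod c e)^*) *: e.
  by rewrite expr2 rcD rcM rcN rmorph1 scalerBl h scale1r addrC addKr.
have h3 : (mu ^+ 2 - 1)%:C * iprod c e = iprod c e - 2 * (iprod c e)^*.
  by rewrite -[LHS]iprodZl h2 iprodZl e1 mulr1.
have mu2 : mu ^+ 2 != 0 by rewrite expf_neq0.
(* With k = <c, e>, the real parts give mu^2 Re k = 0 and the imaginary parts give (mu^2 - 4) Im k =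
   0. *)
have hr := congr1 (@complex.Re R) h3; have hi := congr1 (@complex.Im R) h3.
move: hr hi; rewrite !ReImE /= => hr hi.
have Re0 : complex.Re (iprod c e) = 0.
  by apply: (mulfI mu2); rewrite mulr0; lra.
exists p, c, D; split => //; split=> //.
have [->|m4] := eqVneq (mu ^+ 2) 4; first by left.
right; apply: complexP => //=; rewrite -subr_eq0 in m4.
by apply: (mulfI m4); rewrite mulr0; lra.
Qed.

Lemma iprod0l c : iprod 0 c = 0.
Proof. by rewrite -(scale0r 0) iprodZl mul0r. Qed.

Lemma bracketZl (a : C) X Y : bracket (a *: X) Y = a *: bracket X Y.
Proof. by rewrite /bracket -scalemxAl -scalemxAr scalerBr. Qed.

Lemma su1n_block (p : C) c (D : 'M[C]_n) : p^* = - p -> adj D = - D ->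
  p + \tr D = 0 -> su1n (block_mx p%:M (adj c) c D).
Proof.
move=> pc Dc tr0; split; last by rewrite mxtrace_block mxtrace_scalar mulr1n.
rewrite [conj_transpose _]adj_block adjK pc Dc /hform !mulmx_block.
rewrite !mulmx0 !mul0mx !addr0 !add0r !mulmx1 !mul1mx !mulmxN !mulNmx !mulmx1 !mul1mx.
rewrite add_block_mx raddfN opprK subrr !addNr subrr.
exact: block_mx0.
Qed.

(** [Xroot] and [Zroot] give the eigenvectors of ad (pH e) for the eigenvalues 1 and 2, |e| = 1,
    when c is orthogonal to e and k is imaginary. *)
Definition Xroot e c : Mat := block_mx 0 (adj c) c (e *m adj c - c *m adj e).

Definition Zroot e (k : C) : Mat :=
  block_mx k%:M (- k *: adj e) (k *: e) (- k *: (e *m adj e)).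

Lemma adj_outer u c : adj (u *m adj c) = c *m adj u.
Proof. by rewrite adjM adjK. Qed.

Lemma root_spaceX e X : iprod e e = 1 ->
  (su1n X /\ bracket (pH e) X = X) <-> exists2 c, iprod c e = 0 & X = Xroot e c.
Proof.
move=> e1; split=> [[Xsu bX]|[c ce ->]].
  have := @root_vector e 1 X e1 (oner_neq0 _) Xsu; rewrite scale1r => /(_ bX).
  move=> [p [c [D [-> hp hD hc [hk _]]]]].
  have ce : iprod c e = 0.
    by case: hk => // h; exfalso; move: h; rewrite expr1n; clear; lra.
  exists c => //; congr block_mx.
    by move: hp; rewrite mul1r -(iprodC c e) ce rmorph0 subrr => ->; rewrite raddf0.
  by rewrite -hD scale1r.
have ec : iprod e c = 0 by rewrite -iprodC ce rmorph0.
have XE : Xroot e c = block_mx (0%:M : 'M[C]_1) (adj c) c (e *m adj c - c *m adj e).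
  by rewrite raddf0.
rewrite XE; split.
  apply: su1n_block; first by rewrite rmorph0 oppr0.
    by rewrite adjD adjN !adj_outer opprB.
  rewrite add0r raddfB /= (mxtrace_mulC e) (mxtrace_mulC c).
  by rewrite !iprod_mx ce ec subrr.
rewrite bracket_pH ce ec subrr !scale0r sub0r subr0 mulmxBr !mulmxA !iprod_mx e1 ce.
rewrite mul1mx mul_scalar_mx scale0r subr0 mulmxBl !outerE e1 ec scale1r scale0r.
by rewrite sub0r opprK.
Qed.

Lemma root_spaceZ e X : iprod e e = 1 ->
  (su1n X /\ bracket (pH e) X = 2 *: X) <->
  exists k : C, k^* = - k /\ X = Zroot e k.
Proof.
move=> e1; have two : 2 = (2 : R)%:C :> C by rewrite rc_nat.
split=> [[Xsu bX]|[k [kc ->]]].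
  have := @root_vector e 2 X e1 _ Xsu; rewrite two in bX => /(_ _ bX).
  have n2 : (2 : R) != 0 by rewrite pnatr_eq0.
  move=> /(_ n2) [p [c [D [-> hp hD hc [_ hk]]]]].
  have ke : (iprod c e)^* = - iprod c e.
    by apply: complexP; rewrite !ReImE ?hk ?oppr0.
  have cE : c = iprod c e *: e.
    have n3 : ((2 ^+ 2 - 1 : R)%:C : C) != 0 by rewrite realC_neq0; apply/eqP; clear; lra.
    apply: (scalerI n3); rewrite hc ke scalerA; congr (_ *: _).
    by rewrite rcD rcX rcN rmorph1 -two; ring.
  have pE : p = iprod c e.
    have n2' : ((2 : R)%:C : C) != 0 by rewrite realC_neq0.
    by apply: (mulfI n2'); rewrite hp -(iprodC c e) ke -two; ring.
  exists (iprod c e); split=> //; rewrite pE {2 3}cE adjZ ke; congr block_mx.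
  have n2' : ((2 : R)%:C : C) != 0 by rewrite realC_neq0.
  apply: (scalerI n2'); rewrite hD {1 2}cE adjZ ke -scalemxAr -scalemxAl scalerA.
  by rewrite -scalerBl -two; congr (_ *: _); ring.
have XE : Zroot e k = block_mx k%:M (adj (k *: e)) (k *: e) (- k *: (e *m adj e)).
  by rewrite adjZ kc.
rewrite XE; split.
  apply: su1n_block => //; first by rewrite adjZ adj_outer cjN kc scaleNr.
  by rewrite linearZ /= mxtrace_mulC iprod_mx e1 mxtrace_scalar mulr1n mulr1 subrr.
rewrite bracket_pH scale_block_mx iprodZl iprodZr kc e1; congr block_mx.
- by rewrite scale_scalar_mx; congr (_ %:M); ring.
- rewrite -scalemxAr mulmxA iprod_mx e1 mul1mx adjZ kc -scalerBl scalerA.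
  by congr (_ *: _); ring.
- by rewrite -scalemxAl outerE e1 scale1r -scalerBl scalerA; congr (_ *: _); ring.
- rewrite adjZ kc -scalemxAr -scalemxAl -scalerBl scalerA.
  by congr (_ *: _); ring.
Qed.

(** This is the rank one property: the corner entry of the bracket makes <e, c> real, and its lower
    block applied to e makes |e|^2 c a multiple of e. *)
Lemma bracket_pHpH e c : bracket (pH e) (pH c) = 0 ->
  iprod e c = iprod c e /\ iprod e e *: c = iprod e c *: e.
Proof.
have -> : pH c = block_mx (0%:M : 'M[C]_1) (adj c) c 0 by rewrite raddf0.
rewrite bracket_pH -[RHS]block_mx0 => /eq_block_mx[h _ _ h'].
have hh : iprod e c = iprod c e.
  have := congr1 (fun M : 'M[C]_1 => M 0 0) h; rewrite !mxE !eqxx !mulr1n.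
  by move/eqP; rewrite subr_eq0 => /eqP ->.
split=> //; have := congr1 (fun M => M *m e) h'.
by rewrite mulmxBl mul0mx !outerE => /eqP; rewrite subr_eq0 => /eqP ->.
Qed.

Lemma adjZr (r : R) p q (M : 'M[C]_(p, q)) : adj (r%:C *: M) = r%:C *: adj M.
Proof. by rewrite adjZ conjRC. Qed.

Lemma pHZ (r : R) c : pH (r%:C *: c) = r%:C *: pH c.
Proof. by rewrite /pH adjZr scale_block_mx !scaler0. Qed.

Lemma bracket0l X : bracket 0 X = 0.
Proof. by rewrite /bracket mul0mx mulmx0 subrr. Qed.

Lemma abelian_line (a : set Mat) c0 : abelian_subspace a -> a (pH c0) -> c0 != 0 ->
  exists2 e, iprod e e = 1 &
    forall H, a H <-> exists t : R, H = t%:C *: pH e.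
Proof.
move=> [[a0 aD aZ] ap aab] ac0 c00.
set v : E := vec_of_complex c0.
have cv : c0 = vec_to_complex v by rewrite vec_of_complexK.
have v0 : 0 < dotE v v.
  rewrite dotE_gt0; apply: contra c00 => /eqP v0.
  by rewrite cv v0 vec_to_complex0.
have s0 : Num.sqrt (dotE v v) != 0 by rewrite gt_eqF ?sqrtr_gt0.
set s := Num.sqrt (dotE v v) in s0.
have cc : iprod c0 c0 = (s ^+ 2)%:C by rewrite iprod_hE hExx sqr_sqrtr// ltW.
have sC : (s%:C : C) != 0 by rewrite realC_neq0.
exists (s^-1%:C *: c0).
  rewrite iprodZl iprodZr conjRC cc rcX rcV; field; exact: sC.
move=> H; split=> [aH|[t ->]]; last first.
  by rewrite -pHZ !scalerA -rcM pHZ; exact: aZ.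
have [c HE] := cartan_pH (ap _ aH).
have := aab _ _ ac0 aH; rewrite HE => /bracket_pHpH [h1]; rewrite cc => h2.
have hr : iprod c0 c = (complex.Re (iprod c0 c))%:C.
  apply: complexP => //=; have := congr1 (@complex.Im R) (iprodC c0 c).
  by rewrite Imconj -h1 => ?; lra.
exists (complex.Re (iprod c0 c) / s); rewrite -pHZ; congr pH.
have s2 : ((s ^+ 2)%:C : C) != 0 by rewrite realC_neq0 expf_neq0.
apply: (scalerI s2); rewrite h2 hr !scalerA; congr (_ *: _).
by rewrite !rcE /=; field; exact: sC.
Qed.

(** If mu^2 were neither 1 nor 4, then <c, e> = 0 and (mu^2 - 1) c = 0, so c and with it p and D
    would vanish. *)
Lemma root_value e (mu : R) X : iprod e e = 1 -> mu != 0 -> su1n X ->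
  bracket (pH e) X = mu%:C *: X -> X != 0 -> mu ^+ 2 = 1 \/ mu ^+ 2 = 4.
Proof.
move=> e1 mu0 Xsu bX; have [p [c [D [-> hp hD hc [hk _]]]]] := root_vector e1 mu0 Xsu bX.
case: hk => [|ce]; first by right.
have [->|m1 X0] := eqVneq (mu ^+ 2) 1; first by left.
exfalso; move/negP: X0; apply; apply/eqP.
have muC : (mu%:C : C) != 0 by rewrite realC_neq0.
have mC : ((mu ^+ 2 - 1)%:C : C) != 0 by rewrite realC_neq0 subr_eq0.
have c0 : c = 0 by apply: (scalerI mC); rewrite hc ce rmorph0 mulr0 subr0 scale0r scaler0.
rewrite -[RHS]block_mx0; congr block_mx.
- rewrite (_ : p = 0) ?raddf0//; apply: (mulfI muC).
  by rewrite hp c0 iprod0l iprod0r subrr mulr0.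
- by rewrite c0; apply/matrixP => i j; rewrite !mxE rmorph0.
- by [].
- apply: (scalerI muC); rewrite hD c0 mul0mx subr0 scaler0.
  apply/matrixP => i j; rewrite !mxE big1// => k _.
  by rewrite !mxE rmorph0 mulr0.
Qed.

(** Let mu be the value of alpha at the generator [pH e]. Both mu and 2 mu are eigenvalues, so mu^2
    and 4 mu^2 lie in {1, 4} and mu is 1 or -1. Replacing e by mu e normalises this value to 1 and
    absorbs the choice of the positive root. *)
Lemma root_data (a : set Mat) (alpha : Mat -> R) :
  maximal_abelian a -> simple_root a alpha ->
  exists e, [/\ iprod e e = 1, forall H, a H <-> exists t : R, H = t%:C *: pH e,
    forall X, root_space a alpha X <-> su1n X /\ bracket (pH e) X = X &
    forall X, root_space a (double_root alpha) X <->
              su1n X /\ bracket (pH e) X = 2 *: X].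
Proof.
move=> [aab _] [[[H0 aH0 al0] [X [Xsu Xr] X0]] [_ [Y [Ysu Yr] Y0]]].
have [a_sub ap _] := aab; have [a0 _ _] := a_sub.
have two : 2 = (2 : R)%:C :> C by rewrite rc_nat.
(* [alpha] is given as a bare function; the nonzero root vector [X] forces it to be homogeneous on
   the line [a]. *)
have scaleXI (s t : C) : s *: X = t *: X -> s = t.
  move/eqP; rewrite -subr_eq0 -scalerBl scaler_eq0 (negPf X0) orbF subr_eq0.
  by move/eqP.
have alpha0 : alpha 0 = 0.
  have := Xr _ a0; rewrite bracket0l -(scale0r X) => /scaleXI/esym.
  by move/(congr1 (@complex.Re R)).
have [c0 HE] := cartan_pH (ap _ aH0).
have c00 : c0 != 0.
  apply: contra al0 => /eqP c00; rewrite HE c00 (_ : pH 0 = 0) ?alpha0//.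
  by rewrite -[0 in LHS](scale0r (0 : 'cV[C]_n)) (_ : 0 = (0 : R)%:C)// pHZ scale0r.
rewrite HE in aH0; have [e e1 aE] := abelian_line aab aH0 c00.
have aH : a (pH e) by apply/aE; exists 1; rewrite scale1r.
have alphaZ t : alpha (t%:C *: pH e) = t * alpha (pH e).
  have aT : a (t%:C *: pH e) by apply/aE; exists t.
  have := Xr _ aT; rewrite bracketZl (Xr _ aH) scalerA -rcM => /scaleXI.
  by move/(congr1 (@complex.Re R)) => /= ->.
set mu := alpha (pH e) in alphaZ.
have mu0 : mu != 0.
  apply: contra al0 => /eqP m0; rewrite HE; have [t ->] := (aE _).1 aH0.
  by rewrite alphaZ m0 mulr0.
have mu20 : 2 * mu != 0 by rewrite mulf_neq0 ?pnatr_eq0.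
have r1 := root_value e1 mu0 Xsu (Xr _ aH) X0.
have r2 := root_value e1 mu20 Ysu (Yr _ aH) Y0.
have mu1 : mu * mu = 1.
  rewrite -expr2; case: r1 => // m4; move: r2; rewrite exprMn m4.
  by clear; case=> h; exfalso; lra.
have pE : pH (mu%:C *: e) = mu%:C *: pH e by rewrite pHZ.
have aT t : a (t%:C *: pH e) by apply/aE; exists t.
have tmu t : t%:C *: pH (mu%:C *: e) = (t * mu)%:C *: pH e.
  by rewrite pE scalerA rcM.
have aE' H : a H <-> exists t : R, H = t%:C *: pH (mu%:C *: e).
  split=> [/aE [t ->]|[t ->]]; last by rewrite tmu.
  by exists (t * mu); rewrite tmu -mulrA mu1 mulr1.
exists (mu%:C *: e); split => //.
- by rewrite iprodZl iprodZr conjRC e1 mulr1 -rcM mu1.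
- move=> Z; split=> [[Zsu Zr]|[Zsu Zb]]; split=> //.
    by rewrite pE (Zr _ (aT mu)) alphaZ mu1 scale1r.
  by move=> H /aE' [t ->]; rewrite bracketZl Zb tmu alphaZ -mulrA mu1 mulr1.
- move=> Z; split=> [[Zsu Zr]|[Zsu Zb]]; split=> //.
    by rewrite pE (Zr _ (aT mu)) /double_root alphaZ mu1 mulr1 two.
  move=> H /aE' [t ->]; rewrite bracketZl Zb tmu /double_root alphaZ.
  by rewrite -mulrA mu1 mulr1 scalerA two rcM mulrC.
Qed.

End RootSpaces.

(** * One-parameter groups of S_w *)

Section SolvableGroup.
Context {R : realType} {n : nat}.
Local Notation E := 'rV[R]_(n + n).
Local Notation C := R[i].
Local Notation Mat := 'M[C]_(1 + n).
Variable eta : E.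
Hypothesis eta1 : dotE eta eta = 1.
Implicit Types (X Y Z H A : Mat) (x y : 'cV[C]_(1 + n)) (u v : E) (k : C).

Local Notation e := (vec_to_complex eta).
Local Notation mcol := (mcol eta).
Local Notation vcol := (vcol eta).

Lemma head_block (p : C) (r : 'rV[C]_n) c (D : 'M[C]_n) x :
  head_coord (block_mx p%:M r c D *m x) = p * head_coord x + (r *m tail_coord x) 0 0.
Proof.
rewrite -[in LHS](vsubmxK x) mul_block_col /head_coord col_mxKu mul_scalar_mx.
by rewrite mxE [X in X + _]mxE.
Qed.

Lemma tail_block (p : C) (r : 'rV[C]_n) c (D : 'M[C]_n) x :
  tail_coord (block_mx p%:M r c D *m x) = head_coord x *: c + D *m tail_coord x.
Proof.
rewrite -[in LHS](vsubmxK x) mul_block_col {1}/tail_coord col_mxKd.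
by rewrite [usubmx x]mx11_scalar mul_mx_scalar.
Qed.

Lemma iprod_tail x v : iprod (tail_coord x) (vec_to_complex v) = hE (tailE x) v.
Proof. by rewrite iprod_hE vec_to_complexK -vec_tailE vec_to_complexK. Qed.

Lemma hE_tail_eta x : hE (tailE x) eta = head_coord x - mcol x.
Proof. by rewrite mcolE opprB addrC subrK. Qed.

Lemma tailE_pH x : head_coord (pH e *m x) = head_coord x - mcol x /\
  tailE (pH e *m x) = cscale (head_coord x) eta.
Proof.
have -> : pH e = block_mx (0%:M : 'M[C]_1) (adj e) e 0 by rewrite raddf0.
split; first by rewrite head_block mul0r add0r -hE_tail_eta -iprod_tail.
apply: vec_to_complex_inj; rewrite vec_tailE tail_block mul0mx addr0.
by rewrite vec_to_complex_cscale.
Qed.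

Lemma col_pH x : [/\ head_coord (pH e *m x) = head_coord x - mcol x,
  mcol (pH e *m x) = - mcol x & vcol (pH e *m x) = 0].
Proof.
have [h t] := tailE_pH x; split=> //.
  by rewrite mcolE h t hEcl hE_eta//; ring.
by rewrite vcolE t hEcl hE_eta// mulr1 subrr.
Qed.

Definition nilp v k : Mat := Xroot e (vec_to_complex v) + Zroot e k.

(** In the coordinates [mcol], [vcol], [head_coord] the matrix is strictly triangular: mcol feeds
    vcol, and both feed the head. Hence its cube vanishes and its exponential is quadratic. *)
Lemma col_nilp v k x : hE v eta = 0 ->
  [/\ head_coord (nilp v k *m x) = hE (vcol x) v + k * mcol x,
      mcol (nilp v k *m x) = 0 & vcol (nilp v k *m x) = cscale (mcol x) v].
Proof.
move=> ve; have ev := hE_perpC ve; set c := vec_to_complex v.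
have hv : hE (tailE x) v = hE (vcol x) v.
  by rewrite (tailE_vcol eta) hEDl hEcl ev mulr0 addr0.
have XE : Xroot e c = block_mx (0%:M : 'M[C]_1) (adj c) c (e *m adj c - c *m adj e).
  by rewrite raddf0.
have hX : head_coord (Xroot e c *m x) = hE (vcol x) v.
  by rewrite XE head_block mul0r add0r -/(iprod _ _) iprod_tail.
have tX : tailE (Xroot e c *m x) = cscale (mcol x) v + cscale (hE (vcol x) v) eta.
  apply: vec_to_complex_inj; rewrite vec_tailE XE tail_block mulmxBl !outerE.
  rewrite !iprod_tail hE_tail_eta hv !vec_to_complex_lin -/c.
  move: (hE _ _) (head_coord x) (mcol x) => a b m; clear.
  by apply/matrixP => i j; rewrite !mxE; ring.
have hZ : head_coord (Zroot e k *m x) = k * mcol x.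
  rewrite head_block -scalemxAl mxE -/(iprod _ _) iprod_tail hE_tail_eta; ring.
have tZ : tailE (Zroot e k *m x) = cscale (k * mcol x) eta.
  apply: vec_to_complex_inj; rewrite vec_tailE tail_block -scalemxAl outerE.
  rewrite iprod_tail hE_tail_eta vec_to_complex_lin !scalerA -scalerDl.
  by congr (_ *: _); ring.
rewrite mulmxDl; split.
- by rewrite head_coordD hX hZ.
- rewrite mcolD !mcolE hX hZ tX tZ !hE_lin hE_eta// ve; ring.
- rewrite vcolD !vcolE tX tZ !hE_lin hE_eta// ve mulr0 !mulr1 add0r subrr addr0.
  by rewrite addrK.
Qed.

Lemma mx_cols_eq0 (M : Mat) : (forall x, M *m x = 0) -> M = 0.
Proof.
move=> M0; apply/matrixP => i j; have := M0 (delta_mx j 0).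
by rewrite -colE => /matrixP/(_ i 0); rewrite !mxE.
Qed.

Definition exp_nilp v k : Mat :=
  1%:M + nilp v k + (2^-1 : R)%:C *: (nilp v k *m nilp v k).

Lemma nilp3 v k : hE v eta = 0 -> nilp v k *m nilp v k *m nilp v k = 0.
Proof.
move=> ve; apply: mx_cols_eq0 => x; rewrite -!mulmxA.
have [h1 m1 v1] := col_nilp k x ve.
have [h2 m2 v2] := col_nilp k (nilp v k *m x) ve.
have [h3 m3 v3] := col_nilp k (nilp v k *m (nilp v k *m x)) ve.
have H0 : head_coord (0 : 'cV[C]_(1 + n)) = 0 by rewrite -(scale0r 0) head_coordZ mul0r.
have M0 : mcol 0 = 0 by rewrite -(scale0r 0) mcolZ mul0r.
have V0 : vcol 0 = 0 by rewrite -(scale0r 0) vcolZ cscale0.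
apply: (@col_ext _ _ eta).
- by rewrite m3 M0.
- by rewrite v3 m2 V0 cscale0.
- by rewrite h3 v2 m1 m2 cscale0 hE0l mulr0 addr0 H0.
Qed.

Lemma mderive_realZ (f : R -> R) (t f' : R) p q (M : 'M[C]_(p, q)) :
  is_derive t 1 f f' -> mderive (fun s => (f s)%:C *: M) t (f'%:C *: M).
Proof.
move=> df; apply: mderive_eq (mderiveZ (cderive_real df) (mderive_cst M t)) _.
by rewrite scaler0 addr0.
Qed.

Lemma is_derive_idR (t : R) : is_derive t 1 (fun s : R => s) (1 : R).
Proof. exact: is_derive_id. Qed.

Lemma is_exp_nilp v k : hE v eta = 0 -> is_exp (nilp v k) (exp_nilp v k).
Proof.
move=> ve; exists (fun s : R => 1%:M + s%:C *: nilp v k +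
  (s * s / 2)%:C *: (nilp v k *m nilp v k)).
split.
- have z0 : (0 : R)%:C = 0 :> C by [].
  by rewrite !mul0r z0 !scale0r !addr0.
- by rewrite rmorph1 scale1r mul1r mul1r.
move=> t; have := nilp3 k ve; move: (nilp v k) => X X3.
have d1 := mderive_realZ X (is_derive_idR t).
have d2 := mderive_realZ (X *m X) (is_deriveMf (is_deriveMf (is_derive_idR t)
  (is_derive_idR t)) (is_derive_cstR (2^-1) t)).
apply: mderive_eq (mderiveD (mderiveD (mderive_cst 1%:M t) d1) d2) _.
rewrite !mulmxDl mul1mx -!scalemxAl X3 scaler0 addr0 add0r rmorph1 scale1r.
by congr (_ + _%:C *: _); field.
Qed.

Lemma pH3 : pH e *m pH e *m pH e = pH e.
Proof.
apply/eqP; rewrite -subr_eq0; apply/eqP; apply: mx_cols_eq0 => x.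
rewrite mulmxBl -!mulmxA; apply/eqP; rewrite subr_eq0; apply/eqP.
have [h1 m1 v1] := col_pH x.
have [h2 m2 v2] := col_pH (pH e *m x).
have [h3 m3 v3] := col_pH (pH e *m (pH e *m x)).
apply: (@col_ext _ _ eta).
- by rewrite m3 m2 opprK.
- by rewrite v3 v1.
- by rewrite h3 h2 m2; ring.
Qed.

(** Since the cube of [pH e] is [pH e], the exponential is 1 + sinh s pH + (cosh s - 1) pH^2. *)
Definition exp_pH (s : R) : Mat :=
  1%:M + ((expR s - expR (- s)) / 2)%:C *: pH e +
  ((expR s + expR (- s)) / 2 - 1)%:C *: (pH e *m pH e).

Lemma is_derive_expRZ (s t : R) :
  is_derive t 1 (fun q : R => expR (s * q)) (s * expR (s * t)).
Proof.
have ds : is_derive t 1 (fun q : R => s * q) s.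
  by apply: is_derive_eq (is_deriveMf (is_derive_cstR s t) (is_derive_idR t)) _; ring.
have := @is_derive1_comp R expR (fun q => s * q) t _ _ (is_derive_expR _) ds.
by move/is_derive_eq; apply; rewrite mulrC.
Qed.

Lemma is_exp_pH s : is_exp (s%:C *: pH e) (exp_pH s).
Proof.
exists (fun q : R => 1%:M + ((expR (s * q) - expR (- s * q)) / 2)%:C *: pH e +
  ((expR (s * q) + expR (- s * q)) / 2 - 1)%:C *: (pH e *m pH e)).
split.
- have z0 : (0 : R)%:C = 0 :> C by [].
  rewrite !mulr0 expR0 subrr mul0r z0 scale0r addr0.
  have -> : (1 + 1 : R) / 2 - 1 = 0 by field.
  by rewrite z0 scale0r addr0.
- by rewrite /exp_pH !mulr1.
move=> t.
have d1 := mderive_realZ (pH e) (is_deriveMf (is_deriveBf (is_derive_expRZ s t)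
  (is_derive_expRZ (- s) t)) (is_derive_cstR (2^-1) t)).
have d2 := mderive_realZ (pH e *m pH e) (is_deriveBf (is_deriveMf (is_deriveDf
  (is_derive_expRZ s t) (is_derive_expRZ (- s) t)) (is_derive_cstR (2^-1) t))
  (is_derive_cstR 1 t)).
apply: mderive_eq (mderiveD (mderiveD (mderive_cst 1%:M t) d1) d2) _.
rewrite add0r !mulmxDl mul1mx -!scalemxAl -!scalemxAr pH3.
rewrite [RHS]addrAC !scalerA -[in RHS]scalerDl -!rcM -rcD.
by congr (_%:C *: _ + _%:C *: _); field.
Qed.

Lemma cderive_mcol (y : R -> 'cV[C]_(1 + n)) (t : R) y' :
  mderive y t y' -> cderive (fun s => mcol (y s)) t (mcol y').
Proof.
move=> dy; have dt : is_derive t 1 (fun s => tailE (y s)) (tailE y').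
  apply/is_derive_vecP; rewrite vec_tailE.
  by apply: mderive_ext (mderive_tail dy) => s; rewrite vec_tailE.
apply: (cderive_ext (fun s => esym (mcolE eta (y s)))); rewrite mcolE.
apply: cderive_eq (cderiveB (cderive_head dy) (cderive_hE dt (is_derive_cstE eta t))) _.
by rewrite hE0r addr0.
Qed.

Lemma is_derive_vcol (y : R -> 'cV[C]_(1 + n)) (t : R) y' :
  mderive y t y' -> is_derive t 1 (fun s => vcol (y s)) (vcol y').
Proof.
move=> dy; have dt : is_derive t 1 (fun s => tailE (y s)) (tailE y').
  apply/is_derive_vecP; rewrite vec_tailE.
  by apply: mderive_ext (mderive_tail dy) => s; rewrite vec_tailE.
have dh := cderive_hE dt (is_derive_cstE eta t).
apply: (is_derive_ext (fun s => esym (vcolE eta (y s)))); rewrite vcolE.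
apply: is_derive_eq (is_deriveBf dt (is_derive_cscale dh (is_derive_cstE eta t))) _.
by rewrite hE0r addr0 cscaler0 addr0.
Qed.

(** The integral of exp (t q) for q from 0 to s. *)
Definition expR_prim (t s : R) : R := if t == 0 then s else (expR (t * s) - 1) / t.

Lemma is_derive_expR_prim (t s : R) : is_derive s 1 (expR_prim t) (expR (t * s)).
Proof.
rewrite /expR_prim; have [->|t0] := eqVneq t 0.
  by rewrite mul0r expR0; exact: is_derive_id.
apply: is_derive_eq (is_deriveMf (is_deriveBf (is_derive_expRZ t s)
  (is_derive_cstR 1 s)) (is_derive_cstR (t^-1) s)) _.
by field.
Qed.

Lemma expR_prim0 (t : R) : expR_prim t 0 = 0.
Proof. by rewrite /expR_prim; case: eqP => // _; rewrite mulr0 expR0 subrr mul0r. Qed.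

Lemma unitary_invK A : unitary_inv (unitary_inv A) = A.
Proof.
rewrite /unitary_inv !adjM adjK adj_hform -!mulmxA hformK mulmx1.
by rewrite mulmxA hformK mul1mx.
Qed.

(** [is_exp] asserts only that some integral curve ends at A, so A is studied through the equation
    gam' = gam X. Here X stands on the right; the inverse curve satisfies Gam' = - X Gam, and there
    [mcol] and [vcol] obey a closed triangular system that integrates explicitly. Unitarity holds
    because gam Gam is constant. *)
Lemma exp_shaped (t : R) v k A : hE v eta = 0 ->
  su1n (t%:C *: pH e + nilp v k) -> is_exp (t%:C *: pH e + nilp v k) A ->
  exists (lam rho : R), shaped eta A lam (rho *: v).
Proof.
move=> ve; set X := _ + nilp v k => -[Xsu _] [gam [g0 gA dgam]].
have dg s : mderive gam s (gam s *m X) by exact: dgam.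
pose Gam s := unitary_inv (gam s).
have XE : hform *m adj X = - (X *m hform).
  move: Xsu => /eqP; rewrite addr_eq0 => /eqP Xsu.
  rewrite -[LHS]mulmx1 -hformK [LHS]mulmxA -(mulmxA hform) Xsu mulmxN mulNmx.
  by rewrite mulmxA hformK mul1mx.
have dG s : mderive Gam s (- (X *m Gam s)).
  apply: mderive_eq (mderiveMr hform (mderiveMl hform (mderive_conjT (dg s)))) _.
  rewrite -/(adj (gam s *m X)) adjM mulmxA XE /Gam /unitary_inv.
  by rewrite !mulNmx !mulmxA.
have gG s : gam s *m Gam s = 1%:M.
  rewrite -[RHS](_ : gam 0 *m Gam 0 = _); last first.
    by rewrite /Gam g0 mul1mx /unitary_inv /adj map_mx1 trmx1 mulmx1 hformK.
  apply: (@mderive0_cst R _ _ (fun s => gam s *m Gam s)) => q.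
  apply: mderive_eq (mderiveM (dg q) (dG q)) _.
  by rewrite mulmxN -mulmxA subrr.
have Au : unitary A.
  have := mulmx1C (gG 1); rewrite gA /Gam gA /unitary_inv /unitary => h.
  by rewrite -[RHS]mulmx1 -h !mulmxA hformK mul1mx.
have Xcol y : mcol (X *m y) = - t%:C * mcol y /\ vcol (X *m y) = cscale (mcol y) v.
  have [_ m1 v1] := col_pH y; have [_ m2 v2] := col_nilp k y ve.
  rewrite mulmxDl -scalemxAl mcolD vcolD mcolZ vcolZ m1 m2 v1 v2 cscaler0 add0r.
  by split=> //; ring.
have dmG q x : mcol (- (X *m Gam q) *m x) = t%:C * mcol (Gam q *m x).
  rewrite mulNmx -mulmxA -[- (X *m _)]scaleN1r mcolZ (Xcol _).1; ring.
have dvG q x : vcol (- (X *m Gam q) *m x) = - cscale (mcol (Gam q *m x)) v.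
  rewrite mulNmx -mulmxA -[- (X *m _)]scaleN1r vcolZ (Xcol _).2.
  by rewrite cscaleN cscale1.
have mG x s : mcol (Gam s *m x) = (expR (t * s))%:C * mcol x.
  have eN q : expR (- t * q) * expR (t * q) = 1 :> R.
    by rewrite -expRD mulNr addNr expR0.
  have G0 : Gam 0 *m x = x by rewrite -[LHS]mul1mx -g0 mulmxA gG mul1mx.
  have : (expR (- t * s))%:C * mcol (Gam s *m x) =
      (expR (- t * 0))%:C * mcol (Gam 0 *m x).
    apply: (@cderive0_cst R (fun s => (expR (- t * s))%:C * mcol (Gam s *m x))) => q.
    apply: cderive_eq (cderiveM (cderive_real (is_derive_expRZ (- t) q))
      (cderive_mcol (mderiveMr x (dG q)))) _.
    rewrite dmG rcM rcN; ring.
  rewrite mulr0 expR0 mul1r G0 => <-.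
  move: (mcol (Gam s *m x)) => a.
  by rewrite mulrA -rcM (mulrC (expR (t * s))) eN mul1r.
have vG x s : vcol (Gam s *m x) = vcol x - expR_prim t s *: cscale (mcol x) v.
  have G0 : Gam 0 *m x = x by rewrite -[LHS]mul1mx -g0 mulmxA gG mul1mx.
  apply/eqP; rewrite -subr_eq opprK; apply/eqP.
  have -> : vcol x = vcol (Gam 0 *m x) + expR_prim t 0 *: cscale (mcol x) v.
    by rewrite expR_prim0 scale0r addr0 G0.
  apply/rowP => j; apply: (@is_derive_0_is_cst R
    (fun s => (vcol (Gam s *m x) + expR_prim t s *: cscale (mcol x) v) 0 j)) => q.
  have := (is_derive_mxP _ _ _ _).1 (is_deriveDf (is_derive_vcol (mderiveMr x (dG q)))
    (is_deriveZf (is_derive_expR_prim t q) (is_derive_cstE (cscale (mcol x) v) q))) 0 j.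
  move/is_derive_eq; apply; rewrite dvG mG.
  rewrite scaler0 addr0 -cscaleA cscale_real addNr.
  by rewrite mxE.
have GE : unitary_inv (Gam 1) = A by rewrite /Gam gA unitary_invK.
have GA : Gam 1 = unitary_inv A by rewrite /Gam gA.
(* The factor 2 compensates the half in [shaped]. *)
have Gs : shaped eta (Gam 1) (expR t) (- (2 * expR_prim t 1) *: v).
  split.
  - by rewrite GA; exact: unitary_unitary_inv.
  - exact: expR_gt0.
  - by rewrite hEZl ve mulr0.
  - by move=> x; rewrite mG mulr1.
  - move=> x; rewrite vG; congr (_ + _); rewrite -scaleN1r -!cscale_real !cscaleA.
    by congr (cscale _ _); rewrite !rcE rmorph1; field.
exists (expR t)^-1, ((expR t)^-1 * (2 * expR_prim t 1)).
by have := shapedV Gs; rewrite GE scaleNr scalerN opprK scalerA.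
Qed.

End SolvableGroup.

(** * Horospherical coordinates and the equation of the orbit *)

Section Orbit.
Context {R : realType} {n : nat}.
Local Notation E := 'rV[R]_(n + n).
Local Notation C := R[i].
Local Notation Mat := 'M[C]_(1 + n).
Variable eta : E.
Hypothesis eta1 : dotE eta eta = 1.
Variable P : {linear E -> E}.
Hypotheses (PK : forall X, P (P X) = P X)
  (P_sym : forall X Y, dotE (P X) Y = dotE X (P Y))
  (P_eta : P eta = 0) (P_Jeta : P (Jmap eta) = 0).
Implicit Types (A : Mat) (x : 'cV[C]_(1 + n)) (u v z xi : E) (k : C).

Local Notation e := (vec_to_complex eta).

Lemma col_exp_pH s x :
  [/\ head_coord (exp_pH eta s *m x) = head_coord x +
        ((expR s - expR (- s)) / 2)%:C * (head_coord x - mcol eta x) +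
        ((expR s + expR (- s)) / 2 - 1)%:C * head_coord x,
      mcol eta (exp_pH eta s *m x) = (expR (- s))%:C * mcol eta x &
      vcol eta (exp_pH eta s *m x) = vcol eta x].
Proof.
have [h1 m1 v1] := col_pH eta1 x.
have [h2 m2 v2] := col_pH eta1 (pH e *m x).
rewrite /exp_pH !mulmxDl mul1mx -!scalemxAl -mulmxA; split.
- by rewrite !head_coordD !head_coordZ h2 h1 m1; ring.
- by rewrite !mcolD !mcolZ m2 m1 !rcE; field.
- by rewrite !vcolD !vcolZ v2 v1 !cscaler0 !addr0.
Qed.

Lemma col_exp_nilp v k x : hE v eta = 0 ->
  [/\ head_coord (exp_nilp eta v k *m x) = head_coord x + hE (vcol eta x) v +
        k * mcol eta x + mcol eta x * (dotE v v)%:C / 2,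
      mcol eta (exp_nilp eta v k *m x) = mcol eta x &
      vcol eta (exp_nilp eta v k *m x) = vcol eta x + cscale (mcol eta x) v].
Proof.
move=> ve; have [h1 m1 v1] := col_nilp eta1 k x ve.
have [h2 m2 v2] := col_nilp eta1 k (nilp eta v k *m x) ve.
have XE (X : Mat) (c : C) : (1%:M + X + c *: (X *m X)) *m x =
    x + X *m x + c *: (X *m (X *m x)).
  by rewrite !mulmxDl mul1mx -!scalemxAl -mulmxA.
rewrite /exp_nilp XE; split.
- by rewrite !head_coordD !head_coordZ h2 h1 v1 m1 hEcl hExx !rcE; field.
- by rewrite !mcolD !mcolZ m2 m1 mulr0 !addr0.
- by rewrite !vcolD !vcolZ v2 v1 m1 cscale0 cscaler0 !addr0.
Qed.

(** The defining function of the Siegel domain model: division by |mz|^2 turns it into 2 Re (1 / mz)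
    - 1 - |vz / mz|^2. *)
Lemma norm_vz z : 1 - dotE z z =
  2 * complex.Re (mz eta z) - normsq (mz eta z) - dotE (vz eta z) (vz eta z).
Proof.
have zE : z = vz eta z + cscale (1 - mz eta z) eta.
  by rewrite vzE mzE subKr subrK.
have zz : hE z z = hE (vz eta z) (vz eta z) +
    (1 - mz eta z) * (1 - (mz eta z)^*).
  have hv := hE_vz eta1 z; have hv' := hE_perpC hv.
  rewrite [in LHS]zE; move: (vz eta z) (mz eta z) hv hv' => v m hv hv'.
  by rewrite !hE_lin (hE_eta eta1) hv hv' cjD cjN rmorph1; ring.
apply: complexI; rewrite -sub1C -hExx zz hExx !rcE -normsqE.
have -> : (complex.Re (mz eta z))%:C = (mz eta z + (mz eta z)^*) / 2 by exact: ReJ_add.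
by field.
Qed.

Lemma conjC_imag k : complex.Re k = 0 -> k^* = - k.
Proof. by move=> rk; apply: complexP; rewrite !ReImE ?rk ?oppr0. Qed.

(** An Iwasawa type decomposition. With V = vz / mz, the unipotent factor supplies the component v =
    V - P V, the factor from a adjusts the scale, and what remains is a multiple xi of P V. The
    parameter k matches the head coordinates. *)
Lemma horospherical_decomposition z : CH z -> exists s v k xi mu,
  [/\ hE v eta = 0, P v = 0, k^* = - k, P xi = xi &
      mu != 0 /\
      exp_nilp eta v k *m (exp_pH eta s *m lift xi) = mu *: lift z].
Proof.
move=> zB; have m0 := mz_neq0 eta1 zB; set m := mz eta z in m0.
set V := cscale m^-1 (vz eta z); set v := V - P V.
have VE : hE V eta = 0 by rewrite hEcl hE_vz// mulr0.
have PVE : hE (P V) eta = 0 by exact: P_perp.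
have ve : hE v eta = 0 by rewrite hEDl hENl VE PVE subrr.
have Pv : P v = 0 by rewrite linearB /= PK subrr.
have dPv : dotE (P V) v = 0.
  by rewrite /v dotEDr dotENr (P_sym V (P V)) PK P_sym subrr.
have VV : dotE V V = dotE v v + dotE (P V) (P V).
  have dvP : dotE v (P V) = 0 by rewrite dotEC.
  have -> : dotE V V = dotE (v + P V) (v + P V) by rewrite subrK.
  have pyth (x y : E) : dotE x y = 0 -> dotE y x = 0 ->
      dotE (x + y) (x + y) = dotE x x + dotE y y.
    by move=> xy yx; rewrite !dotE_lin xy yx; ring.
  exact: pyth.
have nm : 0 < normsq m by rewrite normsq_gt0.
(* This value makes the real part of k below vanish. It is (1 - |z|^2) / |mz|^2 plus |P V|^2, hence
   positive. *)
set q := 2 * complex.Re m^-1 - 1 - dotE v v.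
have q0 : 0 < q.
  have VVz : dotE V V = dotE (vz eta z) (vz eta z) / normsq m.
    apply: complexI; rewrite -hExx /V hEcl hEcr hExx cjV rcM rcV -normsqE.
    have mc0 : m^* != 0 by rewrite conjc_eq0.
    field; by rewrite ?m0 ?mc0.
  have := CH_gt0 zB; rewrite norm_vz -/m => h.
  have : 0 < (2 * complex.Re m - normsq m - dotE (vz eta z) (vz eta z)) / normsq m.
    by rewrite divr_gt0.
  have -> : (2 * complex.Re m - normsq m - dotE (vz eta z) (vz eta z)) / normsq m =
      2 * complex.Re m^-1 - 1 - dotE V V.
    by rewrite VVz ReV -normsq_ReIm; field; rewrite gt_eqF.
  by rewrite VV /q; have := dotE_ge0 (P V); clear; lra.
have sq0 : 0 < Num.sqrt q by rewrite sqrtr_gt0.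
pose lam := (Num.sqrt q)^-1.
have lam0 : lam != 0 by rewrite invr_eq0 gt_eqF.
have qE : q = lam ^- 2 by rewrite /lam exprVn invrK sqr_sqrtr// ltW.
have eS : expR (ln (Num.sqrt q)) = lam^-1 by rewrite lnK ?posrE// invrK.
have eNS : expR (- ln (Num.sqrt q)) = lam by rewrite expRN lnK ?posrE.
pose k : C := m^-1 - 2^-1 - (q / 2)%:C - hE (P V) v - (dotE v v / 2)%:C.
exists (ln (Num.sqrt q)), v, k, (lam *: P V), (lam%:C / m).
have lamC : (lam%:C : C) != 0 by rewrite realC_neq0.
have Pxi : P (lam *: P V) = lam *: P V by rewrite linearZ /= PK.
have xie : hE (lam *: P V) eta = 0 by rewrite hEZl PVE mulr0.
split=> //.
  have Rk : complex.Re k = 0.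
    have half : complex.Re (2^-1 : C) = 2^-1.
      by rewrite -(rc_nat 2) -rcV.
    have hPV : complex.Re (hE (P V) v) = 0 := dPv.
    have rr (r : R) : complex.Re (r%:C : C) = r by [].
    by rewrite /k !ReImE half hPV !rr /q; field.
  exact: conjC_imag.
split; first by rewrite mulf_neq0 ?invr_eq0.
have [h1 m1 v1] := col_exp_pH (ln (Num.sqrt q)) (lift (lam *: P V)).
have [h2 m2 v2] := col_exp_nilp k (exp_pH eta (ln (Num.sqrt q)) *m lift (lam *: P V)) ve.
apply: (@col_ext _ _ eta).
- rewrite m2 m1 eNS mcolZ !mcol_lift (mz_perp xie) -/m; field; exact: m0.
- rewrite v2 m1 v1 eNS vcolZ !vcol_lift mcol_lift (mz_perp xie) (vz_perp xie).
  by rewrite mulr1 -cscaleA -/V cscale_real -scalerDr /v addrC subrK cscale_real.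
- rewrite h2 h1 m1 v1 eNS eS vcol_lift mcol_lift head_coordZ !head_lift.
  rewrite (mz_perp xie) (vz_perp xie) hEZl /k qE !rcE.
  have s0 : ((Num.sqrt q)%:C : C) != 0 by rewrite realC_neq0 gt_eqF.
  have one : (1 : R)%:C = 1 :> C by [].
  rewrite one; move: (hE (P V) v) ((dotE v v)%:C) ((Num.sqrt q)%:C : C) s0 (m) m0.
  by move=> a b s s0 m' m0'; field; rewrite ?s0 ?m0'.
Qed.

Variable h : set Mat.
Hypothesis hE_alg : forall X, h X <-> exists t v k,
  [/\ hE v eta = 0, P v = 0, k^* = - k & X = t%:C *: pH e + nilp eta v k].

Lemma su1nD (X Y : Mat) : su1n X -> su1n Y -> su1n (X + Y).
Proof.
move=> [X1 X2] [Y1 Y2]; split; last by rewrite mxtraceD X2 Y2 addr0.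
rewrite [conj_transpose _]adjD mulmxDl mulmxDr addrACA.
by rewrite [X in X + _]X1 [X in _ + X]Y1 addr0.
Qed.

Lemma su1nZ (t : R) (X : Mat) : su1n X -> su1n (t%:C *: X).
Proof.
move=> [X1 X2]; split; last by rewrite mxtraceZ X2 mulr0.
rewrite [conj_transpose _]adjZr -scalemxAl -scalemxAr -scalerDr.
by rewrite [X in _ *: X]X1 scaler0.
Qed.

Lemma su1n_pH (c : 'cV[C]_n) : su1n (pH c).
Proof.
have -> : pH c = block_mx (0%:M : 'M[C]_1) (adj c) c 0 by rewrite raddf0.
apply: su1n_block; first by rewrite rmorph0 oppr0.
  by apply/matrixP => i j; rewrite !mxE oppr0 rmorph0.
by rewrite raddf0 addr0.
Qed.

Lemma iprod_eta : iprod e e = 1.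
Proof. by rewrite iprod_hE !vec_to_complexK hE_eta. Qed.

Lemma su1n_nilp v k : hE v eta = 0 -> k^* = - k -> su1n (nilp eta v k).
Proof.
move=> ve kc; apply: su1nD.
  apply: (proj1 ((root_spaceX _ iprod_eta).2 _)).
  by exists (vec_to_complex v) => //; rewrite iprod_hE !vec_to_complexK.
by apply: (proj1 ((root_spaceZ _ iprod_eta).2 _)); exists k.
Qed.

Lemma connected_shaped A : connected_subgroup h A ->
  exists lam U, shaped eta A lam U /\ P U = 0.
Proof.
elim=> {A} [|X A B /hE_alg [t [v [k [ve Pv kc XE]]]] XA _ [mu [V [Bs PV]]]].
  by exists 1, 0; split; [exact: shaped1|rewrite linear0].
rewrite XE in XA.
have Xsu : su1n (t%:C *: pH e + nilp eta v k).
  by apply: su1nD; [apply/su1nZ/su1n_pH|exact: su1n_nilp].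
have [lam [rho As]] := exp_shaped eta1 ve Xsu XA.
exists (lam * mu), (V + mu *: (rho *: v)); split; first exact: shapedM.
by rewrite linearD !linearZ /= PV Pv !scaler0 addr0.
Qed.

Lemma nilp0 : nilp eta 0 0 = 0.
Proof.
have z : (0%:M : 'M[C]_1) = 0 by exact: raddf0.
have a0 : adj (0 : 'cV[C]_n) = 0 by apply/matrixP => i j; rewrite !mxE rmorph0.
rewrite /nilp vec_to_complex0 /Xroot a0 mul0mx mulmx0 subr0 block_mx0 add0r.
by rewrite /Zroot z oppr0 !scale0r block_mx0.
Qed.

Lemma connected_transitive z : CH z -> exists A xi,
  [/\ connected_subgroup h A, P xi = xi, CH xi & z = ball_action A xi].
Proof.
move=> zB; have [s [v [k [xi [mu [ve Pv kc Pxi [mu0 e1]]]]]]] := horospherical_decomposition zB.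
pose A := exp_nilp eta v k *m (exp_pH eta s *m 1%:M).
have Ac : connected_subgroup h A.
  apply: connected_subgroupM (is_exp_nilp eta1 k ve) _.
    by apply/hE_alg; exists 0, v, k; split=> //; rewrite scale0r add0r.
  apply: connected_subgroupM (is_exp_pH eta1 s) (connected_subgroup1 _).
  apply/hE_alg; exists s, 0, 0; split=> //.
  - exact: hE0l.
  - exact: linear0.
  - by rewrite rmorph0 oppr0.
  by rewrite nilp0 addr0.
have AE : A *m lift xi = mu *: lift z.
  rewrite /A; move: (exp_nilp _ _ _) (exp_pH _ _) e1 => B D e1.
  by rewrite mulmx1 -mulmxA e1.
have [lam [U [As _]]] := connected_shaped Ac; have Au := shaped_unitary As.
have dE : denom A xi = mu by rewrite denomE AE head_scale_lift.
exists A, xi; split=> //.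
  (* That xi lies in the ball is read off from the Lorentz norms: 1 - |xi|^2 = |mu|^2 (1 -
     |z|^2). *)
  have := lorentz_unitary (lift xi) (lift xi) Au.
  rewrite AE lorentz_lift_lift lorentz_lift normsqE !hExx -opprB sub1C => /eqP.
  rewrite mulrN -[X in _ == X]opprB sub1C eqr_opp -rcM => /eqP/complexI e2.
  by rewrite /CH /= -subr_gt0 -e2 mulr_gt0 ?normsq_gt0// CH_gt0.
apply: vec_to_complex_inj; rewrite vec_ball_action dE AE tail_scale_lift scalerA.
by rewrite mulVf// scale1r.
Qed.

Lemma CH0 : CH (0 : E).
Proof. by rewrite /CH /= dotE0l ltr01. Qed.

(** Along the orbit [Qz] is rescaled from its value 0 at o. Conversely z = A xi with xi fixed by P,
    where [Qz] is a nonzero multiple of xi; its vanishing forces xi = 0. *)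
Lemma orbitP z : (exists2 A, connected_subgroup h A & z = ball_action A 0) <->
  CH z /\ Qz eta P z = 0.
Proof.
split=> [[A Ac ->]|[zB Q0]].
  have [lam [U [As PU]]] := connected_shaped Ac; have Au := shaped_unitary As.
  split; first exact: ball_action_CH CH0.
  by rewrite (Qz_action P_eta P_Jeta As PU CH0) Qz_def cscaler0 linear0 scaler0.
have [A [xi [Ac Pxi xiB zE]]] := connected_transitive zB.
have [lam [U [As PU]]] := connected_shaped Ac.
have lam0 : lam != 0 by case: As => _ l0 _ _ _; rewrite gt_eqF.
have nm : normsq (mz eta z) != 0 by rewrite gt_eqF// normsq_gt0 mz_neq0.
exists A; first exact: Ac.
rewrite {1}zE; congr (ball_action A _).
move: Q0; rewrite zE (Qz_perp eta1 P_sym P_eta P_Jeta As PU Pxi xiB) -zE.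
by move/eqP; rewrite scaler_eq0 mulf_eq0 invr_eq0 (negPf nm) (negPf lam0) => /eqP.
Qed.

End Orbit.

(** * Tubes around the orbit of S_w *)

Section Tube.
Context {R : realType} {n : nat}.
Local Notation E := 'rV[R]_(n + n).
Local Notation C := R[i].
Local Notation Mat := 'M[C]_(1 + n).
Variable eta : E.
Hypothesis eta1 : dotE eta eta = 1.
Variable P : {linear E -> E}.
Hypotheses (PK : forall X, P (P X) = P X)
  (P_sym : forall X Y, dotE (P X) Y = dotE X (P Y))
  (P_eta : P eta = 0) (P_Jeta : P (Jmap eta) = 0).
Implicit Types (A B : Mat) (X Y z xi : E).

(** What the geometry of the tube uses of the elements of S_w. Together with [W_P] and [W_trans] it
    separates the study of the tube from the Lie algebra. *)
Definition solv A := exists lam U, shaped eta A lam U /\ P U = 0.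

Lemma solv_unitary A : solv A -> unitary A.
Proof. by case=> lam [U [/shaped_unitary]]. Qed.

Lemma solvM A B : solv A -> solv B -> solv (A *m B).
Proof.
move=> [lam [U [As PU]]] [mu [V [Bs PV]]].
exists (lam * mu), (V + mu *: U); split; first exact: shapedM.
by rewrite linearD linearZ /= PU PV scaler0 addr0.
Qed.

Lemma solvV A : solv A -> solv (unitary_inv A).
Proof.
move=> [lam [U [As PU]]]; exists lam^-1, (- (lam^-1 *: U)).
by split; [exact: shapedV|rewrite linearN linearZ /= PU scaler0 oppr0].
Qed.

Variable W : set E.
Hypothesis W_P : forall z, W z <-> CH z /\ Qz eta P z = 0.
Hypothesis W_trans : forall z, CH z -> exists A xi,
  [/\ solv A, P xi = xi, CH xi & z = ball_action A xi].

Lemma W_CH z : W z -> CH z. Proof. by case/W_P. Qed.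

Lemma W_action A z : solv A -> W z -> W (ball_action A z).
Proof.
move=> [lam [U [As PU]]] /W_P[zB Q0]; apply/W_P.
split; first exact: ball_action_CH (shaped_unitary As) zB.
by rewrite (Qz_action P_eta P_Jeta As PU zB) Q0 scaler0.
Qed.

Lemma W_base z : W z -> exists2 A, solv A & z = ball_action A 0.
Proof.
move=> /W_P[zB Q0]; have [A [xi [As Pxi xiB zE]]] := W_trans zB.
exists A; first exact: As.
have [lam [U [As' PU]]] := As.
have lam0 : lam != 0 by case: As' => _ l0 _ _ _; rewrite gt_eqF.
have nm : normsq (mz eta z) != 0 by rewrite gt_eqF// normsq_gt0 mz_neq0.
rewrite {1}zE; congr (ball_action A _).
move: Q0; rewrite zE (Qz_perp eta1 P_sym P_eta P_Jeta As' PU Pxi xiB) -zE.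
by move/eqP; rewrite scaler_eq0 mulf_eq0 invr_eq0 (negPf nm) (negPf lam0) => /eqP.
Qed.

Lemma is_geodesic_derive (c : R -> E) : is_geodesic CH bergman c ->
  forall t : R, is_derive t 1 c (c^`()%classic t).
Proof.
move=> geo t; have [_ [c' [V' [dc _ _]]]] := geo t.
by case: (dc) => d dE; split; [exact: d|rewrite derive1E].
Qed.

Lemma derive1_ball_action A (c : R -> E) : unitary A -> is_geodesic CH bergman c ->
  (fun s => ball_action A (c s))^`()%classic =
  fun s => dball_action A (c s) (c^`()%classic s).
Proof.
move=> Au geo; apply/funext => s; rewrite derive1E.
have [cB _] := geo s.
by case: (is_derive_ball_action Au cB (is_geodesic_derive geo s)).
Qed.

Lemma is_geodesic_action A (c : R -> E) : unitary A -> is_geodesic CH bergman c ->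
  is_geodesic CH bergman (fun s => ball_action A (c s)).
Proof.
move=> Au geo t; have [cB dc] := geo t; split; first exact: ball_action_CH.
rewrite derive1_ball_action// -(dball_action0 Au cB).
exact: is_covariant_derivative_ball_action.
Qed.

Lemma tangent_vector_action A p X : solv A -> W p -> tangent_vector W p X ->
  tangent_vector W (ball_action A p) (dball_action A p X).
Proof.
move=> As Wp [c [cW c0 dc]]; exists (fun s => ball_action A (c s)); split.
- by move=> t; apply: W_action.
- by rewrite c0.
- rewrite -c0 in Wp *; exact: is_derive_ball_action (solv_unitary As) (W_CH Wp) dc.
Qed.

Lemma unit_normal_vector_action A p xi : solv A -> W p ->
  unit_normal_vector bergman W p xi ->
  unit_normal_vector bergman W (ball_action A p) (dball_action A p xi).
Proof.
move=> As Wp [xiT xi1]; have Au := solv_unitary As; have pB := W_CH Wp.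
split; last by rewrite bergman_dball.
move=> X TX; have := tangent_vector_action (solvV As) (W_action As Wp) TX.
rewrite (ball_actionK Au pB) => /xiT; rewrite -(bergman_dball Au pB).
have := dball_actionVK X Au (ball_action_CH Au pB).
by rewrite (ball_actionK Au pB) => ->.
Qed.

Lemma unit_normal_geodesic_action A (c : R -> E) : solv A ->
  unit_normal_geodesic CH bergman W c ->
  unit_normal_geodesic CH bergman W (fun s => ball_action A (c s)).
Proof.
move=> As [geo Wc nc]; have Au := solv_unitary As; split.
- exact: is_geodesic_action.
- exact: W_action.
- by rewrite derive1_ball_action//; exact: unit_normal_vector_action.
Qed.

Lemma near_lt (f : R -> R) (t f' b : R) : is_derive t 1 f f' -> f t < b ->
  \forall s \near t, f s < b.
Proof.
move=> [df _] ftb; have /derivable1_diffP/differentiable_continuous cf := df.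
exact: (cvgr_lt (f t) cf).
Qed.

Lemma near_CH (c : R -> E) (t : R) c' : is_derive t 1 c c' -> CH (c t) ->
  \forall s \near t, CH (c s).
Proof. by move=> dc; apply: near_lt (is_derive_dotE dc dc). Qed.

Lemma bergman0E X Y : bergman 0 X Y = 4 * dotE X Y.
Proof. by rewrite /bergman !linear0 !dotE0r; field. Qed.

Lemma tangent_line X : (forall t : R, CH (t *: X) -> W (t *: X)) ->
  tangent_vector W 0 X.
Proof.
move=> XW; have d0 := is_derive_affine (0 : E) X (0 : R).
(* A curve has to stay in W for all times; the value 0 outside the ball does not affect the
   derivative at 0. *)
exists (fun t : R => if `[< CH (t *: X) >] then t *: X else 0); split.
- move=> t; case: asboolP => [/XW//|_].
  by have := XW 0; rewrite scale0r; apply; exact: CH0.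
- by case: asboolP => _; rewrite ?scale0r.
apply: (near_eq_is_derive _ d0).
have := near_CH d0 _; rewrite scale0r addr0 => /(_ CH0); apply: filterS => s.
by rewrite add0r; case: asboolP.
Qed.

(** Differentiating Qz = 0 along a curve of W through 0 gives P X = 0, so the range of P is normal.
    Conversely the lines through eta, J eta and xi - P xi lie in W within the ball, and
    orthogonality to them leaves xi = P xi. The Euclidean length is 1/2 because the metric at 0 is 4
    [dotE]. *)
Lemma unit_normal_vector0 xi : unit_normal_vector bergman W 0 xi <->
  P xi = xi /\ dotE xi xi = 4^-1.
Proof.
split=> [[xiT]|[Pxi xi1]]; last first.
  split; last by rewrite bergman0E xi1 divff.
  move=> X [c [cW c0 dc]]; rewrite bergman0E.
  have dm : cderive (fun s => (mz eta (c s))^*) 0 (- hE X eta)^*.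
    apply: cderive_conj; apply: (cderive_ext (fun s => esym (mzE eta (c s)))).
    apply: cderive_eq (cderiveB (cderive_cst 1 0) (cderive_hE dc (is_derive_cstE eta 0))) _.
    by rewrite hE0r addr0 sub0r.
  have dQ : is_derive (0 : R) 1 (fun s => Qz eta P (c s)) (P X).
    apply: (is_derive_ext (fun s => esym (Qz_def eta P (c s)))).
    apply: is_derive_eq (is_derive_linear P (is_derive_cscale dm dc)) _.
    by rewrite c0 mzE hE0l subr0 rmorph1 cscaler0 add0r cscale1.
  have Q0 : (fun s => Qz eta P (c s)) = fun=> 0.
    by apply/funext => s; have /W_P[] := cW s.
  have PX : P X = 0.
    by rewrite Q0 in dQ; apply: is_derive_unique dQ (is_derive_cst _ _ _).
  by rewrite -Pxi P_sym PX dotE0r mulr0.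
rewrite bergman0E => xi1; split; last by lra.
have T X : tangent_vector W 0 X -> dotE xi X = 0.
  by move=> /xiT; rewrite bergman0E => ?; lra.
have he : hE xi eta = 0.
  apply: complexP; apply: T; apply: tangent_line => t tB; apply/W_P; split=> //.
    by rewrite Qz_def -cscale_real cscaleA (P_cscale_eta P_eta P_Jeta).
  rewrite Qz_def (_ : t *: Jmap eta = cscale (0 +i* t) eta).
    by rewrite cscaleA (P_cscale_eta P_eta P_Jeta).
  by rewrite cscaleE /= scale0r add0r.
set v := xi - P xi.
have Pv : P v = 0 by rewrite linearB /= PK subrr.
have ve : hE v eta = 0.
  by rewrite hEDl hENl he (P_perp P_sym P_eta P_Jeta (PK _)) subrr.
have vv : dotE v v = 0.
  have Tv : dotE xi v = 0.
    apply: T; apply: tangent_line => t tB; apply/W_P; split=> //.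
    rewrite Qz_def mz_perp ?rmorph1 ?cscale1 ?linearZ /= ?Pv ?scaler0//.
    by rewrite hEZl ve mulr0.
  by rewrite {1}/v dotEDl dotENl Tv P_sym Pv dotE0r subrr.
by move/eqP: vv; rewrite dotE_eq0 subr_eq0 => /eqP <-.
Qed.

Lemma W0 : W 0.
Proof. by apply/W_P; split; [exact: CH0|rewrite Qz_def cscaler0 linear0]. Qed.

Variable r : R.
Hypothesis r_gt0 : 0 < r.

(** These are tanh (r / 2) and 1 / sinh r. A normal geodesic from 0 reaches a point xi of Euclidean
    length [tau] with a velocity of Euclidean length (1 - tau^2) / 2, that is with velocity kap
    xi. *)
Definition tau : R := thalf r.
Definition kap : R := (1 - tau ^+ 2) / (2 * tau).

Lemma tau_gt0 : 0 < tau. Proof. exact: thalf_gt0. Qed.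

Lemma tau_lt1 : tau ^+ 2 < 1. Proof. exact: thalf_bound. Qed.

(** A group element moves the foot point of the geodesic to 0, where [geodesic0E] makes the geodesic
    explicit. *)
Lemma tube_normalP q N : tube_normal CH bergman W r q N <->
  exists A xi, [/\ solv A, P xi = xi, dotE xi xi = tau ^+ 2,
    q = ball_action A xi & N = - kap *: dball_action A xi xi].
Proof.
have t0 := lt0r_neq0 tau_gt0.
have CHxi xi : dotE xi xi = 4^-1 -> forall t, CH ((2 * thalf t) *: xi).
  by move=> xi1 t; have [] := geodesic_thalf xi1 t.
split.
  move=> [c cN [cq NE]]; have [geo Wc _] := cN.
  have [A As c0] := W_base Wc; have Au := solv_unitary As.
  have [c1 [cE c10 geo1 n1]] : exists c1 : R -> E,
      [/\ forall s, c s = ball_action A (c1 s), c1 0 = 0,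
          is_geodesic CH bergman c1 &
          unit_normal_vector bergman W 0 (c1^`()%classic 0)].
    exists (fun s => ball_action (unitary_inv A) (c s)).
    have [geo1 _] := unit_normal_geodesic_action (solvV As) cN.
    rewrite c0 (ball_actionK Au CH0) => n1; split; [|by []|exact: geo1|exact: n1].
    by move=> s; rewrite (ball_actionVK Au)//; case: (geo s).
  have [Pxi xi1] := (unit_normal_vector0 _).1 n1.
  have c1E := geodesic0E geo1 c10; set xi := c1^`()%classic 0 in Pxi xi1 c1E.
  rewrite bergman0E xi1 divff// in c1E; have {}c1E := c1E erefl.
  have hB : CH ((2 * tau) *: xi) := CHxi _ xi1 r.
  have c1r : c1 r = (2 * tau) *: xi by exact: c1E.
  have c'E : c^`()%classic r =
      dball_action A ((2 * tau) *: xi) ((1 - tau ^+ 2) *: xi).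
    rewrite derive1E (_ : c = fun s => ball_action A ((2 * thalf s) *: xi)).
      by have [_ ->] := is_derive_ball_action Au hB (is_derive_thalfZ r xi).
    by apply/funext => s; rewrite -c1E -cE.
  exists A, ((2 * tau) *: xi); split.
  - exact: As.
  - by rewrite linearZ /= Pxi.
  - by rewrite !dotE_lin xi1; field.
  - by rewrite -cq -c1r -cE.
  - rewrite NE c'E !(dball_actionZ Au hB); move: (dball_action A _ xi) => Y.
    by rewrite scalerA -scaleNr; congr (_ *: _); rewrite /kap; field.
move=> [A [xi [As Pxi xi1 -> ->]]]; have Au := solv_unitary As.
set x0 := (2 * tau)^-1 *: xi.
have x1 : dotE x0 x0 = 4^-1 by rewrite !dotE_lin xi1; field.
have xE : (2 * thalf r) *: x0 = xi.
  by rewrite scalerA divff ?scale1r// mulf_neq0 ?pnatr_eq0.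
have dE s : (fun t => (2 * thalf t) *: x0)^`()%classic s = (1 - thalf s ^+ 2) *: x0.
  by rewrite derive1E; case: (is_derive_thalfZ s x0).
have geo := geodesic_thalf x1.
have N0 : unit_normal_geodesic CH bergman W (fun t => (2 * thalf t) *: x0).
  split=> //; rewrite thalf0 mulr0 scale0r; first exact: W0.
  rewrite dE thalf0 expr0n subr0 scale1r; apply/unit_normal_vector0.
  by split=> //; rewrite linearZ /= Pxi.
exists (fun t => ball_action A ((2 * thalf t) *: x0)).
  exact: unit_normal_geodesic_action As N0.
rewrite xE; split=> //; rewrite derive1_ball_action// xE dE scaleNr; congr (- _).
have hB : CH xi by rewrite -xE; exact: CHxi.
rewrite !(dball_actionZ Au hB); move: (dball_action A xi xi) => Y.
by rewrite !scalerA; congr (_ *: _); rewrite /kap /tau; field.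
Qed.

Lemma CH_tau xi : dotE xi xi = tau ^+ 2 -> CH xi.
Proof. by rewrite /CH /= => ->; exact: tau_lt1. Qed.

Lemma tubeP q : tube CH bergman W r q <->
  exists A xi, [/\ solv A, P xi = xi, dotE xi xi = tau ^+ 2 & q = ball_action A xi].
Proof.
split=> [[c cN cq]|[A [xi [As Pxi xi1 qE]]]].
  have /tube_normalP[A [xi [As Pxi xi1 qE _]]] :
    tube_normal CH bergman W r q (- c^`()%classic r) by exists c.
  by exists A, xi.
have [c cN [cq _]] : tube_normal CH bergman W r q (- kap *: dball_action A xi xi).
  by apply/tube_normalP; exists A, xi.
by exists c.
Qed.

(** The quotient |Qz|^2 / (|mz|^2 (1 - |z|^2)) is invariant under the group and equals |xi|^2 / (1 -
    |xi|^2) at xi. *)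
Lemma tube_equation A lam U xi : shaped eta A lam U -> P U = 0 -> P xi = xi ->
  CH xi -> (1 - tau ^+ 2) * dotE (Qz eta P (ball_action A xi)) (Qz eta P (ball_action A xi))
    = tau ^+ 2 * normsq (mz eta (ball_action A xi)) *
      (1 - dotE (ball_action A xi) (ball_action A xi)) <-> dotE xi xi = tau ^+ 2.
Proof.
move=> As PU Pxi xiB.
have lam0 : lam != 0 by case: As => _ l0 _ _ _; rewrite gt_eqF.
have Au := shaped_unitary As.
rewrite (one_sub_norm_action eta1 P_sym P_eta P_Jeta As Pxi xiB).
rewrite (Qz_perp eta1 P_sym P_eta P_Jeta As PU Pxi xiB) dotEZl dotEZr.
have := mz_neq0 eta1 (ball_action_CH Au xiB); rewrite -normsq_gt0.
move: (normsq _) (dotE xi xi) => m d m0; have {}m0 := lt0r_neq0 m0.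
split=> [e|->]; last by field.
have k0 : m * m / (lam * lam) != 0 by rewrite mulf_neq0 ?mulf_neq0 ?invr_eq0 ?mulf_neq0.
apply: (mulfI k0); apply/eqP; rewrite -subr_eq0; apply/eqP.
have -> : m * m / (lam * lam) * d - m * m / (lam * lam) * tau ^+ 2 =
  (1 - tau ^+ 2) * (m / lam * (m / lam * d)) -
  tau ^+ 2 * m * ((1 - d) * m / lam ^+ 2) by field.
by rewrite e subrr.
Qed.

Lemma tube_eqP q : tube CH bergman W r q <->
  CH q /\ (1 - tau ^+ 2) * dotE (Qz eta P q) (Qz eta P q) =
          tau ^+ 2 * normsq (mz eta q) * (1 - dotE q q).
Proof.
split=> [/tubeP [A [xi [As Pxi xi1 ->]]]|[qB]].
  have xiB := CH_tau xi1; split; first exact: ball_action_CH (solv_unitary As) xiB.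
  by have [lam [U [As' PU]]] := As; apply/(tube_equation As' PU Pxi xiB).
have [A [xi [As Pxi xiB ->]]] := W_trans qB; have [lam [U [As' PU]]] := As.
by move=> /(tube_equation As' PU Pxi xiB) xi1; apply/tubeP; exists A, xi.
Qed.

(** In particular the normal at a point does not depend on the geodesic that reaches it: the
    relation [tube_normal] is the graph of a function. *)
Lemma tube_normal_fieldP q N : tube_normal CH bergman W r q N <->
  tube CH bergman W r q /\ N = normal_field eta P kap q.
Proof.
split=> [/tube_normalP[A [xi [As Pxi xi1 -> ->]]]|[/tubeP[A [xi [As Pxi xi1 ->]]] ->]];
  have [lam [U [As' PU]]] := As.
  split; first by apply/tubeP; exists A, xi.
  by rewrite (normal_fieldE eta1 P_sym P_eta P_Jeta As' PU Pxi (CH_tau xi1)).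
apply/tube_normalP; exists A, xi; split=> //.
by rewrite (normal_fieldE eta1 P_sym P_eta P_Jeta As' PU Pxi (CH_tau xi1)).
Qed.

Local Notation nu := (tube_normal CH bergman W r).

Lemma tube_CH q : tube CH bergman W r q -> CH q.
Proof. by case/tube_eqP. Qed.

Lemma tube_normal_action A q N : solv A -> nu q N ->
  nu (ball_action A q) (dball_action A q N).
Proof.
move=> As /tube_normalP[B [xi [Bs Pxi xi1 -> ->]]]; have xiB := CH_tau xi1.
have Au := solv_unitary As; have Bu := solv_unitary Bs.
apply/tube_normalP; exists (A *m B), xi; split.
- exact: solvM.
- exact: Pxi.
- exact: xi1.
- by have [-> _] := ball_actionM Au Bu xiB.
- by rewrite (dball_actionM _ Au Bu xiB) dball_actionZ//; exact: ball_action_CH.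
Qed.

Lemma shape_operator_action A q X Y : solv A -> shape_operator bergman nu q X Y ->
  shape_operator bergman nu (ball_action A q) (dball_action A q X) (dball_action A q Y).
Proof.
move=> As [c [V [cN cq dc dV]]]; have Au := solv_unitary As.
have cB t : CH (c t) by have /tube_normal_fieldP[/tube_CH] := cN t.
exists (fun s => ball_action A (c s)), (fun s => dball_action A (c s) (V s)).
split.
- by move=> t; apply: tube_normal_action.
- by rewrite cq.
- by rewrite -cq; exact: is_derive_ball_action.
- by rewrite -cq -dball_actionN//; exact: is_covariant_derivative_ball_action.
Qed.

End Tube.

(** * The shape operator of a tube *)

Section ShapeOperator.
Context {R : realType} {n : nat}.
Local Notation E := 'rV[R]_(n + n).
Local Notation C := R[i].
Local Notation Mat := 'M[C]_(1 + n).
Variable eta : E.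
Hypothesis eta1 : dotE eta eta = 1.
Variable P : {linear E -> E}.
Hypotheses (PK : forall X, P (P X) = P X)
  (P_sym : forall X Y, dotE (P X) Y = dotE X (P Y))
  (P_eta : P eta = 0) (P_Jeta : P (Jmap eta) = 0).
Variable W : set E.
Hypothesis W_P : forall z, W z <-> CH z /\ Qz eta P z = 0.
Hypothesis W_trans : forall z, CH z -> exists A xi,
  [/\ solv eta P A, P xi = xi, CH xi & z = ball_action A xi].
Variable r : R.
Hypothesis r_gt0 : 0 < r.
Local Notation t0 := (tau r).
Local Notation k0 := (kap r).
Variable xi : E.
Hypotheses (Pxi : P xi = xi) (xi1 : dotE xi xi = t0 ^+ 2).
Implicit Types (X Y : E).

Let he : hE xi eta = 0. Proof. exact: (P_perp P_sym P_eta P_Jeta Pxi). Qed.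

Let xiB : CH xi. Proof. exact: CH_tau xi1. Qed.

Definition tangF : E := P (Jmap xi).
Definition tangG : E := locked_with action_key (Jmap xi - tangF).

Lemma tangGE : tangG = Jmap xi - tangF. Proof. exact: locked_withE. Qed.

(* The shape operator of the tube at xi, extended linearly to the whole
   space. *)
Definition shape_map X : E :=
  let a := dotE X (Jmap eta) in
  let d := dotE X tangG + a * dotE tangG tangG in
  k0 *: (P X - a *: tangG - d *: Jmap eta
    + (d + dotE X (Jmap xi) / (1 - t0 ^+ 2)) *: Jmap xi
    + (t0 ^+ 2 / (1 - t0 ^+ 2)) *: X).

Section AlongCurve.
Variables (c : R -> E) (X : E).
Hypotheses (c0 : c 0 = xi) (dc : is_derive (0 : R) 1 c X).

Let a : C := hE X eta.

Lemma cderive_mz : cderive (fun s => mz eta (c s)) 0 (- a).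
Proof.
apply: (cderive_ext (fun s => esym (mzE eta (c s)))).
apply: cderive_eq (cderiveB (cderive_cst 1 0) (cderive_hE dc (is_derive_cstE eta 0))) _.
by rewrite hE0r addr0 sub0r.
Qed.

Lemma mz_c0 : mz eta (c 0) = 1. Proof. by rewrite c0 mz_perp. Qed.

Lemma Qz_c0 : Qz eta P (c 0) = xi.
Proof. by rewrite Qz_def mz_c0 rmorph1 cscale1 c0. Qed.

Lemma is_derive_Qz :
  is_derive (0 : R) 1 (fun s => Qz eta P (c s)) (P (X - cscale a^* xi)).
Proof.
apply: (is_derive_ext (fun s => esym (Qz_def eta P (c s)))).
apply: is_derive_eq (is_derive_linear P
  (is_derive_cscale (cderive_conj cderive_mz) dc)) _.
by rewrite mz_c0 rmorph1 cscale1 c0 cjN cscaleN addrC.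
Qed.

Lemma is_derive_vz :
  is_derive (0 : R) 1 (fun s => vz eta (c s)) (X - cscale a eta).
Proof.
apply: (is_derive_ext (fun s => esym (vzE eta (c s)))).
apply: is_derive_eq (is_deriveBf dc (is_derive_cscale
  (cderive_hE dc (is_derive_cstE eta 0)) (is_derive_cstE eta 0))) _.
by rewrite hE0r addr0 cscaler0 addr0.
Qed.

(** At xi one has mz = 1 and vz = Qz = xi, so conj (mz) vz - Qz vanishes there and only its
    derivative y - P y enters. *)
Lemma is_derive_normal_field :
  let y := X - cscale a eta - cscale a^* xi in
  is_derive (0 : R) 1 (fun s => normal_field eta P k0 (c s))
    (- k0 *: (cscale a^* xi + P y + cscale (hE xi (y - P y)) (eta - xi))).
Proof.
move=> y.
have m1 : (mz eta (c 0))^* = 1 by rewrite mz_c0 rmorph1.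
have m10 : (mz eta (c 0))^* != 0 by rewrite m1 oner_neq0.
have mm10 : mz eta (c 0) * (mz eta (c 0))^* != 0 by rewrite m1 mz_c0 mulr1 oner_neq0.
have dmc := cderive_conj cderive_mz.
have dR := is_deriveBf (is_derive_cscale dmc is_derive_vz) is_derive_Qz.
have dH := cderiveM (cderive_hE is_derive_Qz dR)
  (cderiveV (cderiveM cderive_mz dmc) mm10).
have dT := is_derive_cscale (cderiveV dmc m10) (is_deriveDf is_derive_Qz
  (is_derive_cscale dH (is_deriveBf (is_derive_cstE eta 0) dc))).
have dN := is_deriveZf (is_derive_cstR (- k0) 0) dT.
apply: (is_derive_ext (f := fun s => - k0 *: cscale (mz eta (c s))^*^-1
  (Qz eta P (c s) + cscale
    (hE (Qz eta P (c s)) (cscale (mz eta (c s))^* (vz eta (c s)) - Qz eta P (c s)) *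
      (mz eta (c s) * (mz eta (c s))^*)^-1) (eta - c s)))).
  by move=> s; rewrite normsqE.
apply: is_derive_eq dN _.
rewrite scale0r add0r; congr (_ *: _).
have Py : P y = P (X - cscale a^* xi).
  by rewrite /y addrAC linearB /= (P_cscale_eta P_eta P_Jeta) subr0.
rewrite -Py m1 mz_c0 Qz_c0 c0 (vz_perp he).
rewrite !(invr1, cscale1) subrr !hE0r !mul0r !cscale0 !addr0 !add0r.
rewrite expr1n mul1r !divr1 cjN opprK cscaleN.
rewrite (_ : - cscale a^* xi + (X - cscale a eta) = y); last first.
  by rewrite addrC.
by rewrite addrA.
Qed.

Lemma normal_field_base : normal_field eta P k0 (c 0) = - k0 *: xi.
Proof.
rewrite /normal_field mz_c0 Qz_c0 c0 (vz_perp he) rmorph1 invr1 !cscale1 subrr.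
by rewrite hE0r mul0r cscale0 addr0.
Qed.

Hypothesis Xxi : dotE X xi = 0.

(** For X orthogonal to xi the number h(X, xi) is imaginary, and the Christoffel term of X and - kap
    xi contributes exactly the terms of [shape_map] with denominator 1 - tau^2. The other terms come
    from [is_derive_normal_field]. *)
Lemma covariant_derivative_normal_field :
  is_covariant_derivative bergman c (fun s => normal_field eta P k0 (c s)) 0
    (- shape_map X).
Proof.
have cB : CH (c 0) by rewrite c0.
apply/is_covariant_derivative_bergmanP; first exact: cB.
do 2 eexists; split; [exact: dc|exact: is_derive_normal_field|].
rewrite normal_field_base c0 /christoffel xi1.
have N0 : 1 - t0 ^+ 2 != 0 by rewrite subr_eq0 eq_sym lt_eqF// tau_lt1.
set y := _ - cscale a^* xi.
have aE : a = dotE X eta +i* dotE X (Jmap eta) by [].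
have xe : dotE xi eta = 0 by have := congr1 (@complex.Re R) he.
have xJe : dotE xi (Jmap eta) = 0 by have := congr1 (@complex.Im R) he.
have hX : hE X xi = 0 +i* dotE X (Jmap xi) by rewrite /hE Xxi.
have yE : y = X - dotE X eta *: eta - dotE X (Jmap eta) *: Jmap eta
    - dotE X eta *: xi + dotE X (Jmap eta) *: Jmap xi.
  rewrite /y aE !cscaleE Reconj Imconj /= scaleNr.
  by apply/rowP => j; rewrite !mxE; ring.
have PyE : P y = P X - dotE X eta *: xi + dotE X (Jmap eta) *: tangF.
  have P4 (x u v w z : E) (b d : R) : P (x - b *: u - d *: v - b *: w + d *: z) =
      P x - b *: P u - d *: P v - b *: P w + d *: P z.
    by rewrite linearD !linearB !linearZ.
  by rewrite yE P4 P_eta P_Jeta Pxi !scaler0 !subr0.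
(* The real part vanishes because P xi = xi; the imaginary part is minus the coefficient d of
   [shape_map]. *)
have hy : hE xi (y - P y) =
    0 +i* - (dotE X tangG + dotE X (Jmap eta) * dotE tangG tangG).
  apply: complexP => /=.
    by rewrite dotEDr dotENr -P_sym Pxi subrr.
  rewrite PyE yE.
  have PG : P tangG = 0 by rewrite tangGE linearB /= PK subrr.
  have GJ Z : dotE tangG Z = dotE (Jmap xi) (Z - P Z).
    by rewrite tangGE dotEDl dotENl /tangF P_sym dotEDr dotENr.
  have GG : dotE tangG tangG = dotE (Jmap xi) tangG by rewrite GJ PG subr0.
  have XG : dotE X tangG = dotE (Jmap xi) (X - P X) by rewrite dotEC GJ.
  rewrite GG XG -[LHS]opprK -dotEJl; congr (- _).
  have Je : dotE (Jmap xi) eta = 0 by rewrite dotEJl xJe oppr0.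
  have JJe : dotE (Jmap xi) (Jmap eta) = 0 by rewrite dotEJJ.
  by rewrite tangGE !dotE_lin Je JJe; ring.
rewrite /shape_map hX hy PyE aE hEZl hExx xi1.
have -> : (- k0)%:C * (t0 ^+ 2)%:C = (- k0 * t0 ^+ 2)%:C :> C by exact: esym (rcM _ _).
have -> : ((dotE X eta +i* dotE X (Jmap eta))^* : C) =
    dotE X eta +i* - dotE X (Jmap eta).
  by apply: complexP; rewrite ?Reconj ?Imconj.
rewrite !cscaleE /=.
move: (dotE X _) (dotE X _) (dotE X _) (dotE X _) (dotE tangG tangG) N0.
move=> b0 b1 b2 b3 b4; rewrite JmapD JmapN JmapZ.
rewrite tangGE; move: (Jmap xi) (Jmap eta) (Jmap X) tangF (P X) (1 - t0 ^+ 2).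
move=> jx je jX f p N N0; apply/rowP => j; rewrite !mxE; by field.
Qed.

(** The derivative at xi of the equation in [tube_eqP] is 2 <X, xi>: the contributions of <X, eta>
    cancel. *)
Lemma tube_tangent : (forall t, tube CH bergman W r (c t)) -> dotE X xi = 0.
Proof.
move=> cT.
pose F s := (1 - t0 ^+ 2) * dotE (Qz eta P (c s)) (Qz eta P (c s)) -
  t0 ^+ 2 * normsq (mz eta (c s)) * (1 - dotE (c s) (c s)).
have TP := tube_eqP eta1 PK P_sym P_eta P_Jeta W_P W_trans r_gt0.
have F0 : F = fun=> 0.
  by apply/funext => s; have /TP[_] := cT s; rewrite /F => ->; rewrite subrr.
have [dm1 dm2] := cderive_mz.
have dnn : is_derive (0 : R) 1 (fun s => normsq (mz eta (c s)))
    (- (2 * dotE X eta)).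
  apply: (is_derive_ext (fun s => esym (normsq_ReIm (mz eta (c s))))).
  apply: is_derive_eq (is_deriveDf (is_deriveMf dm1 dm1) (is_deriveMf dm2 dm2)) _.
  by rewrite mz_c0 /=; ring.
have dF := is_deriveBf
  (is_deriveMf (is_derive_cstR (1 - t0 ^+ 2) 0) (is_derive_dotE is_derive_Qz is_derive_Qz))
  (is_deriveMf (is_deriveMf (is_derive_cstR (t0 ^+ 2) 0) dnn)
     (is_deriveBf (is_derive_cstR 1 0) (is_derive_dotE dc dc))).
have dF0 : is_derive (0 : R) 1 F (0 : R) by rewrite F0; exact: is_derive_cstR.
have := is_derive_unique dF dF0.
rewrite Qz_c0 mz_c0 c0 normsq1 xi1 (dotEC xi (P _)) (dotEC xi X) P_sym Pxi dotEDl dotENl.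
have -> : dotE (cscale a^* xi) xi = dotE X eta * t0 ^+ 2.
  by rewrite cscaleE Reconj /= !dotE_lin dotEJl dotExJx xi1; ring.
by move=> e; lra.
Qed.

End AlongCurve.

(** In the Siegel coordinates v = vz / mz and zeta = 2 / mz - 1 the tube is the graph Re zeta =
    |v|^2 + ((1 - tau^2) / tau^2) |P v|^2. The curve moves (v, Im zeta) along a straight line and is
    carried back to the ball. *)
Lemma tube_curve X : dotE X xi = 0 ->
  exists c : R -> E, [/\ forall t, tube CH bergman W r (c t), c 0 = xi &
    is_derive (0 : R) 1 c X].
Proof.
move=> Xxi.
have TP := tube_eqP eta1 PK P_sym P_eta P_Jeta W_P W_trans r_gt0.
have t00 := lt0r_neq0 (tau_gt0 r_gt0).
have xe : dotE xi eta = 0 by have := congr1 (@complex.Re R) he.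
(* Y and 2 a are the derivatives of vz / mz and of 2 / mz - 1 at xi in the direction X. *)
pose a := hE X eta; pose Y := X - cscale a eta + cscale a xi.
pose v (s : R) := xi + s *: Y.
have dv : is_derive (0 : R) 1 v Y by exact: is_derive_affine.
have Ye : hE Y eta = 0 by rewrite !hE_lin (hE_eta eta1) he mulr1 mulr0 addr0 subrr.
have ve s : hE (v s) eta = 0 by rewrite hEDl hEZl he Ye mulr0 addr0.
pose rho (s : R) := dotE (v s) (v s) + (1 - t0 ^+ 2) / t0 ^+ 2 * dotE (P (v s)) (P (v s)).
pose zeta (s : R) : C := rho s +i* (2 * complex.Im a * s).
have v0 : v 0 = xi by rewrite /v scale0r addr0.
have rho0 : rho 0 = 1 by rewrite /rho v0 Pxi xi1; field.
have N0 : 0 < 1 - t0 ^+ 2 by rewrite subr_gt0 tau_lt1.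
have rho_ge0 s : 0 <= rho s.
  rewrite addr_ge0 ?dotE_ge0// mulr_ge0 ?dotE_ge0// divr_ge0 ?sqr_ge0//.
  exact: ltW.
have zeta0 : zeta 0 = 1 by rewrite /zeta rho0 mulr0.
have z1 s : zeta s + 1 != 0.
  apply/negP => /eqP/(congr1 (@complex.Re R)); rewrite ReD /=.
  by have := rho_ge0 s; move: (rho s) => x; lra.
have drho : is_derive (0 : R) 1 rho (2 * dotE X eta).
  have dP := is_derive_linear P dv.
  apply: is_derive_eq (is_deriveDf (is_derive_dotE dv dv) (is_deriveMf
    (is_derive_cstR ((1 - t0 ^+ 2) / t0 ^+ 2) 0) (is_derive_dotE dP dP))) _.
  rewrite v0 Pxi (dotEC xi (P Y)) P_sym Pxi (dotEC xi Y).
  have -> : dotE Y xi = dotE X eta * t0 ^+ 2.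
    have Je : dotE eta xi = 0 by rewrite dotEC.
    have JJ : dotE (Jmap eta) xi = 0.
      by rewrite dotEC; have := congr1 (@complex.Im R) he.
    rewrite /Y /a !cscaleE /= !dotE_lin Xxi Je JJ (dotEJl xi) dotExJx xi1; ring.
  by field.
have dzeta : cderive zeta 0 (2 * a).
  split; rewrite ?ReM ?ImM /=.
    by apply: is_derive_eq drho _; ring.
  apply: is_derive_eq (is_deriveMf (is_derive_cstR (2 * complex.Im a) 0)
    (is_derive_idR 0)) _.
  by rewrite /a /=; ring.
pose c (s : R) := cscale (zeta s + 1)^-1 (2 *: v s + cscale (zeta s - 1) eta).
have dc : is_derive (0 : R) 1 c X.
  have dz1 := cderiveD dzeta (cderive_cst 1 0).
  have dz2 := cderiveB dzeta (cderive_cst 1 0).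
  apply: is_derive_eq (is_derive_cscale (cderiveV dz1 (z1 0))
    (is_deriveDf (is_deriveZf (is_derive_cstR 2 0) dv)
      (is_derive_cscale dz2 (is_derive_cstE eta 0)))) _.
  rewrite zeta0 v0 subrr cscale0 scale0r cscaler0 !addr0 subr0 add0r.
  rewrite -!(cscale_real 2) !cscaleDr !cscaleA rc_nat.
  have -> : - (2 * a) / (1 + 1) ^+ 2 * 2 = - a by field.
  have -> : (1 + 1)^-1 * 2 = 1 :> C by field.
  have -> : (1 + 1)^-1 * (2 * a) = a by field.
  rewrite !cscale1 mul1r cscaleN; move: (cscale a xi) (cscale a eta) => x y.
  by apply/rowP => j; rewrite !mxE; ring.
have c0 : c 0 = xi.
  rewrite /c zeta0 v0 subrr cscale0 addr0 -(cscale_real 2) cscaleA rc_nat.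
  have -> : (1 + 1)^-1 * 2 = 1 :> C by field.
  by rewrite cscale1.
have mc s : mz eta (c s) = 2 / (zeta s + 1).
  rewrite mzE /c hEcl hEDl hEZl hEcl ve (hE_eta eta1).
  by have := z1 s; move: (zeta s) => z zn; field.
have vc s : vz eta (c s) = cscale (2 / (zeta s + 1)) (v s).
  rewrite vzE /c hEcl hEDl hEZl hEcl ve (hE_eta eta1) -(cscale_real 2) rc_nat.
  rewrite cscaleDr !cscaleA mulr0 add0r mulr1 addrK.
  by rewrite mulrC.
have nc s : 1 - dotE (c s) (c s) = normsq (2 / (zeta s + 1)) * (rho s - dotE (v s) (v s)).
  rewrite (norm_vz eta1) mc vc.
  have mz1 : 2 / (zeta s + 1) * (zeta s + 1) = 2 by rewrite mulfVK.
  move: (2 / (zeta s + 1)) mz1 => m mz1.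
  have -> : dotE (cscale m (v s)) (cscale m (v s)) = normsq m * dotE (v s) (v s).
    by apply: complexI; rewrite -hExx hEcl hEcr hExx mulrA normsqE rcM.
  have h2 : (normsq m)%:C * (zeta s + 1) = 2 * m^*.
    by rewrite -normsqE mulrAC mz1.
  have := congr1 (@complex.Re R) h2; rewrite !ReM ReD Reconj.
  have -> : complex.Re (zeta s) = rho s by [].
  have -> : complex.Re (normsq m)%:C = normsq m by [].
  have -> : complex.Im (normsq m)%:C = 0 by [].
  have -> : complex.Re (1 : C) = 1 by [].
  have -> : complex.Im (2 : C) = 0 by rewrite -(rc_nat 2).
  have -> : complex.Re (2 : C) = 2 by rewrite -(rc_nat 2).
  by move: (normsq m) (complex.Re m) (dotE _ _) (rho s) => x y d q e; lra.
have cT s : CH (c s) -> tube CH bergman W r (c s).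
  move=> cB; apply/TP; split=> //.
  rewrite (QzE P_eta P_Jeta) vc nc mc cscaleA.
  move: (2 / (zeta s + 1)) => m; rewrite (mulrC m^* m) normsqE cscale_real.
  have -> : P (normsq m *: v s) = normsq m *: P (v s) by rewrite linearZ.
  rewrite dotEZl dotEZr /rho; move: (normsq m) (dotE (v s) _) (dotE (P _) _).
  by move=> x y q; field.
(* Values outside the ball are replaced by xi, so that the curve stays on the tube for all times. *)
exists (fun s => if `[< CH (c s) >] then c s else xi); split.
- move=> s; case: asboolP => [/cT//|_].
  by rewrite -c0; apply: cT; rewrite c0.
- by case: asboolP => _.
apply: (near_eq_is_derive _ dc).
have := near_CH dc; rewrite c0 => /(_ xiB); apply: filterS => s.
by case: asboolP.
Qed.

(** The field along a curve of the tube is forced to be [normal_field], so the relation is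
    single-valued; [tube_curve] provides a curve for every X orthogonal to xi. *)
Lemma shape_operatorP X Y :
  shape_operator bergman (tube_normal CH bergman W r) xi X Y <->
  dotE X xi = 0 /\ Y = shape_map X.
Proof.
have NP := tube_normal_fieldP eta1 PK P_sym P_eta P_Jeta W_P W_trans r_gt0.
split.
  move=> [c [V [cN c0 dc dV]]].
  have VE : V = fun s => normal_field eta P k0 (c s).
    by apply/funext => s; have /NP[] := cN s.
  have Xxi : dotE X xi = 0.
    by apply: (tube_tangent c0 dc) => t; have /NP[] := cN t.
  split=> //.
  have cB : CH (c 0) by rewrite c0.
  have /(is_covariant_derivative_bergmanP _ _ cB) [c' [V' [dc' dV' YE]]] := dV.
  have /(is_covariant_derivative_bergmanP _ _ cB) [c2 [V2 [dc2 dV2 YE2]]] :=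
    covariant_derivative_normal_field c0 dc Xxi.
  apply: oppr_inj; rewrite YE YE2 VE; rewrite VE in dV'.
  by rewrite (is_derive_unique dc' dc2) (is_derive_unique dV' dV2).
move=> [Xxi ->]; have [c [cT c0 dc]] := tube_curve Xxi.
exists c, (fun s => normal_field eta P k0 (c s)); split=> //.
  by move=> t; apply/NP.
exact: covariant_derivative_normal_field.
Qed.

End ShapeOperator.

(** * Linear algebra *)

Section LinearAlgebra.
Context {R : realType} {m : nat}.
Local Notation E := 'rV[R]_m.
Implicit Types (S : set E) (X Y : E).

Definition linear_set S :=
  [/\ S 0, forall X Y, S X -> S Y -> S (X + Y) & forall (a : R) X, S X -> S (a *: X)].

(** A matrix of maximal rank with row space in S spans S: a vector of S outside the row space would
    raise the rank. *)
Lemma linear_set_has_dim S : linear_set S -> exists k, has_dim S k.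
Proof.
move=> [S0 SD SZ].
pose p k := `[< exists B : 'M[R]_m, \rank B = k /\ forall v : E, (v <= B)%MS -> S v >].
have p0 : p 0%N.
  apply/asboolP; exists 0; split; first exact: mxrank0.
  by move=> v; rewrite submx0 => /eqP ->.
have pm k : p k -> (k <= m)%N by move=> /asboolP [B [<- _]]; exact: rank_leq_row.
have [k /asboolP [B [rB BS]] kmax] := ex_maxnP (ex_intro _ 0%N p0) pm.
exists (\rank B), (row_base B); first exact: row_base_free.
apply/seteqP; split=> v; rewrite /mkset eq_row_base; last exact: BS.
move=> Sv; have : p (\rank (B + v)%MS).
  apply/asboolP; exists (B + v)%MS; split=> // u /sub_addsmxP [[a b]] /= ->.
  apply: SD; first by apply: BS; exact: submxMl.
  by rewrite [b]mx11_scalar mul_scalar_mx; exact: SZ.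
move=> /kmax; rewrite -rB => le.
have e : (B == B + v)%MS by rewrite -(geq_leqif (mxrank_leqif_eq (addsmxSl B v))).
by rewrite (eqmxP e) addsmxSr.
Qed.

Lemma linear_mx (T : E -> E) : linear T -> exists M : 'M[R]_m, forall X, T X = X *m M.
Proof.
move=> T_lin; pose Tl : {linear E -> E} := HB.pack T (GRing.isLinear.Build R E E *:%R T T_lin).
by exists (lin1_mx Tl) => X; rewrite mul_rV_lin1.
Qed.

Lemma has_dim_transport S1 S2 (T T' : E -> E) k : linear T -> linear T' ->
  (forall X, T' (T X) = X) -> (forall X, T (T' X) = X) ->
  (forall X, S1 X -> S2 (T X)) -> (forall X, S2 X -> S1 (T' X)) ->
  has_dim S1 k -> has_dim S2 k.
Proof.
move=> /linear_mx[M TE] /linear_mx[M' TE'] TK TK' S12 S21 [B Bf BE].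
have MM' : M *m M' = 1%:M.
  by apply/row_matrixP => i; rewrite !rowE mulmxA -TE -TE' TK mulmx1.
have Mf : row_free M by apply/row_freeP; exists M'.
exists (B *m M); first by rewrite /row_free mxrankMfree.
apply/seteqP; split=> v; rewrite /mkset.
  by move/S21; rewrite BE /= => h; rewrite -(TK' v) TE; exact: submxMr.
move/submxP => [D ->]; rewrite mulmxA -TE; apply: S12.
by rewrite BE /= submxMl.
Qed.

Lemma has_dim_neq0 S k X : has_dim S k -> S X -> X != 0 -> (0 < k)%N.
Proof.
move=> [B _ ->] /submxP[D ->]; case: k B D => [B D|//].
by rewrite (flatmx0 B) mulmx0 eqxx.
Qed.

Lemma has_dim_gt0 S k : has_dim S k -> (0 < k)%N -> exists2 X, S X & X != 0.
Proof.
case: k => // k [B Bf ->] _; exists (row ord0 B); first exact: row_sub.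
apply: contraL Bf => /eqP r0; rewrite -kermx_eq0; apply/rowV0Pn.
exists (delta_mx 0 ord0).
  by apply/sub_kermxP; rewrite -rowE.
by apply/eqP => /matrixP/(_ 0 ord0)/eqP; rewrite !mxE !eqxx oner_eq0.
Qed.

End LinearAlgebra.

(** * Orthogonal projections and reflections *)

Section Projection.
Context {R : realType} {n : nat}.
Local Notation E := 'rV[R]_(n + n).

Lemma dotE_mx (x y : E) : dotE x y = (x *m y^T) 0 0.
Proof. by rewrite mxE; apply: eq_bigr => j _; rewrite mxE. Qed.

(** With the rows of B a basis of S, the projection is right multiplication by B^T G^-1 B for the
    Gram matrix G = B B^T, which is invertible since u G = 0 gives |u B|^2 = 0. *)
Lemma orthogonal_projection (S : set E) : linear_set S -> exists P : {linear E -> E},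
  [/\ forall X, P (P X) = P X, forall X Y, dotE (P X) Y = dotE X (P Y),
      forall X, S (P X) & forall X, S X -> P X = X].
Proof.
move=> /linear_set_has_dim [k [B Bf BE]].
pose G := B *m B^T.
have Gu : G \in unitmx.
  rewrite -row_free_unit -kermx_eq0; apply/eqP/row_matrixP => i.
  rewrite row0; apply/eqP; have : (row i (kermx G) <= kermx G)%MS by exact: row_sub.
  move=> /sub_kermxP; move: (row i _) => u uG.
  have : dotE (u *m B) (u *m B) = 0.
    by rewrite dotE_mx trmx_mul mulmxA -(mulmxA u) -/G uG mul0mx mxE.
  move/eqP; rewrite dotE_eq0 => /eqP uB.
  by move: Bf; rewrite -kermx_eq0 => /eqP K; rewrite -submx0 -K; apply/sub_kermxP.
pose M := B^T *m invmx G *m B.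
have MM : M *m M = M.
  by rewrite /M !mulmxA -(mulmxA _ B B^T) -/G -(mulmxA _ _ G) mulVmx// mulmx1.
have GT : G^T = G by rewrite /G trmx_mul trmxK.
have MT : M^T = M by rewrite /M !trmx_mul trmxK trmx_inv GT mulmxA.
have ML : linear (fun x : E => x *m M).
  by move=> a x y; rewrite mulmxDl -scalemxAl.
pose Pl : {linear E -> E} := HB.pack (fun x : E => x *m M)
  (GRing.isLinear.Build R E E *:%R _ ML).
exists Pl; split => /=.
- by move=> X; rewrite -mulmxA MM.
- by move=> X Y; rewrite !dotE_mx trmx_mul MT (mulmxA X M).
- by move=> X; rewrite BE /= /M !mulmxA; exact: submxMl.
- move=> X; rewrite BE /= => /submxP[D ->].
  by rewrite /M !mulmxA -(mulmxA D) -/G mulmxK.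
Qed.

(** For v = 0 this is the identity, so [reflection_swap] also covers X = Y. *)
Definition reflection (v X : E) : E := X - (2 * dotE X v / dotE v v) *: v.

Lemma reflection_linear v : linear (reflection v).
Proof.
move=> a X Y; rewrite /reflection dotEDl dotEZl; move: (dotE _ v) (dotE Y v) (dotE v v).
by move=> b c d; apply/rowP => j; rewrite !mxE; ring.
Qed.

Lemma reflection_dot v X Y : dotE (reflection v X) (reflection v Y) = dotE X Y.
Proof.
have [->|v0] := eqVneq v 0; first by rewrite /reflection !scaler0 !subr0.
have nv : dotE v v != 0 by rewrite dotE_eq0.
by rewrite /reflection !dotE_lin (dotEC v Y); field.
Qed.

Lemma reflectionK v X : reflection v (reflection v X) = X.
Proof.
have [->|v0] := eqVneq v 0; first by rewrite /reflection !scaler0 !subr0.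
have nv : dotE v v != 0 by rewrite dotE_eq0.
rewrite /reflection !dotE_lin; move: (dotE X v) (dotE v v) nv => a b nv.
by apply/rowP => j; rewrite !mxE; field.
Qed.

Lemma reflection_id v X : dotE X v = 0 -> reflection v X = X.
Proof. by move=> e; rewrite /reflection e mulr0 mul0r scale0r subr0. Qed.

Lemma reflection_swap X Y : dotE X X = dotE Y Y -> reflection (X - Y) X = Y.
Proof.
move=> XY; have [e|v0] := eqVneq (X - Y) 0.
  by rewrite e /reflection scaler0 subr0; apply/eqP; rewrite -subr_eq0 e.
have nv : dotE (X - Y) (X - Y) != 0 by rewrite dotE_eq0.
have e : dotE (X - Y) (X - Y) = 2 * dotE X (X - Y).
  by rewrite !dotE_lin (dotEC Y X) -XY; ring.
rewrite /reflection -e divff// scale1r opprB addrCA subrr addr0 //.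
Qed.

End Projection.

(** * Principal curvatures *)

Section PrincipalCurvatures.
Context {R : realType} {n : nat}.
Local Notation E := 'rV[R]_(n + n).
Variable eta : E.
Hypothesis eta1 : dotE eta eta = 1.
Variable P : {linear E -> E}.
Hypotheses (PK : forall X, P (P X) = P X)
  (P_sym : forall X Y, dotE (P X) Y = dotE X (P Y))
  (P_eta : P eta = 0) (P_Jeta : P (Jmap eta) = 0).
Variable r : R.
Hypothesis r_gt0 : 0 < r.
Local Notation t0 := (tau r).
Local Notation k0 := (kap r).
Local Notation F := (tangF P).
Local Notation G := (tangG P).
Local Notation Je := (Jmap eta).
Local Notation shape := (shape_map eta P r).
Implicit Types (X Y xi : E) (y : R).

Let u : R := (1 - t0 ^+ 2)^-1.

Let N0 : 0 < 1 - t0 ^+ 2. Proof. by rewrite subr_gt0 tau_lt1. Qed.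

Let u_gt1 : 1 < u.
Proof. by rewrite invf_gt1 // ltrBlDr ltrDl exprn_gt0// tau_gt0. Qed.

Let k00 : k0 != 0.
Proof. by rewrite mulf_neq0 ?gt_eqF// invr_gt0 mulr_gt0// tau_gt0. Qed.

Section Frame.
Variable xi : E.
Hypotheses (Pxi : P xi = xi) (xi1 : dotE xi xi = t0 ^+ 2).

Lemma JE : Jmap xi = F xi + G xi. Proof. by rewrite tangGE addrC subrK. Qed.

Lemma PF : P (F xi) = F xi. Proof. exact: PK. Qed.

Lemma PG : P (G xi) = 0. Proof. by rewrite tangGE linearB /= PK subrr. Qed.

Lemma dot_im_ker X Y : P X = X -> P Y = 0 -> dotE X Y = 0.
Proof. by move=> PX PY; rewrite -PX P_sym PY dotE0r. Qed.

Lemma dot_xi_Jeta : dotE xi Je = 0. Proof. exact: dot_im_ker. Qed.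

Lemma dot_xi_eta : dotE xi eta = 0. Proof. exact: dot_im_ker. Qed.

Lemma dot_FG : dotE (F xi) (G xi) = 0. Proof. exact: dot_im_ker PF PG. Qed.

Lemma dot_FJ : dotE (F xi) Je = 0. Proof. exact: dot_im_ker PF P_Jeta. Qed.

Lemma dot_GJ : dotE (G xi) Je = 0.
Proof. by rewrite tangGE dotEDl dotENl dot_FJ dotEJJ dot_xi_eta subrr. Qed.

Lemma dot_Fxi : dotE (F xi) xi = 0.
Proof. by rewrite P_sym Pxi dotEC dotExJx. Qed.

Lemma dot_Gxi : dotE (G xi) xi = 0.
Proof. by rewrite dotEC; exact: dot_im_ker Pxi PG. Qed.

Lemma dot_FFGG : dotE (F xi) (F xi) = t0 ^+ 2 - dotE (G xi) (G xi).
Proof.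
rewrite -xi1 -(dotEJJ xi xi) JE; have := dot_FG; move: (F xi) (G xi) => f g fg.
by rewrite !dotE_lin (dotEC g f) fg; ring.
Qed.

(** [shape_map] divided by kap and freed from its scalar part tau^2 u, see [shape_eigenP]. *)
Definition shape_aux X : E :=
  let a := dotE X Je in
  let d := dotE X (G xi) + a * dotE (G xi) (G xi) in
  P X - a *: G xi - d *: Je + (d + u * dotE X (Jmap xi)) *: Jmap xi.

Lemma shape_eigenP X y :
  shape xi X = (k0 * (t0 ^+ 2 * u + y)) *: X <-> shape_aux X = y *: X.
Proof.
have -> : shape xi X = k0 *: (shape_aux X + (t0 ^+ 2 * u) *: X).
  by rewrite /shape_map /shape_aux (mulrC u).
rewrite -(scalerA k0) addrC scalerDl; split; first by move=> /(scalerI k00) /addrI.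
by move=> ->.
Qed.

(* The polynomial whose roots y > 1 give the eigenvalues k0 (t0^2 u + y) that
   depend on the length of G xi. *)
Definition kahler_cubic y (g : R) : R := y ^+ 2 * (u - y) - u * g.

(** The span of J eta, F xi and G xi is invariant, and comparing coefficients in the eigenvector
    equation on it leaves the cubic as the single condition. *)
Lemma cubic_eigenvalue y : 1 < y -> dotE (G xi) (G xi) < t0 ^+ 2 ->
  kahler_cubic y (dotE (G xi) (G xi)) = 0 ->
  exists X, [/\ X != 0, dotE X xi = 0 & shape_aux X = y *: X].
Proof.
move=> y1 gt; set g := dotE (G xi) (G xi); rewrite /kahler_cubic => cub.
have y10 : y - 1 != 0 by rewrite subr_eq0 gt_eqF.
have g0 : 0 <= g by exact: dotE_ge0.
(* The coefficient - g of J eta is a normalisation. The J eta component of the equation then leads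
   to y + g at G xi, and the G xi and F xi components together lead to b at F xi. *)
pose b := y ^+ 2 / (y - 1) + g.
have b0 : 0 < b by rewrite ltr_wpDr// divr_gt0 ?subr_gt0// exprn_gt0// (lt_trans _ y1).
pose X := - g *: Je + b *: F xi + (y + g) *: G xi.
have XF : dotE X (F xi) = b * (t0 ^+ 2 - g).
  rewrite /X !dotE_lin (dotEC Je) dot_FJ (dotEC (G xi) (F xi)) dot_FG dot_FFGG -/g.
  by ring.
have Xx : dotE X xi = 0.
  by rewrite /X !dotE_lin dot_Fxi dot_Gxi (dotEC Je) dot_xi_Jeta !mulr0 !addr0.
have XJ : dotE X Je = - g.
  by rewrite /X !dotE_lin dot_FJ dot_GJ dotEJJ eta1; ring.
have XG : dotE X (G xi) = (y + g) * g.
  by rewrite /X !dotE_lin (dotEC Je) dot_GJ dot_FG -/g; ring.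
have PX : P X = b *: F xi.
  by rewrite /X !linearD !linearZ /= P_Jeta PF PG !scaler0 add0r addr0.
exists X; split=> //.
  (* Since b > 0 and |F xi|^2 = tau^2 - g > 0, the product <X, F xi> is not 0. *)
  apply/eqP => X0; move: XF; rewrite X0 dotE0l => /esym/eqP.
  by rewrite mulf_eq0 gt_eqF//= subr_eq0 gt_eqF.
rewrite /shape_aux PX XJ XG JE (dotEDr X) XF XG -/g /X.
move: (F xi) (G xi) Je => f0 g1 e0; apply/rowP => j; rewrite !mxE.
have uE : u * t0 ^+ 2 = u - 1.
  by rewrite /u; field; rewrite gt_eqF.
(* The remaining condition: the difference of the two sides is the cubic divided by y - 1. *)
have key : u * (b * (t0 ^+ 2 - g) + (y + g) * g) = y ^+ 2 - g.
  have -> : u * (b * (t0 ^+ 2 - g) + (y + g) * g) =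
     b * (u * t0 ^+ 2 - u * g) + u * (y + g) * g by ring.
  rewrite uE /b; apply/eqP; rewrite -subr_eq0; apply/eqP.
  transitivity ((y ^+ 2 * (u - y) - u * g) / (y - 1)).
    by field.
  by rewrite cub mul0r.
rewrite key /b; move: (f0 0 j) (g1 0 j) (e0 0 j) => f1 g2 e1.
by field.
Qed.

(** Pairing the equation with J eta, G xi and F xi gives three scalar equations in a, q and p. If a
    is nonzero, eliminating p and q leaves a times the cubic, up to a constant. If a = 0, then q =
    0. In that case p = 0 would make X an eigenvector of P with eigenvalue y > 1, which is
    impossible, and a nonzero p gives g = 0 and y = u, a root of the cubic. *)
Lemma eigenvalue_cubic y X : 1 < y -> X != 0 -> shape_aux X = y *: X ->
  kahler_cubic y (dotE (G xi) (G xi)) = 0.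
Proof.
move=> y1 X0 eX; set g := dotE (G xi) (G xi).
have y10 : y - 1 != 0 by rewrite subr_eq0 gt_eqF.
have y0 : y != 0 by rewrite gt_eqF// (lt_trans _ y1).
have g0 : 0 <= g by exact: dotE_ge0.
set a := dotE X Je; set p := dotE X (F xi); set q := dotE X (G xi).
pose d := q + a * g; pose e := d + u * (p + q).
have eE : P X - a *: G xi - d *: Je + e *: (F xi + G xi) = y *: X.
  by rewrite -eX /shape_aux JE dotEDr.
have dPJ : dotE (P X) Je = 0 by rewrite P_sym P_Jeta dotE0r.
have dPG : dotE (P X) (G xi) = 0 by rewrite P_sym PG dotE0r.
have dPF : dotE (P X) (F xi) = p by rewrite P_sym PF.
have hJ : - d = y * a.
  have := congr1 (dotE^~ Je) eE; rewrite !dotE_lin dPJ dot_GJ dot_FJ dotEJJ eta1.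
  by rewrite -/a => <-; ring.
have hG : g * (e - a) = y * q.
  have := congr1 (dotE^~ (G xi)) eE; rewrite !dotE_lin dPG (dotEC Je) dot_GJ dot_FG.
  by rewrite -/g -/q => <-; ring.
have hF : (y - 1) * p = e * (t0 ^+ 2 - g).
  have := congr1 (dotE^~ (F xi)) eE; rewrite !dotE_lin dPF (dotEC Je) dot_FJ.
  rewrite (dotEC (G xi) (F xi)) dot_FG dot_FFGG -/g -/p => h.
  by rewrite mulrBl mul1r -h; ring.
have uE : u * t0 ^+ 2 = u - 1.
  by rewrite /u; field; rewrite gt_eqF.
have qE : q = - (a * (y + g)).
  by move: hJ; rewrite /d => h; rewrite -[LHS](addrK (a * g)) -[q + _]opprK h; ring.
have dE : d = - (y * a) by rewrite -hJ opprK.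
have u0 : u != 0 by rewrite gt_eqF// (lt_trans _ u_gt1).
have [a0|a0] := eqVneq a 0; last first.
  apply: (mulfI a0); rewrite mulr0 /kahler_cubic -/g.
  have ge : g * e = a * g - a * y * (y + g).
    by move: hG; rewrite qE => h; rewrite -[LHS](subrK (g * a)) -mulrBr h; ring.
  have eE' : e = - (y * a) + u * (p - a * (y + g)) by rewrite /e dE qE.
  have : (y - 1) * (g * e) = (y - 1) * g * (- (y * a)) +
      u * (g * ((y - 1) * p)) - (y - 1) * g * u * (a * (y + g)).
    by rewrite {1}eE'; ring.
  rewrite hF.
  have -> : u * (g * (e * (t0 ^+ 2 - g))) = (g * e) * (u * t0 ^+ 2 - u * g) by ring.
  by rewrite uE ge => /eqP; rewrite -subr_eq0 => /eqP h; rewrite -[RHS]h; ring.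
have q0 : q = 0 by rewrite qE a0 mul0r oppr0.
have d0 : d = 0 by rewrite dE a0 mulr0 oppr0.
have eP : e = u * p by rewrite /e d0 q0 add0r addr0.
have [p0|p0] := eqVneq p 0.
  move: eE; rewrite a0 d0 eP p0 mulr0 !scale0r !subr0 addr0 => PX.
  have PXy : P X = y *: P X by rewrite -[LHS]PK {1}PX linearZ.
  have PX0 : P X = 0.
    apply/eqP; have : (y - 1) *: P X = 0 by rewrite scalerBl -PXy scale1r subrr.
    by move/eqP; rewrite scaler_eq0 (negPf y10).
  by move/eqP: PX; rewrite PX0 eq_sym scaler_eq0 (negPf y0) (negPf X0).
have g00 : g = 0.
  move: hG; rewrite a0 q0 subr0 mulr0 eP => /eqP.
  by rewrite !mulf_eq0 (negPf u0) (negPf p0) !orbF => /eqP.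
move: hF; rewrite g00 subr0 eP => h.
have yE : y - 1 = u * t0 ^+ 2.
  by apply: (mulIf p0); rewrite h; ring.
rewrite /kahler_cubic mulr0 subr0.
by move: yE; rewrite uE => /addIr <-; rewrite subrr mulr0.
Qed.

End Frame.

(** The cubic is u (tau^2 - g) > 0 at y = 1 and - u g <= 0 at y = u. *)
Lemma cubic_root (g : R) : 0 <= g -> g < t0 ^+ 2 ->
  exists2 y, 1 < y & kahler_cubic y g = 0.
Proof.
move=> g0 gt.
pose p : {poly R} := (u * g)%:P - 'X ^+ 2 * (u%:P - 'X).
have pE y : p.[y] = - kahler_cubic y g.
  by rewrite /p /kahler_cubic !hornerE /= opprB.
have uE : u * t0 ^+ 2 = u - 1.
  by rewrite /u; field; rewrite gt_eqF.
have u0 : 0 < u by exact: lt_trans u_gt1.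
have p1 : p.[1] < 0.
  rewrite pE /kahler_cubic expr1n mul1r -uE oppr_lt0 subr_gt0.
  by rewrite ltr_pM2l.
have pu : 0 <= p.[u].
  by rewrite pE /kahler_cubic subrr mulr0 sub0r opprK mulr_ge0// ltW.
have [|y /andP[y1 _] /rootP py] := @poly_ivt R p 1 u (ltW u_gt1).
  by rewrite (ltW p1) pu.
exists y; last by move: py; rewrite pE => /eqP; rewrite oppr_eq0 => /eqP.
rewrite lt_neqAle y1 andbT; apply: contraTneq p1 => ->.
by rewrite py ltxx.
Qed.

Lemma kahler_cubic_inj y (g1 g2 : R) :
  kahler_cubic y g1 = 0 -> kahler_cubic y g2 = 0 -> g1 = g2.
Proof.
rewrite /kahler_cubic => h1 h2.
have u0 : u != 0 by rewrite gt_eqF// (lt_trans _ u_gt1).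
by apply: (mulfI u0); apply: oppr_inj; apply: (addrI (y ^+ 2 * (u - y))); rewrite h1 h2.
Qed.

End PrincipalCurvatures.

(** * A linear isometry matching two points of the sphere in w^perp *)

Section Intertwiner.
Context {R : realType} {n : nat}.
Local Notation E := 'rV[R]_(n + n).
Variable eta : E.
Hypothesis eta1 : dotE eta eta = 1.
Variable P : {linear E -> E}.
Hypotheses (PK : forall X, P (P X) = P X)
  (P_sym : forall X Y, dotE (P X) Y = dotE X (P Y))
  (P_eta : P eta = 0) (P_Jeta : P (Jmap eta) = 0).
Variable r : R.
Local Notation t0 := (tau r).
Local Notation F := (tangF P).
Local Notation G := (tangG P).
Implicit Types (X Y xi : E).

Lemma reflection_im v X : P v = v -> P (reflection v X) = reflection v (P X).
Proof. by move=> Pv; rewrite /reflection linearB linearZ /= P_sym Pv. Qed.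

Lemma reflection_ker v X : P v = 0 -> P (reflection v X) = reflection v (P X).
Proof.
by move=> Pv; rewrite /reflection linearB linearZ /= P_sym Pv dotE0r scaler0 mulr0 mul0r scale0r.
Qed.

Variables xi1 xi2 : E.
Hypotheses (Pxi1 : P xi1 = xi1) (Pxi2 : P xi2 = xi2).
Hypotheses (n1 : dotE xi1 xi1 = t0 ^+ 2) (n2 : dotE xi2 xi2 = t0 ^+ 2).
Hypothesis G12 : dotE (G xi1) (G xi1) = dotE (G xi2) (G xi2).

Let v1 := xi1 - xi2.
Let v2 := reflection v1 (F xi1) - F xi2.
Let v3 := G xi1 - G xi2.

(** The reflections carry in turn xi1 to xi2, the image of F xi1 to F xi2, and G xi1 to G xi2; each
    later mirror vector is orthogonal to what is already in place. The product need not commute with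
    J, but the shape operator involves J only through J xi and J eta. *)
Definition intertwiner X : E := reflection v3 (reflection v2 (reflection v1 X)).
Definition intertwiner_inv X : E := reflection v1 (reflection v2 (reflection v3 X)).

Let Pv1 : P v1 = v1. Proof. by rewrite linearB /= Pxi1 Pxi2. Qed.

Let Pv2 : P v2 = v2.
Proof. by rewrite linearB /= reflection_im// !(PF PK). Qed.

Let Pv3 : P v3 = 0. Proof. by rewrite linearB /= !(PG PK) subrr. Qed.

Let R1xi : reflection v1 xi1 = xi2.
Proof. by apply: reflection_swap; rewrite n1 n2. Qed.

Let F12 : dotE (F xi1) (F xi1) = dotE (F xi2) (F xi2).
Proof. by rewrite (dot_FFGG PK P_sym n1) (dot_FFGG PK P_sym n2) G12. Qed.

Lemma intertwiner_linear : linear intertwiner.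
Proof. by move=> a X Y; rewrite /intertwiner !reflection_linear. Qed.

Lemma intertwiner_inv_linear : linear intertwiner_inv.
Proof. by move=> a X Y; rewrite /intertwiner_inv !reflection_linear. Qed.

Lemma intertwinerK X : intertwiner_inv (intertwiner X) = X.
Proof. by rewrite /intertwiner_inv /intertwiner !reflectionK. Qed.

Lemma intertwinerVK X : intertwiner (intertwiner_inv X) = X.
Proof. by rewrite /intertwiner_inv /intertwiner !reflectionK. Qed.

Lemma intertwiner_dot X Y : dotE (intertwiner X) (intertwiner Y) = dotE X Y.
Proof. by rewrite /intertwiner !reflection_dot. Qed.

Lemma intertwiner_P X : P (intertwiner X) = intertwiner (P X).
Proof. by rewrite /intertwiner reflection_ker// !reflection_im. Qed.

Lemma intertwiner_xi : intertwiner xi1 = xi2.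
Proof.
rewrite /intertwiner R1xi (reflection_id (v := v2)) ?(reflection_id (v := v3)) //.
  exact: (dot_im_ker P_sym Pxi2 Pv3).
rewrite dotEDr dotENr -{1}R1xi reflection_dot (dotEC xi1) (dot_Fxi P_sym Pxi1).
by rewrite (dotEC xi2) (dot_Fxi P_sym Pxi2) subrr.
Qed.

Lemma intertwiner_F : intertwiner (F xi1) = F xi2.
Proof.
rewrite /intertwiner reflection_swap ?reflection_dot//.
by apply: reflection_id; exact: (dot_im_ker P_sym (PF PK _) Pv3).
Qed.

Lemma intertwiner_G : intertwiner (G xi1) = G xi2.
Proof.
have k v : P v = v -> dotE (G xi1) v = 0.
  by move=> Pv; rewrite dotEC; exact: (dot_im_ker P_sym Pv (PG PK _)).
rewrite /intertwiner (reflection_id (k _ Pv1)) (reflection_id (k _ Pv2)).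
exact: reflection_swap.
Qed.

Lemma intertwiner_Jeta : intertwiner (Jmap eta) = Jmap eta.
Proof.
have k v : P v = v -> dotE (Jmap eta) v = 0.
  by move=> Pv; rewrite dotEC; exact: (dot_im_ker P_sym Pv P_Jeta).
rewrite /intertwiner (reflection_id (k _ Pv1)) (reflection_id (k _ Pv2)).
apply: reflection_id.
rewrite dotEC dotEDl dotENl (dot_GJ PK P_sym P_eta P_Jeta Pxi1).
by rewrite (dot_GJ PK P_sym P_eta P_Jeta Pxi2) subrr.
Qed.

Lemma intertwiner_shape X :
  shape_aux eta P r xi2 (intertwiner X) = intertwiner (shape_aux eta P r xi1 X).
Proof.
have TL := intertwiner_linear.
have [M TE] := linear_mx TL.
have J12 : Jmap xi2 = intertwiner (Jmap xi1).
  by rewrite (JE P xi1) (JE P xi2) -intertwiner_F -intertwiner_G !TE mulmxDl.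
have TD U V : intertwiner (U + V) = intertwiner U + intertwiner V.
  by rewrite !TE mulmxDl.
have TZ k U : intertwiner (k *: U) = k *: intertwiner U.
  by rewrite !TE scalemxAl.
have TN U : intertwiner (- U) = - intertwiner U by rewrite -scaleN1r TZ scaleN1r.
rewrite /shape_aux.
have -> : dotE (intertwiner X) (Jmap eta) = dotE X (Jmap eta).
  by rewrite -{1}intertwiner_Jeta intertwiner_dot.
have -> : dotE (intertwiner X) (Jmap xi2) = dotE X (Jmap xi1).
  by rewrite J12 intertwiner_dot.
have -> : dotE (intertwiner X) (G xi2) = dotE X (G xi1).
  by rewrite -intertwiner_G intertwiner_dot.
rewrite -G12 intertwiner_P -intertwiner_G J12.
set a := dotE X (Jmap eta); set b := dotE X (G xi1); set c := dotE (G xi1) _.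
set d := dotE X (Jmap xi1).
have ZE := intertwiner_Jeta.
move: (P X) (G xi1) (Jmap xi1) a b c d => U V Y a' b c d.
by rewrite !TD !TN !TZ ZE.
Qed.

End Intertwiner.

(** * Constant principal curvatures and constancy of |G xi| *)

Section ConstantCurvatures.
Context {R : realType} {n : nat}.
Local Notation E := 'rV[R]_(n + n).
Local Notation C := R[i].
Local Notation Mat := 'M[C]_(1 + n).
Variable eta : E.
Hypothesis eta1 : dotE eta eta = 1.
Variable P : {linear E -> E}.
Hypotheses (PK : forall X, P (P X) = P X)
  (P_sym : forall X Y, dotE (P X) Y = dotE X (P Y))
  (P_eta : P eta = 0) (P_Jeta : P (Jmap eta) = 0).
Variable W : set E.
Hypothesis W_P : forall z, W z <-> CH z /\ Qz eta P z = 0.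
Hypothesis W_trans : forall z, CH z -> exists A xi,
  [/\ solv eta P A, P xi = xi, CH xi & z = ball_action A xi].
Variable r : R.
Hypothesis r_gt0 : 0 < r.
Local Notation t0 := (tau r).
Local Notation G := (tangG P).
Local Notation shape := (shape_map eta P r).
Local Notation Mr := (tube CH bergman W r).
Local Notation nu := (tube_normal CH bergman W r).
Implicit Types (X Y xi : E).

Lemma shape_map_linear xi : linear (shape xi).
Proof.
move=> k X Y; have PE : P (k *: X + Y) = k *: P X + P Y by rewrite linearP.
rewrite /shape_map PE !dotEDl !dotEZl.
move: (P X) (P Y) (Jmap xi) (Jmap eta) (G xi) => U V Z J g.
move: (dotE X Z) (dotE X J) (dotE X g) (dotE Y Z) (dotE Y J) (dotE Y g) (dotE g g)
  => a1 a2 a3 b1 b2 b3 c.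
move: (1 - t0 ^+ 2)^-1 (kap r) => s k0; apply/rowP => j; rewrite !mxE.
by ring.
Qed.

Lemma shape_map_intertwiner xi1 xi2 X : P xi1 = xi1 -> P xi2 = xi2 ->
  dotE xi1 xi1 = t0 ^+ 2 -> dotE xi2 xi2 = t0 ^+ 2 ->
  dotE (G xi1) (G xi1) = dotE (G xi2) (G xi2) ->
  shape xi2 (intertwiner P xi1 xi2 X) = intertwiner P xi1 xi2 (shape xi1 X).
Proof.
move=> P1 P2 n1 n2 G12.
have shE xi Z : shape xi Z =
    kap r *: ((t0 ^+ 2 / (1 - t0 ^+ 2)) *: Z + shape_aux eta P r xi Z).
  by rewrite /shape_map /shape_aux (mulrC (1 - t0 ^+ 2)^-1) [in RHS]addrC.
have TL := intertwiner_linear P xi1 xi2; have [M TE] := linear_mx TL.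
rewrite !shE (intertwiner_shape PK P_sym P_eta P_Jeta P1 P2 n1 n2 G12).
move: (shape_aux _ _ _ _ _) => Z.
by rewrite !TE -scalemxAl mulmxDl -scalemxAl.
Qed.

Definition curvature_space (x : R) xi : set E :=
  [set X | dotE X xi = 0 /\ x *: X = shape xi X].

Lemma curvature_space_linear x xi : linear_set (curvature_space x xi).
Proof.
have [M sE] := linear_mx (shape_map_linear xi).
split=> [|X Y [X0 eX] [Y0 eY]|k X [X0 eX]]; split.
- by rewrite dotE0l.
- by rewrite sE mul0mx scaler0.
- by rewrite dotEDl X0 Y0 addr0.
- by rewrite sE mulmxDl -!sE -eX -eY scalerDr.
- by rewrite dotEZl X0 mulr0.
- by rewrite sE -scalemxAl -sE -eX !scalerA mulrC.
Qed.

Lemma tube_xi xi : P xi = xi -> dotE xi xi = t0 ^+ 2 -> Mr xi.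
Proof.
move=> Pxi n1; apply/(tubeP eta1 PK P_sym P_eta P_Jeta W_P W_trans r_gt0).
exists 1%:M, xi; split=> //; last by rewrite ball_action1.
by exists 1, 0; split; [exact: shaped1 | rewrite linear0].
Qed.

Lemma shape_operator_spaceE xi x : P xi = xi -> dotE xi xi = t0 ^+ 2 ->
  [set X | shape_operator bergman nu xi X (x *: X)] = curvature_space x xi.
Proof.
move=> Pxi n1; apply/seteqP; split=> X /=;
  by rewrite (shape_operatorP eta1 PK P_sym P_eta P_Jeta W_P W_trans r_gt0 Pxi n1).
Qed.

Lemma shape_operator_space_action A xi x k : solv eta P A -> CH xi ->
  has_dim [set X | shape_operator bergman nu xi X (x *: X)] k ->
  has_dim [set X | shape_operator bergman nu (ball_action A xi) X (x *: X)] k.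
Proof.
move=> sA xiB; have AU := solv_unitary sA.
have sV := solvV sA; have VU := solv_unitary sV.
have qB : CH (ball_action A xi) by exact: (ball_action_CH AU xiB).
have Dlin B z : unitary B -> CH z -> linear (dball_action B z).
  by move=> BU zB a X Y; rewrite -!cscale_real dball_action_lin.
apply: (@has_dim_transport _ _ _ _ (dball_action A xi)
  (dball_action (unitary_inv A) (ball_action A xi))).
- exact: Dlin.
- exact: Dlin.
- by move=> X; exact: dball_actionK.
- move=> X; have := dball_actionVK X AU qB; rewrite ball_actionK//.
- move=> X /= sX; rewrite -dball_actionZ//.
  exact: (shape_operator_action eta1 PK P_sym P_eta P_Jeta W_P W_trans r_gt0).
- move=> X /= sX; rewrite -dball_actionZ//.
  have := shape_operator_action eta1 PK P_sym P_eta P_Jeta W_P W_trans r_gt0 sV sX.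
  by rewrite ball_actionK.
Qed.

(** Once the two values are ordered, the smaller one is less than tau^2, because the larger one is
    at most |J xi2|^2 = tau^2. So [cubic_root] applies at xi1, the principal curvature it yields
    must also occur at xi2, and the same y solves both cubics, which are injective in |G xi|^2. *)
Lemma tangG_constant :
  constant_principal_curvatures bergman Mr nu ->
  forall xi1 xi2, P xi1 = xi1 -> P xi2 = xi2 ->
    dotE xi1 xi1 = t0 ^+ 2 -> dotE xi2 xi2 = t0 ^+ 2 ->
    dotE (G xi1) (G xi1) = dotE (G xi2) (G xi2).
Proof.
move=> [mult multP] xi1 xi2.
wlog: xi1 xi2 / dotE (G xi1) (G xi1) < dotE (G xi2) (G xi2).
  move=> lt_eq P1 P2 n1 n2.
  have [lt|lt|//] := ltgtP (dotE (G xi1) (G xi1)) (dotE (G xi2) (G xi2)).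
    exact: lt_eq.
  by apply: esym; exact: lt_eq.
move=> g12 P1 P2 n1 n2.
have g1t : dotE (G xi1) (G xi1) < t0 ^+ 2.
  apply: (lt_le_trans g12); rewrite -subr_ge0 -(dot_FFGG PK P_sym n2).
  exact: dotE_ge0.
have [y y1 cub] := cubic_root r_gt0 (dotE_ge0 _) g1t.
have [X [X0 Xx eX]] := cubic_eigenvalue eta1 PK P_sym P_eta P_Jeta P1 n1 y1 g1t cub.
pose x := kap r * (t0 ^+ 2 / (1 - t0 ^+ 2) + y).
have := multP _ (tube_xi P1 n1) x; rewrite shape_operator_spaceE// => d1.
have := multP _ (tube_xi P2 n2) x; rewrite shape_operator_spaceE// => d2.
have m0 : (0 < mult x)%N.
  apply: (has_dim_neq0 d1 (X := X)) => //; split=> //.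
  by apply/esym; apply/shape_eigenP.
have [Y [Yx /esym /shape_eigenP eY] Y0] := has_dim_gt0 d2 m0.
have cub2 := eigenvalue_cubic eta1 PK P_sym P_eta P_Jeta r_gt0 P2 n2 y1 Y0 (eY r_gt0).
exact: (kahler_cubic_inj r_gt0 cub cub2).
Qed.

(** The multiplicities are read off at one point xi0 of the sphere; the intertwiner and the group
    transport the eigenspaces to every other point of the tube. *)
Lemma constant_curvatures_tangG :
  (forall xi1 xi2, P xi1 = xi1 -> P xi2 = xi2 ->
    dotE xi1 xi1 = t0 ^+ 2 -> dotE xi2 xi2 = t0 ^+ 2 ->
    dotE (G xi1) (G xi1) = dotE (G xi2) (G xi2)) ->
  constant_principal_curvatures bergman Mr nu.
Proof.
move=> G_cst; pose Mxi xi := P xi = xi /\ dotE xi xi = t0 ^+ 2.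
have tubeE q : Mr q -> exists A xi, [/\ solv eta P A, Mxi xi & q = ball_action A xi].
  move=> /(tubeP eta1 PK P_sym P_eta P_Jeta W_P W_trans r_gt0)[A [xi [sA Pxi n1 ->]]].
  by exists A, xi.
have [[xi0 [P0 n0]]|no_xi] := pselect (exists xi, Mxi xi); last first.
  (* Without a point on the sphere the tube is empty. *)
  exists (fun=> 0%N) => q /tubeE[A [xi [_ Mx _]]].
  by case: no_xi; exists xi.
have dims x := cid (linear_set_has_dim (curvature_space_linear x xi0)).
exists (fun x => projT1 (dims x)) => q /tubeE[A [xi [sA [Pxi n1] ->]]] x.
case: (dims x) => /= k dk.
apply: shape_operator_space_action => //; first exact: CH_tau n1.
rewrite shape_operator_spaceE//.
have G12 := G_cst _ _ P0 Pxi n0 n1.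
have TL := intertwiner_linear P xi0 xi; have VL := intertwiner_inv_linear P xi0 xi.
have [M TE] := linear_mx TL.
have Txi : intertwiner P xi0 xi xi0 = xi :=
  (intertwiner_xi PK P_sym P0 Pxi n0 n1).
apply: (has_dim_transport TL VL _ _ _ _ dk).
- by move=> X; exact: intertwinerK.
- by move=> X; exact: intertwinerVK.
- move=> X [X0 eX]; split; first by rewrite -[in X in dotE _ X]Txi intertwiner_dot.
  rewrite shape_map_intertwiner// -eX.
  by rewrite !TE scalemxAl.
- move=> X; rewrite -{1}(intertwinerVK P xi0 xi X).
  move: (intertwiner_inv P xi0 xi X) => Z [Z0 eZ].
  split; first by move: Z0; rewrite -[in X in dotE _ X]Txi intertwiner_dot.
  apply: (can_inj (intertwinerK P xi0 xi)); rewrite -shape_map_intertwiner// -eZ.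
  by rewrite !TE scalemxAl.
Qed.

End ConstantCurvatures.

(** * The normal space and its Kaehler angle *)

Section NormalSpace.
Context {R : realType} {n : nat}.
Local Notation E := 'rV[R]_(n + n).
Local Notation C := R[i].
Local Notation Mat := 'M[C]_(1 + n).
Implicit Types (X Y : Mat) (u v : E).

(** For v in eta^perp, the element of g_alpha with tangent vector v at o. *)
Definition Xvec (eta v : E) : Mat :=
  locked_with action_key (Xroot (vec_to_complex eta) (vec_to_complex v)).

Lemma XvecE (eta v : E) : Xvec eta v = Xroot (vec_to_complex eta) (vec_to_complex v).
Proof. exact: locked_withE. Qed.

Lemma XvecD (eta : E) u v : Xvec eta (u + v) = Xvec eta u + Xvec eta v.
Proof.
rewrite !XvecE /Xroot vec_to_complexD; move: (vec_to_complex _) (vec_to_complex _) => c d.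
rewrite adjD add_block_mx addr0 mulmxDr mulmxDl opprD addrACA.
by [].
Qed.

Lemma XvecZ (eta : E) (t : R) v : Xvec eta (t *: v) = t%:C *: Xvec eta v.
Proof.
rewrite !XvecE /Xroot vec_to_complexZ; move: (vec_to_complex _) => c.
by rewrite adjZr scale_block_mx scaler0 scalerBr -scalemxAl -scalemxAr.
Qed.

Lemma Xvec0 (eta : E) : Xvec eta 0 = 0.
Proof. by rewrite -(scale0r 0) XvecZ scale0r. Qed.

Lemma vec_at_o_Xvec (eta : E) v : vec_at_o (Xvec eta v) = v.
Proof. by rewrite /vec_at_o XvecE block_mxKdl vec_to_complexK. Qed.

Lemma Xvec_eq0 (eta : E) v : (Xvec eta v == 0) = (v == 0).
Proof.
apply/eqP/eqP => [e|->]; last exact: Xvec0.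
apply: (etrans (esym (vec_at_o_Xvec eta v))).
by rewrite e -(Xvec0 eta); exact: vec_at_o_Xvec.
Qed.

Lemma Xvec_inj (eta : E) : injective (Xvec eta).
Proof. exact: can_inj (vec_at_o_Xvec eta). Qed.

Lemma innerE X Y : inner X Y = 4 * dotE (vec_at_o X) (vec_at_o Y).
Proof. exact: bergman0E. Qed.

Lemma innerJE X Y : innerJ X Y = 4 * dotE (Jmap (vec_at_o X)) (vec_at_o Y).
Proof. exact: bergman0E. Qed.

Lemma inner_Xvec (eta : E) u v : inner (Xvec eta u) (Xvec eta v) = 4 * dotE u v.
Proof. by rewrite innerE; congr (_ * dotE _ _); exact: vec_at_o_Xvec. Qed.

Lemma innerJ_Xvec (eta : E) u v : innerJ (Xvec eta u) (Xvec eta v) = 4 * dotE (Jmap u) v.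
Proof. by rewrite innerJE; congr (_ * dotE (Jmap _) _); exact: vec_at_o_Xvec. Qed.

Lemma hE_eq0P (u v : E) : hE u v = 0 <-> dotE u v = 0 /\ dotE u (Jmap v) = 0.
Proof.
split=> [h|[h1 h2]]; last by rewrite /hE h1 h2.
by split; [exact: (congr1 (@complex.Re R) h) | exact: (congr1 (@complex.Im R) h)].
Qed.

Variables (eta : E) (V w : set Mat).
Hypothesis VE : forall X, V X <-> exists2 v, hE v eta = 0 & X = Xvec eta v.
Hypothesis w_sub : real_subspace w.
Hypothesis wV : w `<=` V.

(** P projects onto the vectors of eta^perp orthogonal to w. The projection Q onto w serves to show
    that w is the whole kernel of P in eta^perp: if P v = 0, then v - Q v lies in the range of P and
    is killed by P, so it vanishes. *)
Lemma normal_projection : exists P : {linear E -> E},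
  [/\ (forall v, P (P v) = P v) /\ (forall u v, dotE (P u) v = dotE u (P v)),
      P eta = 0, P (Jmap eta) = 0,
      forall X, w X <-> exists v, [/\ hE v eta = 0, P v = 0 & X = Xvec eta v] &
      forall X, ortho_in V w X <-> exists2 v, P v = v & X = Xvec eta v].
Proof.
have [w0 wD wZ] := w_sub.
pose wt : set E := [set v | w (Xvec eta v)].
pose U : set E := [set v | hE v eta = 0 /\ forall y, wt y -> dotE v y = 0].
have wt_lin : linear_set wt.
  split=> [|u v|t v]; rewrite /wt /=.
  - by rewrite Xvec0.
  - by rewrite XvecD; exact: wD.
  - by rewrite XvecZ; exact: wZ.
have wt_eta v : wt v -> hE v eta = 0.
  by move=> /wV /VE[v' ve] /Xvec_inj ->.
have U_lin : linear_set U.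
  split=> [|u v [u0 uy] [v0 vy]|t v [v0 vy]]; split.
  - by rewrite hE0l.
  - by move=> y _; rewrite dotE0l.
  - by rewrite hEDl u0 v0 addr0.
  - by move=> y wy; rewrite dotEDl uy// vy// addr0.
  - by rewrite hEZl v0 mulr0.
  - by move=> y wy; rewrite dotEZl vy// mulr0.
have [P [PK P_sym UP PU]] := orthogonal_projection U_lin.
have [Q [QK Q_sym wQ Qw]] := orthogonal_projection wt_lin.
have P0 v : dotE (P v) v = 0 -> P v = 0.
  by move=> e; apply/eqP; rewrite -dotE_eq0 P_sym PK dotEC e.
have Pwt v : wt v -> P v = 0.
  by move=> wv; apply: P0; have [_ ->] := UP v.
have wtE v : wt v <-> hE v eta = 0 /\ P v = 0.
  split=> [wv|[ve Pv]]; first by split; [exact: wt_eta | exact: Pwt].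
  have dU : U (v - Q v).
    split=> [|y wy]; first by rewrite hEDl hENl ve (wt_eta _ (wQ v)) subrr.
    by rewrite dotEDl dotENl Q_sym (Qw _ wy) subrr.
  have := PU _ dU; rewrite linearB /= Pv (Pwt _ (wQ v)) subrr => /esym/eqP.
  by rewrite subr_eq0 => /eqP ->; exact: wQ.
exists P; split=> //.
- by apply: P0; have [/hE_eq0P[]] := UP eta.
- by apply: P0; have [/hE_eq0P[]] := UP (Jmap eta).
- move=> X; split=> [wX|[v [ve Pv ->]]]; last by apply/wtE.
  have /VE[v ve XE] := wV wX; exists v; split=> //.
  by apply: Pwt; rewrite /wt /= -XE.
- move=> X; split=> [[/VE[v ve ->] Xw]|[v Pv ->]].
    exists v => //; apply: PU; split=> // y wy.
    by have := Xw _ wy; rewrite inner_Xvec => /eqP; rewrite mulf_eq0 pnatr_eq0/= => /eqP.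
  have [ve vw] : U v by rewrite -Pv; exact: UP.
  split; first by apply/VE; exists v.
  move=> Y wY; have /VE[y ye YE] := wV wY.
  by rewrite YE inner_Xvec vw ?mulr0// /wt /= -YE.
Qed.

End NormalSpace.

(** * The Kaehler angle in terms of F *)

Section KahlerAngle.
Context {R : realType} {n : nat}.
Local Notation E := 'rV[R]_(n + n).
Local Notation C := R[i].
Local Notation Mat := 'M[C]_(1 + n).
Variable eta : E.
Variable P : {linear E -> E}.
Hypotheses (PK : forall X, P (P X) = P X)
  (P_sym : forall X Y, dotE (P X) Y = dotE X (P Y)).
Variable V : set Mat.
Hypothesis VE : forall X, V X <-> exists2 v, P v = v & X = Xvec eta v.
Local Notation F := (tangF P).
Local Notation G := (tangG P).

Lemma inner_XvecP (u v : E) (k : R) :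
  inner (Xvec eta u) (Xvec eta u) = k * inner (Xvec eta v) (Xvec eta v) <->
  dotE u u = k * dotE v v.
Proof.
have eq4 (a b A B : R) : A = 4 * a -> B = 4 * b -> A = k * B <-> a = k * b.
  move=> -> ->; rewrite mulrCA; split=> [|->//].
  by apply: mulfI; rewrite pnatr_eq0.
exact: eq4 (inner_Xvec _ _ _) (inner_Xvec _ _ _).
Qed.

(** The projection of J v is characterised by its products with V; testing on f - F v, which
    corresponds to an element of V, identifies it with F v. *)
Lemma is_kahler_angleE (v : E) (phi : R) : P v = v ->
  is_kahler_angle V (Xvec eta v) phi <->
  [/\ 0 <= phi, phi <= pi / 2 & dotE (F v) (F v) = cos phi ^+ 2 * dotE v v].
Proof.
move=> Pv; split=> [[phi0 phi1 [Z [/VE[f Pf ->] JF nF]]]|[phi0 phi1 nF]]; split=> //.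
  have fE : f = F v.
    apply/eqP; rewrite -subr_eq0 -dotE_eq0; apply/eqP.
    have Pd : P (f - F v) = f - F v by rewrite linearB /= Pf PK.
    have Vd : V (Xvec eta (f - F v)) by apply/VE; exists (f - F v).
    have := JF _ Vd; rewrite innerJ_Xvec inner_Xvec => /(mulfI _) => e.
    have {}e : dotE (Jmap v) (f - F v) = dotE f (f - F v).
      by apply: e; rewrite pnatr_eq0.
    by rewrite dotEDl dotENl -e -{1}Pd -P_sym subrr.
  by rewrite -fE; apply/inner_XvecP.
exists (Xvec eta (F v)); split.
- by apply/VE; exists (F v); rewrite ?PK.
- by move=> Y /VE[y Py ->]; rewrite innerJ_Xvec inner_Xvec P_sym Py.
- by apply/inner_XvecP.
Qed.

(** F is homogeneous, so the ratio |F v|^2 / |v|^2 is constant on w^perp as soon as |F v| is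
    constant on one sphere. The ratio lies in [0, 1] because F is J followed by a projection, and
    the angle is the arc cosine of its square root. *)
Lemma constant_kahler_angleP (t : R) : 0 < t ->
  (forall xi1 xi2, P xi1 = xi1 -> P xi2 = xi2 ->
    dotE xi1 xi1 = t ^+ 2 -> dotE xi2 xi2 = t ^+ 2 ->
    dotE (F xi1) (F xi1) = dotE (F xi2) (F xi2)) <->
  constant_kahler_angle V.
Proof.
move=> t0; split=> [F_cst|[phi phiP] xi1 xi2 P1 P2 n1 n2]; last first.
  have FE xi : P xi = xi -> dotE xi xi = t ^+ 2 ->
      dotE (F xi) (F xi) = cos phi ^+ 2 * t ^+ 2.
    move=> Pxi nxi.
    have Vx : V (Xvec eta xi) by apply/VE; exists xi.
    have x0 : Xvec eta xi != 0.
      by rewrite Xvec_eq0 -dotE_gt0 nxi exprn_gt0.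
    by have /(is_kahler_angleE _ Pxi)[_ _ ->] := phiP _ Vx x0; rewrite nxi.
  by rewrite !FE.
have F_scale (c : R) v : F (c *: v) = c *: F v by rewrite /tangF JmapZ linearZ.
have F_le v : dotE (F v) (F v) <= dotE v v.
  have : 0 <= dotE (Jmap v - F v) (Jmap v - F v) by exact: dotE_ge0.
  have : dotE (Jmap v) (F v) = dotE (F v) (F v) by rewrite [in RHS]P_sym PK.
  rewrite -(dotEJJ v v) => e; rewrite !dotE_lin (dotEC (F v) (Jmap v)) e.
  by lra.
have [[v0 [Pv0 v00]]|no_v] := pselect (exists v, P v = v /\ v != 0); last first.
  (* Without a nonzero vector in the range of P every angle satisfies the condition. *)
  exists 0 => X /VE[v Pv ->]; rewrite Xvec_eq0 => v0.
  by case: no_v; exists v.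
pose f0 := dotE (F v0) (F v0) / dotE v0 v0.
have nv0 : 0 < dotE v0 v0 by rewrite dotE_gt0.
have f00 : 0 <= f0 by rewrite divr_ge0// ?dotE_ge0// ltW.
have f01 : f0 <= 1 by rewrite ler_pdivrMr// mul1r.
have s0 : 0 <= Num.sqrt f0 by exact: sqrtr_ge0.
have s1 : Num.sqrt f0 <= 1 by rewrite -sqrtr1 ler_wsqrtr.
have s11 : -1 <= Num.sqrt f0 <= 1 by rewrite s1 andbT (le_trans _ s0)// lerN10.
pose phi := acos (Num.sqrt f0).
have cphi : cos phi = Num.sqrt f0 by exact: acosK.
have phi0 : 0 <= phi by exact: acos_ge0.
have phi1 : phi <= pi / 2.
  rewrite leNgt; apply/negP => lt.
  have : cos phi < cos (pi / 2).
    rewrite ltr_cos ?in_itv //=.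
    - by rewrite divr_ge0 ?pi_ge0//= ler_pdivrMr// ler_peMr ?pi_ge0// ler1n.
    - by rewrite phi0 acos_lepi.
  by rewrite cos_pihalf cphi ltNge s0.
exists phi => X /VE[v Pv ->]; rewrite Xvec_eq0 => vn0.
apply/is_kahler_angleE => //; split=> //; rewrite cphi sqr_sqrtr//.
pose c (u : E) : R := t / Num.sqrt (dotE u u).
have cP u : u != 0 -> dotE (c u *: u) (c u *: u) = t ^+ 2 /\
    dotE (F (c u *: u)) (F (c u *: u)) = t ^+ 2 * (dotE (F u) (F u) / dotE u u).
  move=> u0; have nu : 0 < dotE u u by rewrite dotE_gt0.
  have cc : c u * c u = t ^+ 2 / dotE u u.
    by rewrite -expr2 exprMn exprVn sqr_sqrtr// ltW.
  rewrite F_scale; move: (c u) cc => d cc.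
  rewrite !dotEZl !dotEZr !mulrA cc; split; first by rewrite divfK// gt_eqF.
  by rewrite mulrAC.
have [n0 F0] := cP _ v00; have [n1 F1] := cP _ vn0.
have Pc u : P u = u -> P (c u *: u) = c u *: u by move=> Pu; rewrite linearZ /= Pu.
have := F_cst _ _ (Pc _ Pv0) (Pc _ Pv) n0 n1.
rewrite F0 F1 => /(mulfI _) e; rewrite /f0 e; first by rewrite divfK// dotE_eq0.
by rewrite expf_neq0// gt_eqF.
Qed.

End KahlerAngle.

Theorem mainTheorem2 (R : realType) (n : nat) (n_ge2 : (2 <= n)%N)
    (a : set 'M[R[i]]_(1 + n)) (a_max : maximal_abelian a)
    (alpha : 'M[R[i]]_(1 + n) -> R) (alpha_root : simple_root a alpha)
    (w : set 'M[R[i]]_(1 + n)) (w_sub : real_subspace w)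
    (w_proper : w `<=` root_space a alpha /\ w <> root_space a alpha) :
  forall r : R, 0 < r ->
    constant_principal_curvatures bergman
      (tube CH bergman (W_orbit a alpha w) r)
      (tube_normal CH bergman (W_orbit a alpha w) r)
    <-> constant_kahler_angle (ortho_in (root_space a alpha) w).
Proof.
move=> r r0; have [e [e1 aE VE ZE]] := root_data a_max alpha_root.
pose eta := vec_of_complex e.
have eE : vec_to_complex eta = e by exact: vec_of_complexK.
have eta1 : dotE eta eta = 1.
  by have := e1; rewrite iprod_hE hExx => /(congr1 (@complex.Re R)).
have VX X : root_space a alpha X <-> exists2 v, hE v eta = 0 & X = Xvec eta v.
  rewrite VE root_spaceX//; split=> [[c ce ->]|[v ve ->]].
    exists (vec_of_complex c); first by rewrite -iprod_hE.
    by rewrite XvecE eE vec_of_complexK.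
  exists (vec_to_complex v); last by rewrite XvecE eE.
  by rewrite iprod_hE vec_to_complexK.
have [wV _] := w_proper.
have [P [[PK P_sym] P_eta P_Jeta wE nE]] := normal_projection VX w_sub wV.
have hE_alg X : s_alg a alpha w X <-> exists t v k,
    [/\ hE v eta = 0, P v = 0, k^* = - k &
      X = t%:C *: pH (vec_to_complex eta) + nilp eta v k].
  rewrite eE; split=> [[H [U [Z [/aE[t ->] /wE[v [ve Pv ->]] +]]]]|].
    move=> /ZE /(root_spaceZ _ e1)[k [kc ->]] ->; exists t, v, k; split=> //.
    by rewrite /nilp XvecE eE addrA.
  move=> [t [v [k [ve Pv kc ->]]]].
  exists (t%:C *: pH e), (Xvec eta v), (Zroot e k); split.
  - by apply/aE; exists t.
  - by apply/wE; exists v.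
  - by apply/ZE/root_spaceZ => //; exists k.
  - by rewrite /nilp XvecE eE addrA.
have W_P z : W_orbit a alpha w z <-> CH z /\ Qz eta P z = 0.
  exact: (orbitP eta1 PK P_sym P_eta P_Jeta hE_alg).
have W_trans z : CH z -> exists A xi,
    [/\ solv eta P A, P xi = xi, CH xi & z = ball_action A xi].
  move=> /(connected_transitive eta1 PK P_sym P_eta P_Jeta hE_alg).
  move=> [A [xi [hA Pxi xiB ->]]]; exists A, xi; split=> //.
  exact: (connected_shaped eta1 hE_alg hA).
(* Since |F xi|^2 + |G xi|^2 = |J xi|^2, the two lengths are constant together: the principal
   curvatures see G, the Kaehler angle sees F. *)
have FG xi : dotE xi xi = tau r ^+ 2 -> dotE (tangF P xi) (tangF P xi) =
    tau r ^+ 2 - dotE (tangG P xi) (tangG P xi) by exact: dot_FFGG.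
rewrite -(constant_kahler_angleP PK P_sym nE (tau_gt0 r0)); split=> cst.
  move=> xi1 xi2 P1 P2 n1 n2; rewrite !FG//; congr (_ - _).
  exact: (tangG_constant eta1 PK P_sym P_eta P_Jeta W_P W_trans r0 cst).
apply: (constant_curvatures_tangG eta1 PK P_sym P_eta P_Jeta W_P W_trans r0).
move=> xi1 xi2 P1 P2 n1 n2; have := cst _ _ P1 P2 n1 n2.
by rewrite !FG// => /addrI/oppr_inj.
Qed.
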